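(* Let $(X,.)$ be an $n$-space. For every continuous linear functional $\varphi\colon C^*(X,.)\to\mathbb{C}$ there exists a unique $\mu\in\mathcal{M}(X,.)$ such that $\varphi(f)=\int f\,d\mu$ for all $f\in C^*(X,.)$.
   Context: $M_n$ = complex $n\times n$ matrices, $\mathcal{U}_n$ its unitary group, $\mathbb{U}_n=\mathcal{U}_n/(\mathbb{T}I)$; for $\mathfrak{u}\in\mathbb{U}_n$, $A\in M_n$, $\mathfrak{u}.A=UAU^{-1}$ with $U$ a representative of $\mathfrak{u}$. An $n$-space is a locally compact Hausdorff space $X$ with a continuous free action $(\mathfrak{u},x)\mapsto\mathfrak{u}.x$ of $\mathbb{U}_n$. $C^*(X,.)$ is the $C^*$-algebra of continuous $f\colon X\to M_n$ vanishing at infinity with $f(\mathfrak{u}.x)=\mathfrak{u}.f(x)$. For a Borel set $A$, $\mathfrak{u}.A=\{\mathfrak{u}.a:a\in A\}$. An $n$-measure is a matrix $\mu=[\mu_{jk}]$ of regular complex Borel measures on $X$ with $\mu(\mathfrak{u}.A)=\mathfrak{u}.\mu(A)$ for all $\mathfrak{u}$ and Borel $A$, where $\mu(A)=[\mu_{jk}(A)]$; $\mathcal{M}(X,.)$ is the set of all $n$-measures. For bounded Borel $f=[f_{jk}]\colon X\to M_n$, $\int f\,d\mu=\sum_{j,k}\int_X f_{jk}\,d\mu_{kj}$. *)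

(* Defs.v *)
(* C = R[i] (complex numbers over an
   abstract real field R : realType), from mathcomp-real-closed. *)
From HB Require Import structures.
From mathcomp Require Import all_boot all_order all_algebra.
From mathcomp Require Import all_classical all_reals all_analysis.
From mathcomp Require Import complex.
Set Implicit Arguments.
Unset Strict Implicit.
Unset Printing Implicit Defensive.
Import Order.TTheory GRing.Theory Num.Theory.
Import numFieldNormedType.Exports.
Local Open Scope classical_set_scope.
Local Open Scope ring_scope.

(* The usual (Euclidean, |z - w|) metric topology on C = R[i]; matrices
   'M[C]_n then carry the product (entrywise) topology. *)
HB.instance Definition _ (R : realType) := PseudoPointedMetric.copy R[i] (R[i])^o.

Section Defs.
Variable R : realType.
Local Notation C := R[i].
Variable n : nat.

(* conjugate transpose and the unitary group U_n *)
Definition adjmx (A : 'M[C]_n) : 'M[C]_n := (map_mx (fun z : C => z^*) A)^T.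
Definition unitary (U : 'M[C]_n) : Prop := U *m adjmx U = 1%:M.

(* u.A = U A U^{-1} *)
Definition mxconj (U A : 'M[C]_n) : 'M[C]_n := U *m A *m invmx U.

Variable X : topologicalType.

(* An action of the projective unitary group  U_n / (T I)  on X is encoded as
   a map  act : 'M_n -> X -> X  which, on unitary matrices, is an action of U_n
   that is trivial on the scalars T I (hence factors through the quotient).
   Continuity of the quotient action is continuity of the lifted action on
   U_n x X (U_n -> U_n/(T I) is an open quotient map).  Freeness: u.x = x
   forces u to be the identity class, i.e. U is a scalar matrix. *)
Definition nspace (act : 'M[C]_n -> X -> X) : Prop :=
  [/\ hausdorff_space X, locally_compact [set: X],
      (forall x, act 1%:M x = x),
      (forall U V x, unitary U -> unitary V -> act (U *m V) x = act U (act V x)) &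
      (forall (c : C) U x, `|c| = 1 -> unitary U -> act (c *: U) x = act U x)] /\
  {within [set p : 'M[C]_n * X | unitary p.1],
     continuous (fun p : 'M[C]_n * X => act p.1 p.2)} /\
  (forall U x, unitary U -> act U x = x -> exists c : C, U = c%:M).

(* f vanishes at infinity *)
Definition vanishing_at_infinity (f : X -> 'M[C]_n) : Prop :=
  forall e : C, 0 < e ->
    exists K : set X, compact K /\ forall x, ~ K x -> `|f x| < e.

(* C^*(X,.) *)
Definition Cstar (act : 'M[C]_n -> X -> X) : set (X -> 'M[C]_n) :=
  [set f | [/\ continuous f, vanishing_at_infinity f &
              forall U x, unitary U -> f (act U x) = mxconj U (f x)]].

(* continuous linear functional on C^*(X,.), for the sup norm
   ||f|| = sup_x ||f x|| *)
Definition cont_lin_functional (act : 'M[C]_n -> X -> X)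
    (phi : (X -> 'M[C]_n) -> C) : Prop :=
  [/\ (forall f g, Cstar act f -> Cstar act g -> phi (f \+ g) = phi f + phi g),
      (forall (c : C) f, Cstar act f -> phi (fun x => c *: f x) = c * phi f) &
      (forall f, Cstar act f -> forall e : C, 0 < e ->
         exists2 d : C, 0 < d & forall g, Cstar act g ->
           (forall x, `|g x - f x| <= d) -> `|phi g - phi f| < e)].

(* Borel sets of X *)
Definition borel : set (set X) := <<s @open X >>.

(* complex Borel measure: countably additive C-valued on Borel sets *)
Definition complex_measure (nu : set X -> C) : Prop :=
  forall F : nat -> set X, (forall k, borel (F k)) -> trivIset setT F ->
    (fun N => \sum_(k < N) nu (F k)) @ \oo --> nu (\bigcup_k F k).

(* total variation |nu|(E) = sup of sum |nu(E_i)| over Borel partitions of E *)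
Definition total_variation (nu : set X -> C) (E : set X) : \bar R :=
  ereal_sup [set (s%:E)%E | s in
    [set s : R | exists (k : nat) (P : 'I_k -> set X),
       [/\ (forall i, borel (P i)),
           (forall i j, i != j -> P i `&` P j = set0),
           \bigcup_(i in setT) P i = E &
           s = \sum_(i < k) Normc.normc (nu (P i))]]].

(* regular: |nu| is outer regular (open sets) and inner regular (compacts) *)
Definition regular_cmeasure (nu : set X -> C) : Prop :=
  forall E, borel E ->
    total_variation nu E =
      ereal_inf [set total_variation nu V | V in [set V | open V /\ E `<=` V]]
    /\ total_variation nu E =
      ereal_sup [set total_variation nu K | K in [set K | compact K /\ K `<=` E]].

(* integral of a bounded Borel f : X -> C against a complex measure nu, as the
   uniform limit of the integrals  sum_i c_i nu(E_i)  of Borel simple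
   functions  sum_i c_i 1_{E_i}  *)
Definition is_cintegral (nu : set X -> C) (f : X -> C) (v : C) : Prop :=
  forall e : C, 0 < e -> exists2 d : C, 0 < d &
    forall (k : nat) (c : 'I_k -> C) (E : 'I_k -> set X),
      (forall i, borel (E i)) ->
      (forall x, `|f x - \sum_(i < k) c i * \1_(E i) x| <= d) ->
      `|\sum_(i < k) c i * nu (E i) - v| < e.

Definition cintegral (nu : set X -> C) (f : X -> C) : C :=
  xget 0 [set v | is_cintegral nu f v].

(* n-measures: matrices mu = [mu_jk] of regular complex Borel measures with
   mu(u.A) = u.mu(A) *)
Definition nmeasure (act : 'M[C]_n -> X -> X)
    (mu : 'I_n -> 'I_n -> set X -> C) : Prop :=
  (forall j k, complex_measure (mu j k) /\ regular_cmeasure (mu j k)) /\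
  (forall U A, unitary U -> borel A ->
     \matrix_(j, k) mu j k (act U @` A) = mxconj U (\matrix_(j, k) mu j k A)).

(* int f dmu = sum_{j,k} int f_jk dmu_kj *)
Definition nintegral (mu : 'I_n -> 'I_n -> set X -> C) (f : X -> 'M[C]_n) : C :=
  \sum_(j < n) \sum_(k < n) cintegral (mu k j) (fun x => f x j k).

End Defs.

(* Main.v *)
Require Import Defs.
From HB Require Import structures.
From mathcomp Require Import all_boot all_order all_algebra.
From mathcomp Require Import all_classical all_reals all_analysis.
From mathcomp Require Import complex.
From mathcomp Require Import ring lra.

(* For f in C_0(X, M_n) the average E f (x) = int U^-1 f(U x) U dU over the
   unitary group lies in C^*(X,.), is f itself when f is equivariant, and does
   not change when f is replaced by x |-> V^-1 f(V x) V.  Hence phi o E extends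
   phi to a bounded functional on C_0(X, M_n); applying the Riesz theorem to
   p |-> phi (E (p e_kj)) gives mu_jk.  Invariance of phi o E and uniqueness in
   the Riesz theorem make mu equivariant.  Conversely an n-measure satisfies
   int f dmu = int E f dmu, so it is determined by its values on C^*(X,.).

   The Haar mean is obtained by averaging over finite nets of the unitary group
   for the bi-invariant Frobenius distance: one such average multiplies the
   oscillation by less than 1, uniformly over functions with a common modulus of
   continuity, and right averages commute with left averages.

   The Riesz theorem is proved in the manner of Daniell: a bounded functional
   psi defines an upper integral upint on bounded functions, psi extends to the
   closure of C_0 in the seminorm upint |f|, and the sets whose indicator lies
   in this closure form a sigma-algebra containing the open sets. *)

Set Implicit Arguments.
Unset Strict Implicit.
Unset Printing Implicit Defensive.
Import Order.TTheory GRing.Theory Num.Theory.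
Import numFieldNormedType.Exports.
Local Open Scope classical_set_scope.
Local Open Scope ring_scope.

(** * Continuous functions vanishing at infinity *)

(** Three values are limits without an explicit formula: the extension [ext] of a functional, the
    mean [hmean] and the integral [cintegral]. Each arises in the same way: approximations carry
    error bounds, every lower estimate is at most every upper estimate, and the supremum of the
    lower estimates meets all error bounds at once.

    Explicit error bounds have a second use. The mean over the group is taken at every point of a
    space that need not be compact, and E f must again vanish at infinity. The rate of the finite
    averages depends only on a bound and a modulus common to all points, so E f is a uniform limit
    of finite averages of translates of f. This also yields int E f dmu = int f dmu from invariance
    under single group elements: integrals are never interchanged.

    Equalities between total variations are awkward to add. Regularity is therefore replaced by
    tightness: a compact K inside E and an open V around E with small variation on V minus K. This
    is stable under linear combinations and homeomorphisms, as the entrywise sums in U mu(A) U^-1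
    demand. *)

Lemma directed_compact (T : topologicalType) (K : set T) (F : set (set T)) :
  compact K -> F !=set0 -> (forall V, F V -> open V) ->
  (forall V W, F V -> F W -> exists2 Z, F Z & V `|` W `<=` Z) ->
  (forall x, K x -> exists2 V, F V & V x) ->
  exists2 V, F V & K `<=` V.
Proof.
move=> /compact_near_coveringP cK [V0 FV0] oF dF KF.
(* The filter of tails of the directed family; near-covering along it yields a single member that
   contains [K], in place of a finite subcover. *)
pose G := filter_from F (fun V => [set W | F W /\ V `<=` W]).
have FG : ProperFilter G.
  apply: filter_from_proper; last by move=> V FV; exists V; split.
  apply: filter_from_filter; first by exists V0.
  move=> V W FV FW; have [Z FZ VWZ] := dF V W FV FW.
  exists Z => // Y [FY ZY]; split; split => // x Vx; apply/ZY/VWZ; [by left|by right].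
have H : forall x, K x -> \forall x' \near x & i \near G, F i /\ i x'.
  move=> x /KF[V FV Vx]; exists (V, [set W | F W /\ V `<=` W]) => /=.
    split; first by apply: open_nbhs_nbhs; split => //; exact: oF.
    by exists V.
  by move=> [y W] /= [Vy [FW VW]]; split => //; exact: VW.
have FF : Filter G by exact: _.
have /filter_ex[V KV] := cK _ G (fun V x => F V /\ V x) FF H.
have [[x Kx]|K0] := pselect (K !=set0).
  by exists V; [exact: (KV x Kx).1|move=> y /KV[]].
by exists V0 => // x Kx; exfalso; apply: K0; exists x.
Qed.

Section C0.
Variables (R : realType) (X : topologicalType).
Implicit Types f g : X -> R.

Definition c0 f := continuous f /\
  forall e : R, 0 < e -> exists2 K, compact K & forall x, ~ K x -> `|f x| < e.

Lemma c0_dom f g : continuous f -> c0 g -> (forall x, `|f x| <= `|g x|) -> c0 f.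
Proof.
move=> cf [_ vg] fg; split=> // e /vg[K cK Kg]; exists K => // x /Kg.
exact: le_lt_trans.
Qed.

Lemma c0_0 : c0 (fun=> 0).
Proof.
split; first by move=> x; exact: cvg_cst.
by move=> e e0; exists set0; [exact: compact0|move=> x _; rewrite normr0].
Qed.

Lemma c0_add f g : c0 f -> c0 g -> c0 (fun x => f x + g x).
Proof.
move=> [cf vf] [cg vg]; split; first by move=> x; apply: cvgD; [exact: cf|exact: cg].
move=> e e0; have e20 : 0 < e / 2 by rewrite divr_gt0.
have [K cK Kf] := vf _ e20; have [L cL Lg] := vg _ e20.
exists (K `|` L); first exact: compactU.
move=> x KLx; have /Kf fx : ~ K x by move=> Kx; apply: KLx; left.
have /Lg gx : ~ L x by move=> Lx; apply: KLx; right.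
by rewrite (le_lt_trans (ler_normD _ _))// (splitr e) ltrD.
Qed.

Lemma c0_scale (c : R) f : c0 f -> c0 (fun x => c * f x).
Proof.
move=> [cf vf]; split.
  by move=> x; apply: (@cvgMr _ _ (nbhs x) _ f c (f x)); exact: cf.
move=> e e0; have [K cK Kf] := vf (e / (`|c| + 1)) ltac:(by rewrite divr_gt0// ltr_wpDl).
exists K => // x /Kf; rewrite ltr_pdivlMr ?ltr_wpDl// => H.
rewrite normrM mulrC (le_lt_trans _ H)// ler_wpM2l// lerDl//.
Qed.

Lemma c0_opp f : c0 f -> c0 (fun x => - f x).
Proof.
by move=> /(c0_scale (-1)); congr c0; apply/funext => x; rewrite mulN1r.
Qed.

Lemma c0_sub f g : c0 f -> c0 g -> c0 (fun x => f x - g x).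
Proof. by move=> cf /c0_opp; exact: c0_add. Qed.

Lemma c0_sum (I : Type) (s : seq I) (P : pred I) (F : I -> X -> R) :
  (forall i, P i -> c0 (F i)) -> c0 (fun x => \sum_(i <- s | P i) F i x).
Proof.
move=> cF; elim: s => [|i s IH].
  rewrite (_ : (fun x => _) = fun=> 0); first exact: c0_0.
  by apply/funext => x; rewrite big_nil.
have [Pi|/negbTE Pi] := boolP (P i).
  rewrite (_ : (fun x => _) = fun x => F i x + \sum_(i <- s | P i) F i x).
    by apply: c0_add => //; exact: cF.
  by apply/funext => x; rewrite big_cons Pi.
rewrite (_ : (fun x => _) = fun x => \sum_(i <- s | P i) F i x)//.
by apply/funext => x; rewrite big_cons Pi.
Qed.

Lemma c0_norm f : c0 f -> c0 (fun x => `|f x|).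
Proof.
move=> cf; apply: (c0_dom _ cf); last by move=> x; rewrite normr_id.
by move=> x; apply: cvg_norm; exact: cf.1.
Qed.

Lemma continuous_maxr f g : continuous f -> continuous g ->
  continuous (fun x => Num.max (f x) (g x)).
Proof. by move=> cf cg x; apply: continuous_max; [exact: cf|exact: cg]. Qed.

Lemma continuous_minr f g : continuous f -> continuous g ->
  continuous (fun x => Num.min (f x) (g x)).
Proof. by move=> cf cg x; apply: continuous_min; [exact: cf|exact: cg]. Qed.

Lemma c0_max f g : c0 f -> c0 g -> c0 (fun x => Num.max (f x) (g x)).
Proof.
move=> cf cg; apply: (c0_dom _ (c0_add (c0_norm cf) (c0_norm cg))).
  by apply: continuous_maxr; [exact: cf.1|exact: cg.1].
move=> x; rewrite [leRHS]ger0_norm ?addr_ge0//.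
by case: (leP (f x) (g x)) => _; rewrite ?lerDl ?lerDr.
Qed.

Lemma c0_min f g : c0 f -> c0 g -> c0 (fun x => Num.min (f x) (g x)).
Proof.
move=> cf cg; apply: (c0_dom _ (c0_add (c0_norm cf) (c0_norm cg))).
  by apply: continuous_minr; [exact: cf.1|exact: cg.1].
move=> x; rewrite [leRHS]ger0_norm ?addr_ge0//.
by case: (leP (f x) (g x)) => _; rewrite ?lerDl ?lerDr.
Qed.

Lemma open_gt_c0 f (c : R) : continuous f -> open [set x | c < f x].
Proof.
by move=> /continuousP/(_ [set y | c < y]); apply; exact: open_gt.
Qed.

Lemma open_lt_c0 f (c : R) : continuous f -> open [set x | f x < c].
Proof.
by move=> /continuousP/(_ [set y | y < c]); apply; exact: open_lt.
Qed.

Lemma closed_ge_c0 f (c : R) : continuous f -> closed [set x | c <= f x].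
Proof.
move=> cf; have := @closed_comp _ _ f [set y | c <= y]; apply; last exact: closed_ge.
by move=> x _; exact: cf.
Qed.

Lemma c0_compact f (e : R) : c0 f -> 0 < e -> compact [set x | e <= `|f x|].
Proof.
move=> cf e0; have [K cK Kf] := cf.2 _ e0.
apply: (subclosed_compact _ cK); first exact: closed_ge_c0 (c0_norm cf).1.
by move=> x /= ex; apply: contrapT => /Kf; rewrite ltNge ex.
Qed.

Lemma c0_bounded f : c0 f -> exists2 s : R, 0 <= s & forall x, `|f x| <= s.
Proof.
move=> cf; have cK := c0_compact cf ltr01.
have [||||_ [s /= s1 <-] KV] :=
  @directed_compact _ _ [set [set x | `|f x| < s] | s in [set s : R | 1 <= s]] cK.
- by exists [set x | `|f x| < 1], 1 => /=.
- move=> V [s _ <-]; by apply: open_lt_c0; exact: (c0_norm cf).1.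
- move=> _ _ [s /= s1 <-] [t /= t1 <-].
  exists [set x | `|f x| < Num.max s t]; first by exists (Num.max s t) => //=; rewrite le_max s1.
  by move=> x /= []; rewrite lt_max => ->; rewrite ?orbT.
- move=> x _; exists [set y | `|f y| < `|f x| + 1]; last by rewrite /= ltrDl.
  by exists (`|f x| + 1) => //=; rewrite lerDr.
- exists s; first exact: le_trans s1.
  move=> x; have [/KV/ltW//|] := pselect ([set x | 1 <= `|f x|] x).
  by move=> /negP; rewrite -ltNge => /ltW/le_trans; apply.
Qed.

Hypotheses (hX : hausdorff_space X) (lX : locally_compact [set: X]).

(** Complete regularity separates [x] from the complement of [V] intersected with the interior of a
    compact neighbourhood [U]. Vanishing outside [U] is what puts the function in [c0]. *)
Lemma c0_urysohn_pt (V : set X) x : open V -> V x ->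
  exists2 p, c0 p & [/\ forall y, 0 <= p y, forall y, p y <= \1_V y & p x = 1].
Proof.
move=> oV Vx.
have [U] := lX (I : [set: X] x).
move=> nU' [cU clU].
have nU : nbhs x U by apply: (@filterS _ (nbhs x) _ _ _ _ nU') => y; apply.
have oW : open (V `&` U^°) by apply: openI => //; exact: open_interior.
have /(@uniform_separatorP _ R)[f [cf f01 fx fW]] :
    uniform_separator [set x] (~` (V `&` U^°)).
  apply: (@locally_compact_completely_regular _ R lX hX); first exact: open_closedC.
  by apply; split.
have {}fx : f x = 0 by apply: fx; exists x.
have {}fW y : ~ (V `&` U^°) y -> f y = 1 by move=> Wy; apply: fW; exists y.
have {}f01 y : 0 <= f y <= 1.
  by have := f01 (f y) (ex_intro2 _ _ y I erefl); rewrite /= in_itv.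
have p0 y : 0 <= 1 - f y by rewrite subr_ge0; case/andP: (f01 y).
exists (fun y => 1 - f y).
  split; first by move=> y; apply: cvgB; [exact: cvg_cst|exact: cf].
  move=> e e0; exists U => // y Uy; rewrite fW ?subrr ?normr0// => -[_ /interior_subset].
  exact: Uy.
split => //; last by rewrite fx subr0.
move=> y; rewrite indicE; have [yV|yV] := boolP (y \in V) => /=.
  by rewrite lerBlDr lerDl; case/andP: (f01 y).
by rewrite fW ?subrr// => -[Vy _]; move: yV; rewrite mem_set.
Qed.

(** The maxima of pointwise Urysohn functions form a directed family, so one of them exceeds 1/2 on
    all of [K]; doubling it and truncating at 1 gives the value 1 there. *)
Lemma c0_urysohn (K V : set X) : compact K -> open V -> K `<=` V ->
  exists2 p, c0 p &
    [/\ forall y, 0 <= p y, forall y, p y <= \1_V y & forall x, K x -> p x = 1].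
Proof.
move=> cK oV KV.
pose P := [set p | c0 p /\ (forall y, 0 <= p y <= \1_V y)].
have [||||W [p [cp p01] <-] KW] :=
  @directed_compact _ _ [set [set x | 1 / 2 < p x] | p in P] cK.
- exists [set x | 1 / 2 < (0 : R)], (fun=> 0) => //=.
  by split; [exact: c0_0|move=> y; rewrite lexx indicE ler0n].
- by move=> _ [p [cp _] <-]; apply: open_gt_c0; exact: cp.1.
- move=> _ _ [p [cp p01] <-] [q [cq q01] <-].
  exists [set x | 1 / 2 < Num.max (p x) (q x)].
    exists (fun x => Num.max (p x) (q x)) => //; split; first exact: c0_max.
    move=> y; have /andP[p0 p1] := p01 y; have /andP[q0 q1] := q01 y.
    by rewrite le_max p0 ge_max p1 q1.
  by move=> x /= []; rewrite lt_max => ->; rewrite ?orbT.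
- move=> x /KV /(c0_urysohn_pt oV)[p cp [p0 p1 px]].
  exists [set x | 1 / 2 < p x]; last by rewrite /= px; lra.
  by exists p => //; split => // y; rewrite p0 p1.
have p0 y : 0 <= p y by case/andP: (p01 y).
have p1 y : p y <= \1_V y by case/andP: (p01 y).
exists (fun x => Num.min 1 (2 * p x)).
  apply: (c0_dom _ (c0_scale 2 cp)).
    apply: continuous_minr; first by move=> x; exact: cvg_cst.
    exact: (c0_scale 2 cp).1.
  move=> x; rewrite !ger0_norm ?mulr_ge0// ?le_min ?ler01 ?mulr_ge0//.
  by rewrite ge_min lexx orbT.
split=> [y|y|x /KW /= px].
- by rewrite le_min ler01 mulr_ge0.
- have := p1 y; have := p0 y; rewrite indicE; case: (y \in V) => /= p0y p1y.
    by rewrite ge_min lexx.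
  by rewrite ge_min; apply/orP; right; lra.
- by rewrite min_l//; lra.
Qed.

End C0.

(** * The Riesz theorem for real functionals *)

Lemma ler_addeps (R : realType) (a b : R) :
  (forall e, 0 < e -> a <= b + e) -> a <= b.
Proof. by move=> H; apply/ler_addgt0Pr => e /H. Qed.

Lemma sum_half_le (R : realType) (e : R) m : 0 <= e ->
  \sum_(k < m) e * 2^-1 ^+ k.+1 <= e.
Proof.
move=> e0; suff -> : \sum_(k < m) e * 2^-1 ^+ k.+1 = e * (1 - 2^-1 ^+ m).
  by rewrite -[leRHS]mulr1 ler_wpM2l// gerBl exprn_ge0.
elim: m => [|m IH]; first by rewrite big_ord0 expr0 subrr mulr0.
by rewrite big_ord_recr /= IH exprS; field.
Qed.

Section Daniell.
Variables (R : realType) (X : topologicalType).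
Variables (psi : (X -> R) -> R) (B : R).
Hypothesis B0 : 0 <= B.
Hypothesis psiD : forall f g, c0 f -> c0 g -> psi (fun x => f x + g x) = psi f + psi g.
Hypothesis psiZ : forall (c : R) f, c0 f -> psi (fun x => c * f x) = c * psi f.
Hypothesis psiB : forall f (s : R), c0 f -> 0 <= s -> (forall x, `|f x| <= s) -> psi f <= B * s.

Lemma psiN f : c0 f -> psi (fun x => - f x) = - psi f.
Proof.
move=> cf; rewrite -mulN1r -psiZ//; congr psi.
by apply/funext => x; rewrite mulN1r.
Qed.

Lemma psi_sub f g : c0 f -> c0 g -> psi (fun x => f x - g x) = psi f - psi g.
Proof. by move=> cf cg; rewrite psiD ?psiN//; exact: c0_opp. Qed.

Lemma psi0 : psi (fun=> 0) = 0.
Proof.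
by have := psiZ 0 (@c0_0 R X); rewrite !mul0r.
Qed.

Lemma psi_sum (I : Type) (s : seq I) (F : I -> X -> R) : (forall i, c0 (F i)) ->
  psi (fun x => \sum_(i <- s) F i x) = \sum_(i <- s) psi (F i).
Proof.
move=> cF; elim: s => [|i s IH].
  rewrite big_nil (_ : (fun x => _) = fun=> 0) ?psi0//.
  by apply/funext => x; rewrite big_nil.
rewrite big_cons -IH -psiD//; last exact: c0_sum.
by congr psi; apply/funext => x; rewrite big_cons.
Qed.

(** * The variation of [psi] on lower approximable functions *)

Definition below (h : X -> R) := [set g | c0 g /\ forall x, `|g x| <= h x].
(** For nonnegative [h] in C_0 this is the value at [h] of the total variation of [psi], the least
    positive functional dominating [psi]. *)
Definition Lam h := sup [set psi g | g in below h].

(* "Lower approximable" functions: they play the role of the nonnegative bounded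
   lower semicontinuous functions. *)
Definition la (h : X -> R) := [/\ forall x, 0 <= h x, exists s, forall x, h x <= s &
  forall x (e : R), 0 < e -> exists2 p, c0 p & (forall y, 0 <= p y <= h y) /\ h x < p x + e].

Lemma below0 h : (forall x, 0 <= h x) -> below h (fun=> 0).
Proof. by move=> h0; split; [exact: c0_0|move=> x; rewrite normr0]. Qed.

Lemma Lam_has_sup h : (forall x, 0 <= h x) -> (exists s, forall x, h x <= s) ->
  has_sup [set psi g | g in below h].
Proof.
move=> h0 [s hs]; split; first by exists (psi (fun=> 0)), (fun=> 0) => //; exact: below0.
exists (B * `|s|) => _ [g [cg gh] <-]; apply: psiB => // x.
by rewrite (le_trans (gh x))// (le_trans (hs x))// ler_norm.
Qed.

Lemma Lam_ub h g : la h -> below h g -> psi g <= Lam h.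
Proof.
move=> [h0 hb _] gh; apply: sup_ubound; last by exists g.
exact: (Lam_has_sup h0 hb).2.
Qed.

Lemma Lam_le h L : (forall x, 0 <= h x) -> (forall g, below h g -> psi g <= L) -> Lam h <= L.
Proof.
move=> h0 hL; apply: ge_sup.
  by exists (psi (fun=> 0)), (fun=> 0) => //; exact: below0.
by move=> _ [g gh <-]; exact: hL.
Qed.

Lemma Lam_ge0 h : la h -> 0 <= Lam h.
Proof. by move=> lh; rewrite -psi0; apply: Lam_ub => //; apply: below0; case: lh. Qed.

Lemma Lam_adh h e : la h -> 0 < e -> exists2 g, below h g & Lam h < psi g + e.
Proof.
move=> [h0 hb _] e0; have [_ [g gh <-]] := sup_adherent e0 (Lam_has_sup h0 hb).
by rewrite ltrBlDr; exists g.
Qed.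

Lemma la_c0 f : c0 f -> (forall x, 0 <= f x) -> la f.
Proof.
move=> cf f0; split => //.
  by have [s _ fs] := c0_bounded cf; exists s => x; rewrite (le_trans (ler_norm _)).
move=> x e e0; exists f => //; split; last by rewrite ltrDl.
by move=> y; rewrite f0 lexx.
Qed.

Lemma la_scale c h : 0 <= c -> la h -> la (fun x => c * h x).
Proof.
move=> c0' [h0 [s hs] hp]; split.
- by move=> x; rewrite mulr_ge0.
- by exists (c * s) => x; rewrite ler_wpM2l.
- move=> x e e0; have c1 : 0 < c + 1 by rewrite ltr_wpDl.
  have [p cp [ph px]] := hp x _ (divr_gt0 e0 c1).
  exists (fun x => c * p x); first exact: c0_scale.
  split => [y|]; first by have /andP[? ?] := ph y; rewrite mulr_ge0// ler_wpM2l.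
  have H : e / (c + 1) * (c + 1) = e by rewrite divfK// gt_eqF.
  have : 0 < e / (c + 1) by rewrite divr_gt0.
  move: (e / (c + 1)) H px => d <- px d0; nra.
Qed.

Lemma la_subc0 h p : la h -> c0 p -> (forall x, 0 <= p x <= h x) -> la (fun x => h x - p x).
Proof.
move=> [h0 [s hs] hp] cp ph; split.
- by move=> x; rewrite subr_ge0; case/andP: (ph x).
- by exists s => x; have /andP[? ?] := ph x; have := hs x; lra.
- move=> x e e0; have [q cq [qh qx]] := hp x _ e0.
  (* [q] may drop below [p]; the maximum keeps the difference nonnegative. *)
  exists (fun x => Num.max (q x) (p x) - p x); first by apply: c0_sub => //; exact: c0_max.
  split.
    move=> y; have /andP[? ?] := ph y; have /andP[? ?] := qh y.
    rewrite subr_ge0 le_max lexx orbT/= lerB// ge_max; lra.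
  have : q x <= Num.max (q x) (p x) by rewrite le_max lexx.
  lra.
Qed.

(* By compactness finitely many p k in C_0 below the h k satisfy
   |g| <= sum p k + 2e; then g is split into the pieces g * p k / q, where q is
   the maximum of sum p k, |g| and e, up to a remainder of size at most 2e. *)
Lemma Lam_key g (h : nat -> X -> R) (L : R) : c0 g -> (forall k, la (h k)) ->
  (forall x (e : R), 0 < e -> exists m, `|g x| < \sum_(k < m) h k x + e) ->
  (forall m, \sum_(k < m) Lam (h k) <= L) -> psi g <= L.
Proof.
move=> cg lh gh hL; apply: ler_addeps => e0 e00.
(* A remainder of size at most [2 * e] then contributes at most [B * (2 * e) <= e0] to [psi g]. *)
pose e := e0 / (2 * (B + 1)).
have B1 : 0 < B + 1 by rewrite ltr_wpDl.
have ep : 0 < e by rewrite divr_gt0// mulr_gt0.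
have eB : B * (2 * e) <= e0.
  have -> : e0 = 2 * (B + 1) * e by rewrite mulrC divfK// gt_eqF// mulr_gt0.
  by nra.
(* The functions [mp.2 k] exist for every [k] although only the first [mp.1] are summed: two
   candidates are joined by pointwise maxima and the larger length. *)
pose D := [set mp : nat * (nat -> X -> R) | forall k, c0 (mp.2 k) /\
   forall y, 0 <= mp.2 k y <= h k y].
pose U (mp : nat * (nat -> X -> R)) := [set x | `|g x| < \sum_(k < mp.1) mp.2 k x + 2 * e].
have [||||_ [[m p] /= Dmp <-] KU] :=
  @directed_compact _ _ [set U mp | mp in D] (c0_compact cg ep).
- exists (U (0%N, fun _ _ => 0)), (0%N, fun _ _ => 0) => // k; split; first exact: c0_0.
  by move=> y /=; rewrite lexx/=; case: (lh k).
- move=> _ [[m p] Dmp <-].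
  rewrite (_ : U (m, p) = [set x | `|g x| - \sum_(k < m) p k x < 2 * e]).
    suff [] : c0 (fun x => `|g x| - \sum_(k < m) p k x) by move=> + _; exact: (@open_lt_c0 _ _ _ (2 * e)).
    apply: c0_sub; first exact: c0_norm.
    by apply: c0_sum => k _; case: (Dmp k).
  by apply/seteqP; split => x; rewrite /U /= ltrBlDl.
- move=> _ _ [[m p] Dmp <-] [[m' p'] Dmp' <-].
  exists (U (maxn m m', fun k x => Num.max (p k x) (p' k x))).
    eexists; last reflexivity.
    move=> k /=; have [? pk] := Dmp k; have [? p'k] := Dmp' k.
    split; first exact: c0_max.
    move=> y; have /andP[p0 ph] := pk y; have /andP[? p'h] := p'k y.
    by rewrite le_max p0/= ge_max ph.
  have mono (a b : nat) (u v : nat -> R) : (a <= b)%N ->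
      (forall k, u k <= v k) -> (forall k, 0 <= v k) ->
      \sum_(k < a) u k <= \sum_(k < b) v k.
    move=> ab uv v0; apply: (@le_trans _ _ (\sum_(k < a) v k)).
      by apply: ler_sum => k _.
    by rewrite -(subnKC ab) big_split_ord/= lerDl sumr_ge0.
  have max0 k x : 0 <= Num.max (p k x) (p' k x).
    by rewrite le_max; have [_ /(_ x)/andP[->]] := Dmp k.
  move=> x [] /= H; apply: (lt_le_trans H); rewrite /U /= lerD2r.
    apply: (mono _ _ (fun k => p k x) (fun k => Num.max (p k x) (p' k x))) => //.
      exact: leq_maxl.
    by move=> k; rewrite le_max lexx.
  apply: (mono _ _ (fun k => p' k x) (fun k => Num.max (p k x) (p' k x))) => //.
    exact: leq_maxr.
  by move=> k; rewrite le_max lexx orbT.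
- move=> x _; have [m mx] := gh x _ ep.
  have m1 : 0 < e / m.+1%:R by rewrite divr_gt0.
  have /choice[p Hp] : forall k, exists p, c0 p /\ (forall y, 0 <= p y <= h k y) /\ h k x < p x + e / m.+1%:R.
    by move=> k; have [_ _ /(_ x _ m1)[p ? ?]] := lh k; exists p.
  exists (U (m, p)); first by exists (m, p) => // k /=; have [? [? _]] := Hp k.
  rewrite /U /=; apply: (lt_le_trans mx).
  have : \sum_(k < m) h k x <= \sum_(k < m) (p k x + e / m.+1%:R).
    by apply: ler_sum => k _; have [_ [_ /ltW]] := Hp k.
  rewrite big_split/= sumr_const card_ord -[_ / _ *+ _]mulr_natr.
  have : e / m.+1%:R * m%:R <= e.
    by rewrite mulrAC -mulrA ger_pMr// ler_pdivrMr// mul1r ler_nat.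
  move=> H1 H2; apply: (le_trans (lerD H2 (lexx e))).
  by rewrite -addrA lerD2l mulr_natl mulr2n lerD2r.
pose S x := \sum_(k < m) p k x.
have cS : c0 S by apply: c0_sum => k _; case: (Dmp k).
have S0 x : 0 <= S x by apply: sumr_ge0 => k _; have [_ /(_ x)/andP[]] := Dmp k.
pose q x := Num.max (S x) (Num.max `|g x| e).
have qe x : 0 < q x by rewrite /q !lt_max ep !orbT.
have cq : continuous q.
  apply: continuous_maxr; first exact: cS.1.
  by apply: continuous_maxr; [exact: (c0_norm cg).1|move=> x; exact: cvg_cst].
pose gk k x := g x * p k x / q x.
have gkp k x : `|gk k x| <= p k x.
  have [_ /(_ x)/andP[p0 _]] := Dmp k; have p0' : 0 <= p k x by [].
  rewrite /gk normrM normfV (gtr0_norm (qe x)) ler_pdivrMr// normrM (ger0_norm p0') mulrC.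
  by rewrite ler_wpM2l// /q !le_max lexx orbT.
have cgk k : c0 (gk k).
  have [cpk pk0] := Dmp k.
  apply: (c0_dom _ cpk); last first.
    by move=> x; rewrite (le_trans (gkp k x))// ler_norm.
  move=> x; apply: cvgM; first by apply: cvgM; [exact: cg.1|exact: cpk.1].
  by apply: cvgV; [rewrite gt_eqF|exact: cq].
have cr : c0 (fun x => g x - \sum_(k < m) gk k x).
  by apply: c0_sub => //; apply: c0_sum.
have r2e x : `|g x - \sum_(k < m) gk k x| <= 2 * e.
  have -> : g x - \sum_(k < m) gk k x = g x * ((q x - S x) / q x).
    rewrite /gk -mulr_suml -mulr_sumr -/(S x); have := qe x.
    by move=> /lt0r_neq0 ?; field.
  have qS : 0 <= q x - S x by rewrite subr_ge0 /q le_max lexx.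
  rewrite normrM normrM normfV (gtr0_norm (qe x)) (ger0_norm qS) mulrA ler_pdivrMr//.
  have gS : `|g x| <= S x + 2 * e.
    have [ex|/negP] := pselect ([set x | e <= `|g x|] x); first exact/ltW/KU.
    by rewrite -ltNge => /ltW ge; have := S0 x; lra.
  have gq : `|g x| <= q x by rewrite /q !le_max lexx orbT.
  have := normr_ge0 (g x).
  have := qe x; have := S0 x.
  (* If [q] is [S] or [|g|], then [q - S <= 2 * e]. If [q] is [e], then [|g| <= e] and the factor
     [(q - S) / q] is at most 1. *)
  suff : q x - S x <= 2 * e \/ (`|g x| <= e /\ q x - S x <= q x).
    move=> [|[]]; nra.
  rewrite /q; case: (leP (S x)) => _; last by left; lra.
  case: (leP `|g x| e) => ?; last by left; lra.
  by right; have := S0 x; split; lra.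
have -> : g = fun x => \sum_(k < m) gk k x + (g x - \sum_(k < m) gk k x).
  by apply/funext => x; rewrite addrC subrK.
rewrite psiD//; last exact: c0_sum.
rewrite psi_sum//; apply: lerD; last first.
  by apply: le_trans eB; apply: psiB => //; rewrite mulr_ge0// ltW.
apply: le_trans (hL m); apply: ler_sum => k _; apply: Lam_ub => //.
split => // x; apply: (le_trans (gkp k x)).
by have [_ /(_ x)/andP[]] := Dmp k.
Qed.

Hypotheses (hX : hausdorff_space X) (lX : locally_compact [set: X]).

Lemma la_open (V : set X) : open V -> la \1_V.
Proof.
move=> oV; split.
- by move=> x; rewrite indicE ler0n.
- by exists 1 => x; rewrite indicE; case: (_ \in _); rewrite ?lexx ?ler01.
- move=> x e e0; have [Vx|Vx] := pselect (V x).
    have [p cp [p0 p1 px]] := c0_urysohn_pt R hX lX oV Vx.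
    exists p => //; split; first by move=> y; rewrite p0 p1.
    by rewrite px indicE mem_set// ltrDl.
  exists (fun=> 0); first exact: c0_0.
  split; first by move=> y; rewrite lexx indicE ler0n.
  by rewrite indicE memNset// add0r.
Qed.

Lemma la_cst (s : R) : 0 <= s -> la (fun=> s).
Proof.
move=> s0; have := la_scale s0 (la_open (@openT X)); congr la.
by apply/funext => x; rewrite indicE in_setT mulr1.
Qed.

(** * The upper integral *)

Definition upint (h : X -> R) := inf [set Lam k | k in [set k | la k /\ forall x, h x <= k x]].

(** Functions satisfying [la] are bounded, so without this condition no [k] dominates [h] and the
    infimum in [upint] is that of the empty set, a default value. *)
Definition bounded_above (h : X -> R) := exists s, forall x, h x <= s.

Lemma upint_has_inf h : bounded_above h ->
  has_inf [set Lam k | k in [set k | la k /\ forall x, h x <= k x]].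
Proof.
move=> [s hs]; split.
  exists (Lam (fun=> `|s|)), (fun=> `|s|) => //; split; first exact: la_cst.
  by move=> x; rewrite (le_trans (hs x))// ler_norm.
by exists 0 => _ [k [lk _] <-]; exact: Lam_ge0.
Qed.

Lemma upint_ge0 h : bounded_above h -> 0 <= upint h.
Proof.
move=> /upint_has_inf[h0 _]; apply: lb_le_inf => // _ [k [lk _] <-].
exact: Lam_ge0.
Qed.

Lemma upint_le_Lam h k : la k -> (forall x, h x <= k x) -> upint h <= Lam k.
Proof.
move=> lk hk; apply: ge_inf; last by exists k.
have [_ [s ks] _] := lk.
by apply: (upint_has_inf _).2; exists s => x; exact: le_trans (ks x).
Qed.

Lemma upint_adh h e : bounded_above h -> 0 < e ->
  exists k, [/\ la k, forall x, h x <= k x & Lam k < upint h + e].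
Proof.
by move=> /upint_has_inf hh e0; have [_ [k [lk hk] <-] ?] := inf_adherent e0 hh; exists k.
Qed.

Lemma upint_mono h h' : bounded_above h' -> (forall x, h x <= h' x) -> upint h <= upint h'.
Proof.
move=> bh' hh'; apply: ler_addeps => e e0.
have [k [lk hk /ltW kN]] := upint_adh bh' e0.
by apply: le_trans kN; apply: upint_le_Lam => // x; exact: le_trans (hh' x) (hk x).
Qed.

(* A sum of bounded dominating functions u k need not be bounded, so h is
   dominated by the supremum of the p in C_0 below both s and a partial sum. *)
Lemma upint_sigma h (f : nat -> X -> R) (L : R) : bounded_above h ->
  (forall k, bounded_above (f k)) ->
  (forall x (e : R), 0 < e -> exists m, h x < \sum_(k < m) f k x + e) ->
  (forall m, \sum_(k < m) upint (f k) <= L) -> upint h <= L.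
Proof.
move=> [s0 hs0] bf hf NL; pose s : R := `|s0|.
have hs x : h x <= s by rewrite (le_trans (hs0 x))// ler_norm.
have s_ge0 : 0 <= s by exact: normr_ge0.
apply: ler_addeps => e e0.
have /choice[u Hu] k : exists u, [/\ la u, forall x, f k x <= u x &
    Lam u < upint (f k) + e * 2^-1 ^+ k.+1].
  by apply: upint_adh => //; rewrite mulr_gt0// exprn_gt0.
have lu k : la (u k) by case: (Hu k).
pose D := [set p | [/\ c0 p, forall y, 0 <= p y <= s &
   exists m, forall y, p y <= \sum_(k < m) u k y]].
have D0 : D (fun=> 0).
  split; [exact: c0_0|by move=> y; rewrite lexx|].
  by exists 0%N => y; rewrite big_ord0.
pose E x := [set p x | p in D].
have hE x : has_sup (E x).
  split; first by exists 0, (fun=> 0).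
  by exists s => _ [p [_ p0 _] <-]; case/andP: (p0 x).
pose H x := sup (E x).
have HD p x : D p -> p x <= H x.
  by move=> Dp; apply: sup_ubound; [exact: (hE x).2|exists p].
have lH : la H.
  split.
  - by move=> x; exact: HD D0.
  - exists s => x; apply: ge_sup; first exact: (hE x).1.
    by move=> _ [p [_ p0 _] <-]; case/andP: (p0 x).
  - move=> x d d0; have [_ [p Dp <-] pH] := sup_adherent d0 (hE x).
    exists p; first by case: Dp.
    split; last by rewrite -ltrBlDr.
    by move=> y; rewrite HD// andbT; have [_ /(_ y)/andP[]] := Dp.
apply: (@le_trans _ _ (Lam H)).
  apply: upint_le_Lam => // x; apply: ler_addeps => d d0.
  have d20 : 0 < d / 2 by rewrite divr_gt0.
  have [m hm] := hf x _ d20.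
  have m1 : 0 < (d / 2) / m.+1%:R by rewrite divr_gt0.
  have /choice[p Hp] : forall k, exists p, c0 p /\ (forall y, 0 <= p y <= u k y) /\
      u k x < p x + (d / 2) / m.+1%:R.
    by move=> k; have [_ _ /(_ x _ m1)[p ? ?]] := lu k; exists p.
  pose S y := \sum_(k < m) p k y.
  have cS : c0 S by apply: c0_sum => k _; case: (Hp k).
  have S0 y : 0 <= S y by apply: sumr_ge0 => k _; have [_ [/(_ y)/andP[]]] := Hp k.
  have Dq : D (fun y => Num.min s (S y)).
    split.
    - apply: (c0_dom _ cS).
        by apply: continuous_minr; [move=> y; exact: cvg_cst|exact: cS.1].
      move=> y; have m0 : 0 <= Num.min s (S y) by rewrite le_min s_ge0 S0.
      by rewrite (ger0_norm m0) ger0_norm// ge_min lexx orbT.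
    - by move=> y; rewrite le_min s_ge0 S0 ge_min lexx.
    - exists m => y; rewrite ge_min; apply/orP; right; apply: ler_sum => k _.
      by have [_ [/(_ y)/andP[]]] := Hp k.
  apply: le_trans (lerD (HD _ x Dq) (lexx d)).
  have hS : h x <= S x + d.
    have fp : \sum_(k < m) f k x <= \sum_(k < m) (p k x + d / 2 / m.+1%:R).
      apply: ler_sum => k _; have [_ fu _] := Hu k; apply: (le_trans (fu x)).
      by have [_ [_ /ltW]] := Hp k.
    have dm : d / 2 / m.+1%:R * m%:R <= d / 2.
      by rewrite mulrAC -mulrA ger_pMr// ler_pdivrMr// mul1r ler_nat.
    move: fp; rewrite big_split/= sumr_const card_ord -[_ / _ *+ _]mulr_natr -/(S x).
    move=> fp; apply/ltW/(lt_le_trans hm)/(le_trans (lerD fp (lexx _))).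
    by rewrite -addrA lerD2l [leRHS](splitr d) lerD2r.
  have := hs x; case: (leP s (S x)) => _; lra.
apply: Lam_le => [x|g [cg gH]]; first by case: lH.
apply: (Lam_key (h := u)) => //.
- move=> x d d0; have [_ [p [cp p0 [m pm]] <-] pH] := sup_adherent d0 (hE x).
  exists m; have := pm x; have := gH x; move: pH; rewrite -/(H x) ltrBlDr.
  move=> H1 H2 H3; apply: (le_lt_trans H2); apply: (lt_le_trans H1); rewrite lerD2r//.
- move=> m; apply: (@le_trans _ _ (\sum_(k < m) (upint (f k) + e * 2^-1 ^+ k.+1))).
    by apply: ler_sum => k _; have [_ _ /ltW] := Hu k.
  rewrite big_split/= lerD//.
    exact: NL.
  by apply: sum_half_le; exact: ltW.
Qed.

Lemma bounded_aboveD f g : bounded_above f -> bounded_above g -> bounded_above (fun x => f x + g x).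
Proof. by move=> [s fs] [t gt]; exists (s + t) => x; rewrite lerD. Qed.

Lemma upint0 : upint (fun=> 0) = 0.
Proof.
apply/le_anti/andP; split; last by apply: upint_ge0; exists 0.
apply: (@le_trans _ _ (Lam (fun=> 0))).
  by apply: upint_le_Lam => //; exact: la_cst.
apply: Lam_le => // g [cg g0]; rewrite -(mulr0 B); exact: psiB.
Qed.

Lemma upintD f g : bounded_above f -> bounded_above g ->
  upint (fun x => f x + g x) <= upint f + upint g.
Proof.
move=> bf bg.
pose F k : X -> R := if k is 0%N then f else if k is 1%N then g else fun=> 0.
have F2 (G : (X -> R) -> R) m : G (fun=> 0) = 0 -> \sum_(k < m.+2) G (F k) = G f + G g.
  by move=> G0; rewrite 2!big_ord_recl /= big1 ?addr0// => i _; exact: G0.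
apply: (upint_sigma (f := F)).
- exact: bounded_aboveD.
- by case=> [|[|k]] //=; exists 0.
- by move=> x e e0; exists 2%N; rewrite (F2 (fun h => h x))// ltrDl.
- case=> [|[|m]].
  + by rewrite big_ord0 addr_ge0// upint_ge0.
  + by rewrite big_ord_recl big_ord0 /= addr0 lerDl upint_ge0.
  + by rewrite (F2 upint) ?upint0.
Qed.

Lemma upint_scale c f : 0 < c -> bounded_above f -> upint (fun x => c * f x) <= c * upint f.
Proof.
move=> cp bf; apply: ler_addeps => e e0.
have [k [lk fk kN]] := upint_adh bf (divr_gt0 e0 cp).
have lck := la_scale (ltW cp) lk.
apply: (@le_trans _ _ (Lam (fun x => c * k x))).
  by apply: upint_le_Lam => // x; rewrite ler_pM2l.
apply: (@le_trans _ _ (c * Lam k)).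
  apply: Lam_le => [x|g [cg gk]]; first by case: lck.
  have cg' : c0 (fun x => c^-1 * g x) by exact: c0_scale.
  have -> : g = fun x => c * (c^-1 * g x).
    by apply/funext => x; rewrite mulrA divff ?mul1r// gt_eqF.
  rewrite psiZ// ler_pM2l//; apply: Lam_ub => //; split => // x.
  by rewrite normrM gtr0_norm ?invr_gt0// mulrC ler_pdivrMr// mulrC.
have : c * Lam k < c * (upint f + e / c) by rewrite ltr_pM2l.
by rewrite mulrDr mulrCA divff ?gt_eqF// mulr1 => /ltW.
Qed.

Lemma psi_upint g : c0 g -> psi g <= upint (fun x => `|g x|).
Proof.
move=> cg; have [s _ gs] := c0_bounded cg.
apply: ler_addeps => e e0.
have [|k [lk gk kN]] := upint_adh (h := fun x => `|g x|) _ e0; first by exists s.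
by apply: le_trans (ltW kN); apply: Lam_ub.
Qed.

Lemma psi_upint_norm g : c0 g -> `|psi g| <= upint (fun x => `|g x|).
Proof.
move=> cg; rewrite ler_norml psi_upint// andbT lerNl -psiN//.
apply: le_trans (psi_upint (c0_opp cg)) _.
by rewrite le_eqVlt; apply/orP; left; apply/eqP; congr upint; apply/funext => x; rewrite normrN.
Qed.

(** * The extension of [psi] to the closure of C_0 *)

Definition bounded_fct (f : X -> R) := exists s, forall x, `|f x| <= s.

Lemma bounded_fctD f g : bounded_fct f -> bounded_fct g -> bounded_fct (fun x => f x + g x).
Proof.
move=> [s fs] [t gt]; exists (s + t) => x.
by rewrite (le_trans (ler_normD _ _))// lerD.
Qed.

Lemma bounded_fctZ c f : bounded_fct f -> bounded_fct (fun x => c * f x).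
Proof. by move=> [s fs]; exists (`|c| * s) => x; rewrite normrM ler_wpM2l. Qed.

Lemma bounded_fctB f g : bounded_fct f -> bounded_fct g -> bounded_fct (fun x => f x - g x).
Proof.
move=> [s fs] [t gt]; exists (s + t) => x.
by rewrite (le_trans (ler_normB _ _))// lerD.
Qed.

Lemma bounded_fct_c0 f : c0 f -> bounded_fct f.
Proof. by move=> /c0_bounded[s _ fs]; exists s. Qed.

Lemma bounded_fct_ind (E : set X) : bounded_fct \1_E.
Proof.
exists 1 => x; rewrite indicE.
by case: (_ \in _); rewrite ?normr1 ?normr0 ?lexx ?ler01.
Qed.

Hint Resolve bounded_fctD bounded_fctB bounded_fctZ bounded_fct_c0 bounded_fct_ind : core.

Definition upnorm (f : X -> R) := upint (fun x => `|f x|).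

Lemma upnorm_ge0 f : bounded_fct f -> 0 <= upnorm f.
Proof. by move=> bf; exact: upint_ge0. Qed.

Lemma upnorm_triangle f g h : bounded_fct g -> bounded_fct h ->
  (forall x, `|f x| <= `|g x| + `|h x|) -> upnorm f <= upnorm g + upnorm h.
Proof.
move=> bg bh fgh; apply: le_trans (upintD bg bh).
by apply: upint_mono => //; exact: bounded_aboveD.
Qed.

Definition dintegrable f := bounded_fct f /\
  forall e : R, 0 < e -> exists2 g, c0 g & upnorm (fun x => f x - g x) < e.

Definition ext_spec f v := forall g, c0 g -> `|psi g - v| <= upnorm (fun x => f x - g x).

(* ext_spec f has a solution for every bounded f, but it determines it only when
   f lies in the closure of C_0 for upnorm. *)
Definition ext f : R := xget 0 (ext_spec f).

(** Since [psi] is bounded by the seminorm, every [psi g - upnorm (f - g)] is at most every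
    [psi g' + upnorm (f - g')]; the supremum of the former is a solution. *)
Lemma extP f : bounded_fct f -> ext_spec f (ext f).
Proof.
move=> bf.
pose A := [set psi g - upnorm (fun x => f x - g x) | g in [set g | c0 g]].
have H g g' : c0 g -> c0 g' ->
    psi g - upnorm (fun x => f x - g x) <= psi g' + upnorm (fun x => f x - g' x).
  move=> cg cg'; rewrite lerBlDr -addrA -lerBlDl -psi_sub//.
  apply: le_trans (psi_upint (c0_sub cg cg')) _.
  apply: upnorm_triangle; [by auto..|move=> x].
  have -> : g x - g' x = (f x - g' x) - (f x - g x) by ring.
  exact: ler_normB.
have hA : has_sup A.
  split; first by exists (psi (fun=> 0) - upnorm (fun x => f x - 0)), (fun=> 0) => //; exact: c0_0.
  exists (psi (fun=> 0) + upnorm (fun x => f x - 0)) => _ [g cg <-].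
  by apply: (H _ (fun=> 0)) => //; exact: c0_0.
suff HA : ext_spec f (sup A) by apply: (xgetPex 0); exists (sup A).
move=> g cg; rewrite ler_distlC -lerBlDr; apply/andP; split.
  by apply: sup_ubound; [exact: hA.2|exists g].
rewrite lerBlDr; apply: ge_sup; first exact: hA.1.
by move=> _ [g' cg' <-]; exact: H.
Qed.

Lemma ext_eq f v : dintegrable f ->
  (forall e : R, 0 < e -> exists g, [/\ c0 g, upnorm (fun x => f x - g x) <= e & `|psi g - v| <= e]) ->
  ext f = v.
Proof.
move=> [bf _] H; apply/eqP; rewrite -subr_eq0 -normr_le0; apply: ler_addeps => e e0.
have [|g [cg fg gv]] := H (e / 2); first by rewrite divr_gt0.
have := extP bf cg; rewrite distrC => fv.
rewrite add0r (splitr e).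
have -> : ext f - v = (ext f - psi g) + (psi g - v) by ring.
apply: (le_trans (ler_normD _ _)); apply: lerD => //; exact: le_trans fv fg.
Qed.

Lemma upnorm0 (f : X -> R) : (forall x, f x = 0) -> upnorm f = 0.
Proof.
by move=> f0; rewrite -[RHS]upint0; congr upint; apply/funext => x; rewrite f0 normr0.
Qed.

Lemma dintegrable_c0 g : c0 g -> dintegrable g.
Proof.
move=> cg; split; first by auto.
by move=> e e0; exists g => //; rewrite upnorm0// => x; rewrite subrr.
Qed.

Lemma ext_c0 g : c0 g -> ext g = psi g.
Proof.
move=> cg; apply: ext_eq; first exact: dintegrable_c0.
move=> e e0; exists g; rewrite upnorm0 => [|x]; last by rewrite subrr.
by rewrite subrr normr0 ltW.
Qed.

Lemma dintegrable_lin a f f' : dintegrable f -> dintegrable f' ->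
  dintegrable (fun x => f x + a * f' x) /\ ext (fun x => f x + a * f' x) = ext f + a * ext f'.
Proof.
move=> [bf If] [bf' If'].
have H (e : R) : 0 < e -> exists g, [/\ c0 g, upnorm (fun x => f x + a * f' x - g x) < e &
    `|psi g - (ext f + a * ext f')| <= e].
  move=> e0; pose b := `|a| + 1; have b0 : 0 < b by rewrite ltr_wpDl.
  have eb : 0 < e / 2 / b by rewrite !divr_gt0.
  have [g cg fg] := If (e / 2) ltac:(by rewrite divr_gt0).
  have [g' cg' fg'] := If' _ eb.
  have cag : c0 (fun x => a * g' x) by exact: c0_scale.
  have agb (t : R) : 0 <= t -> t < e / 2 / b -> `|a| * t < e / 2.
    move=> t0; rewrite ltr_pdivlMr// => tb; apply: le_lt_trans tb.
    by rewrite mulrC ler_wpM2l// lerDl.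
  have bag : upnorm (fun x => a * (f' x - g' x)) < e / 2.
    (* [upint_scale] is stated for a positive factor only. *)
    have [a0|a0] := eqVneq a 0.
      by rewrite upnorm0 ?divr_gt0// => x; rewrite a0 mul0r.
    apply: le_lt_trans (agb _ _ fg'); last by apply: upnorm_ge0; auto.
    apply: le_trans (upint_scale _ _); last 2 first.
      by rewrite normr_gt0.
      by apply: bounded_fctB => //; auto.
    by rewrite /upnorm; under eq_fun do rewrite normrM.
  exists (fun x => g x + a * g' x); split.
  - exact: c0_add.
  - rewrite (splitr e); apply: le_lt_trans (ltrD fg bag).
    apply: upnorm_triangle; [by auto..|].
    move=> x; have -> : f x + a * f' x - (g x + a * g' x) = (f x - g x) + a * (f' x - g' x) by ring.
    exact: ler_normD.
  - rewrite psiD// psiZ// (splitr e).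
    have -> : psi g + a * psi g' - (ext f + a * ext f') =
      (psi g - ext f) + a * (psi g' - ext f') by ring.
    apply: (le_trans (ler_normD _ _)); apply: lerD.
      by apply: le_trans (ltW fg); exact: extP.
    rewrite normrM; apply/ltW/agb => //; apply: le_lt_trans fg'.
    exact: extP.
have bI : bounded_fct (fun x => f x + a * f' x) by auto.
have I : dintegrable (fun x => f x + a * f' x).
  by split => // e /H[g [cg ? _]]; exists g.
split => //; apply: ext_eq => // e /H[g [cg /ltW ? ?]]; by exists g.
Qed.

Lemma ext_bound f : dintegrable f -> `|ext f| <= upnorm f.
Proof.
move=> [bf If]; apply: ler_addeps => e e0.
have [g cg fg] := If (e / 2) ltac:(by rewrite divr_gt0).
have H1 := extP bf cg.
have H2 := psi_upint_norm cg.
have H3 : upnorm g <= upnorm f + upnorm (fun x => f x - g x).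
  apply: upnorm_triangle; [by auto..|move=> x].
  have {1}-> : g x = f x - (f x - g x) by ring.
  exact: ler_normB.
have : `|ext f| <= `|psi g| + `|psi g - ext f|.
  have {1}-> : ext f = psi g - (psi g - ext f) by ring.
  exact: ler_normB.
rewrite /upnorm in H1 H2 H3 fg *; lra.
Qed.

(** If [g] nearly attains the supremum [Lam k], then [|g|] approximates [k]: whenever [g'] is below
    [k - |g|], the sum [g + g'] is below [k], so [psi g'] is at most the defect [Lam k - psi g]. *)
Lemma dintegrable_la k : la k -> dintegrable k.
Proof.
move=> lk; have [k0 [s ks] _] := lk.
split; first by exists s => x; rewrite ger0_norm.
move=> e e0; have [g [cg gk] kg] := Lam_adh lk (divr_gt0 e0 (ltr0Sn R 1)).
have lkg : la (fun x => k x - `|g x|).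
  apply: la_subc0 => //; first exact: c0_norm.
  by move=> x; rewrite normr_ge0 gk.
exists (fun x => `|g x|); first exact: c0_norm.
apply: (@le_lt_trans _ _ (Lam (fun x => k x - `|g x|))).
  apply: upint_le_Lam => // x; rewrite ger0_norm// subr_ge0; exact: gk.
apply: (@le_lt_trans _ _ (e / 2)); last by lra.
apply: Lam_le => [x|g' [cg' g'k]]; first by rewrite subr_ge0.
have : psi (fun x => g x + g' x) <= Lam k.
  apply: Lam_ub => //; split; first exact: c0_add.
  move=> x; apply: (le_trans (ler_normD _ _)).
  by have := g'k x; lra.
rewrite psiD//; lra.
Qed.

(** This reverses [upintD] for integrable functions. On C_0 it follows by adding near-optimal [p]
    below [|g|] and [p'] below [|g'|]; approximation carries it over. It makes the measures of
    disjoint sets summable in [dset_tail]. *)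
Lemma upint_superadd f f' : dintegrable f -> dintegrable f' ->
  (forall x, 0 <= f x) -> (forall x, 0 <= f' x) ->
  upint f + upint f' <= upint (fun x => f x + f' x).
Proof.
move=> [bf If] [bf' If'] f0 f'0; apply: ler_addeps => e e0.
(* Each of the approximations [g], [g'] costs an error twice, each of the near-optimal [p], [p']
   once. *)
have e5 : 0 < e / 6 by rewrite divr_gt0.
have [g cg fg] := If _ e5; have [g' cg' fg'] := If' _ e5.
have [bg bg'] : bounded_fct g /\ bounded_fct g' by auto.
have ba (h : X -> R) : bounded_fct h -> bounded_above h.
  by move=> [s hs]; exists s => x; rewrite (le_trans (ler_norm _)).
have ban (h : X -> R) : bounded_fct h -> bounded_above (fun x => `|h x|) by [].
have N1 (h u : X -> R) : bounded_fct h -> bounded_fct u -> (forall x, 0 <= h x) ->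
    upint h <= upint (fun x => `|u x|) + upnorm (fun x => h x - u x).
  move=> bh bu h0; apply: le_trans (upintD (ban _ bu) (ban _ (bounded_fctB bh bu))).
  apply: upint_mono; first by apply: bounded_aboveD; apply: ban => //; auto.
  move=> x; have := ler_normD (u x) (h x - u x).
  by rewrite [u x + _]addrC subrK ger0_norm.
have H1 := N1 _ _ bf bg f0; have H2 := N1 _ _ bf' bg' f'0.
have lg : la (fun x => `|g x|) by apply: la_c0 => //; exact: c0_norm.
have lg' : la (fun x => `|g' x|) by apply: la_c0 => //; exact: c0_norm.
have H3 := upint_le_Lam lg (fun x => lexx _).
have H4 := upint_le_Lam lg' (fun x => lexx _).
have [p [cp pg] H5] := Lam_adh lg e5; have [p' [cp' pg'] H6] := Lam_adh lg' e5.
have H7 : psi p + psi p' <= upint (fun x => `|g x| + `|g' x|).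
  rewrite -psiD//; apply: le_trans (psi_upint (c0_add cp cp')) _.
  apply: upint_mono; first by apply: bounded_aboveD; apply: ban.
  by move=> x; rewrite (le_trans (ler_normD _ _))// lerD.
have H8 : upint (fun x => `|g x| + `|g' x|) <= upint (fun x => f x + f' x) +
    (upnorm (fun x => f x - g x) + upnorm (fun x => f' x - g' x)).
  have bfg := bounded_fctB bf bg; have bfg' := bounded_fctB bf' bg'.
  have bs := bounded_aboveD (ban _ bfg) (ban _ bfg').
  apply: (@le_trans _ _ (upint (fun x => f x + f' x) +
     upint (fun x => `|f x - g x| + `|f' x - g' x|))); last first.
    by rewrite lerD2l; apply: upintD; exact: ban.
  apply: le_trans (upintD _ bs); last by apply: ba; auto.
  apply: upint_mono.
    by apply: bounded_aboveD => //; apply: ba; auto.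
  move=> x; have T (a b : R) : 0 <= a -> `|b| <= a + `|a - b|.
    by move=> a0; have := ler_normB a (a - b); rewrite subKr (ger0_norm a0).
  have := T _ (g x) (f0 x); have := T _ (g' x) (f'0 x); lra.
rewrite /upnorm in H1 H2 H8 fg fg' *; lra.
Qed.

(** * Sets with integrable indicator and the representing measure *)

Definition dset (E : set X) := dintegrable \1_E.
Definition rmeas (E : set X) := ext \1_E.

(** Chebyshev's inequality at level 1/4. *)
Lemma upnorm_ind_le (E : set X) (e : R) k : la k -> (forall x, E x -> 1 <= 4 * k x) ->
  Lam k <= e -> upint \1_E <= 4 * e.
Proof.
move=> lk Ek ke; have [k0 bk _] := lk.
apply: (@le_trans _ _ (upint (fun x => 4 * k x))).
  apply: upint_mono.
    by case: bk => s ks; exists (4 * s) => x; rewrite ler_pM2l.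
  move=> x; rewrite indicE; have [Ex|Ex] := pselect (E x).
    by rewrite mem_set// Ek.
  by rewrite memNset// mulr_ge0.
apply: le_trans (upint_scale _ bk) _ => //.
by rewrite ler_pM2l//; apply: le_trans ke; apply: upint_le_Lam.
Qed.

(* If k >= |1_E - g| has small upper integral, then K = {g - k >= 1/2} lies in E,
   V = {g + k > 1/2} contains E, and 4k >= 1 on V \ K. *)
Lemma dset_regular E (e : R) : dset E -> 0 < e ->
  exists K V, [/\ compact K, open V, K `<=` E, E `<=` V & upint \1_(V `\` K) <= e].
Proof.
move=> [bE IE] e0; have e4 : 0 < e / 4 by rewrite divr_gt0.
have [g cg gE] := IE _ e4.
have [||k [lk Ek ke]] := upint_adh (h := fun x => `|\1_E x - g x|) (e := e / 4 - upnorm (fun x => \1_E x - g x)) _ _.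
- by have [s H] := bounded_fctB bE (bounded_fct_c0 cg); exists s.
- by rewrite subr_gt0.
have {}ke : Lam k <= e / 4.
  by apply/ltW/(lt_le_trans ke); rewrite /upnorm addrC subrK.
have [k0 bk kap] := lk.
pose V := [set x | 1 / 2 < g x + k x].
pose K := [set x | 1 / 2 <= g x - k x].
(* As [k] is lower semicontinuous, so is [g + k], while [g - k] is upper semicontinuous; this makes
   [V] open and [K] closed. *)
have oV : open V.
  rewrite openE => x /= Vx.
  have [p cp [pk px]] := kap x (g x + k x - 1 / 2) ltac:(by rewrite subr_gt0).
  have oW : open [set y | 1 / 2 < g y + p y].
    by apply: open_gt_c0; exact: (c0_add cg cp).1.
  have : nbhs x [set y | 1 / 2 < g y + p y].
    by apply: open_nbhs_nbhs; split => //=; lra.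
  apply: filterS => y /=; have /andP[_] := pk y; rewrite /V /=; lra.
have clK : closed K.
  rewrite -openC openE => x /= /negP; rewrite -ltNge => Kx.
  have [p cp [pk px]] := kap x (1 / 2 - (g x - k x)) ltac:(by rewrite subr_gt0).
  have oW : open [set y | g y - p y < 1 / 2].
    by apply: open_lt_c0; exact: (c0_sub cg cp).1.
  have : nbhs x [set y | g y - p y < 1 / 2].
    by apply: open_nbhs_nbhs; split => //=; lra.
  apply: filterS => y /=; have /andP[_] := pk y; rewrite /K /= => H1 H2.
  by apply/negP; rewrite -ltNge; lra.
have inE x : E x -> 1 - g x <= k x /\ g x - 1 <= k x.
  move=> Ex; have := Ek x; rewrite indicE mem_set//= ler_norml => /andP[]; lra.
have ninE x : ~ E x -> g x <= k x /\ - g x <= k x.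
  move=> Ex; have := Ek x; rewrite indicE memNset//= ler_norml => /andP[]; lra.
exists K, V; split => //.
- have half0 : (0 : R) < 1 / 2 by rewrite divr_gt0.
  apply: (subclosed_compact clK (c0_compact cg half0)) => x /=; rewrite /K /=.
  move=> H; apply: le_trans (ler_norm _); have := k0 x; lra.
- by move=> x Kx; apply: contrapT => /ninE; move: Kx; rewrite /K /=; lra.
- by move=> x /inE; rewrite /V /=; lra.
- rewrite -[leRHS](divfK (x := 4)) ?pnatr_eq0// [leRHS]mulrC; apply: upnorm_ind_le ke => // x [].
  rewrite /V /K /= => H1 /negP; rewrite -ltNge => H2.
  by have [/inE|/ninE] := pselect (E x); lra.
Qed.

Lemma dset_open V : open V -> dset V.
Proof. by move=> /la_open; exact: dintegrable_la. Qed.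

(** The constant 1 is the indicator of the open set [X], hence integrable even when it does not
    vanish at infinity. *)
Lemma dsetC E : dset E -> dset (~` E).
Proof.
move=> dE; have [] := dintegrable_lin (- 1) (dset_open (@openT X)) dE.
rewrite /dset (_ : (fun x => _) = \1_(~` E))//.
apply/funext => x; rewrite !indicE in_setT in_setC mulN1r.
by case: (_ \in E) => /=; rewrite ?subrr ?subr0.
Qed.

Lemma dsetI E F : dset E -> dset F -> dset (E `&` F).
Proof.
move=> [bE IE] [bF IF]; split; first exact: bounded_fct_ind.
move=> e e0; have e2 : 0 < e / 2 by rewrite divr_gt0.
have [g cg gE] := IE _ e2; have [h ch hF] := IF _ e2.
exists (fun x => Num.min (g x) (h x)); first exact: c0_min.
rewrite (splitr e); apply: le_lt_trans (ltrD gE hF).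
have minB (a b c d : R) : `|Num.min a b - Num.min c d| <= `|a - c| + `|b - d|.
  have H1 := ler_norm (a - c); have H2 := ler_norm (b - d).
  have H3 := ler_norm (c - a); have H4 := ler_norm (d - b).
  rewrite distrC in H3; rewrite distrC in H4.
  have H5 := normr_ge0 (a - c); have H6 := normr_ge0 (b - d).
  rewrite ler_norml; apply/andP; case: (leP a b); case: (leP c d); lra.
apply: upnorm_triangle; [by auto..|move=> x].
suff -> : \1_(E `&` F) x = Num.min (\1_E x) (\1_F x) :> R by exact: minB.
rewrite !indicE in_setI; case: (_ \in E); case: (_ \in F) => /=;
  by rewrite ?minxx// ?(min_l ler01) ?(min_r ler01).
Qed.

Lemma dset0 : dset set0.
Proof. by apply: dset_open; exact: open0. Qed.

Lemma dsetU E F : dset E -> dset F -> dset (E `|` F).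
Proof.
move=> dE dF; rewrite -[_ `|` _]setCK setCU.
by apply/dsetC/dsetI; exact: dsetC.
Qed.

Lemma dset_bigsetU (F : nat -> set X) m : (forall k, dset (F k)) -> dset (\big[setU/set0]_(k < m) F k).
Proof. by move=> dF; elim/big_ind : _ => //; [exact: dset0|exact: dsetU]. Qed.

Lemma sum_ind_trivIset (F : nat -> set X) m i x : trivIset setT F -> F i x ->
  \sum_(k < m) \1_(F k) x = (i < m)%:R :> R.
Proof.
move=> tF Fx; elim: m => [|m IH]; first by rewrite big_ord0 ltn0.
rewrite big_ord_recr /= IH indicE; have [mi|mi] := eqVneq m i.
  by rewrite mi ltnn ltnSn mem_set// add0r.
rewrite memNset ?addr0; last first.
  move=> Fm; move/eqP : mi; apply; apply: tF => //; by exists x.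
by rewrite [(i < m.+1)%N]ltnS [(i <= m)%N]leq_eqVlt [i == m]eq_sym (negbTE mi).
Qed.

(** Superadditivity bounds the partial sums of [upint \1_(F k)] by [upint] of the constant 1, so
    these sums have small tails; countable subadditivity bounds the part of the union missed by the
    first [m] sets by such a tail. *)
Lemma dset_tail (F : nat -> set X) : (forall k, dset (F k)) -> trivIset setT F ->
  forall e : R, 0 < e -> exists M, forall m, (M <= m)%N ->
  upnorm (fun x => \1_(\bigcup_k F k) x - \sum_(k < m) \1_(F k) x) <= e.
Proof.
move=> dF tF e e0.
pose a k := upint \1_(F k).
have a0 k : 0 <= a k by apply: upint_ge0; exists 1 => x; rewrite indicE; case: (_ \in _).
have ba (E : set X) : bounded_above (\1_E : X -> R).
  by exists 1 => x; rewrite indicE; case: (_ \in _).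
have sumI m : \sum_(k < m) a k <= upint (fun x => \sum_(k < m) \1_(F k) x) /\
    dintegrable (fun x => \sum_(k < m) \1_(F k) x : R).
  elim: m => [|m [IH1 IH2]].
    rewrite big_ord0 (_ : (fun x => _) = fun=> 0) ?upint0; last first.
      by apply/funext => x; rewrite big_ord0.
    by split => //; apply: dintegrable_c0; exact: c0_0.
  rewrite big_ord_recr /= (_ : (fun x => _) = (fun x => \sum_(k < m) \1_(F k) x + \1_(F m) x)); last first.
    by apply/funext => x; rewrite big_ord_recr.
  split.
    apply: le_trans (upint_superadd IH2 (dF m) _ _) => //.
    - by rewrite lerD2r.
    - by move=> x; apply: sumr_ge0 => k _; rewrite indicE.
  have [+ _] := dintegrable_lin 1 IH2 (dF m).
  by congr dintegrable; apply/funext => x; rewrite mul1r.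
have sum1 m : \sum_(k < m) a k <= upint \1_[set: X].
  have [H _] := sumI m; apply: (le_trans H); apply: upint_mono => // x.
  rewrite [leRHS]indicE in_setT /=.
  have [[i Fx]|nF] := pselect (exists i, F i x).
    by rewrite (sum_ind_trivIset _ tF Fx); case: (i < m)%N.
  by rewrite big1// => k _; rewrite indicE memNset// => Fk; apply: nF; exists k.
pose S := [set \sum_(k < m) a k | m in [set: nat]].
have hS : has_sup S.
  split; first by exists (\sum_(k < 0) a k), 0%N.
  by exists (upint \1_[set: X]) => _ [m _ <-].
have [_ [M _ <-] HM] := sup_adherent e0 hS.
exists M => m Mm.
have bd : bounded_fct (fun x => \sum_(k < m) \1_(F k) x : R) by case: (sumI m) => _ [].
apply: (upint_sigma (f := fun k => \1_(F (m + k)%N))) => //.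
- by have [s H] := bounded_fctB (bounded_fct_ind (\bigcup_k F k)) bd; exists s.
- move=> x d d0; have [[i Fx]|nF] := pselect (exists i, F i x).
    rewrite indicE mem_set/=; last by exists i.
    rewrite (sum_ind_trivIset _ tF Fx); case: (ltnP i m) => im.
      by exists 0%N; rewrite big_ord0 subrr normr0 add0r.
    exists (i - m).+1; rewrite subr0 normr1 big_ord_recr /= subnKC//.
    rewrite [\1_(F i) x]indicE mem_set//= -addrA ltr_wpDl ?ltrDl//.
    by apply: sumr_ge0 => k _; rewrite indicE.
  exists 0%N; rewrite big_ord0 add0r indicE memNset/=; last by move=> [k _ Fk]; apply: nF; exists k.
  rewrite big1 ?subrr ?normr0// => k _; rewrite indicE memNset// => Fk; apply: nF; exists k => //.
- move=> j; have : \sum_(k < m + j) a k <= sup S by apply: sup_ubound; [exact: hS.2|exists (m + j)%N].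
  have : \sum_(k < M) a k <= \sum_(k < m) a k.
    by rewrite -(subnKC Mm) big_split_ord/= lerDl sumr_ge0.
  rewrite big_split_ord/= -/(a _); move: HM.
  move: (\sum_(k < M) a k) (\sum_(k < m) a k) (\sum_(k < j) _) => u v w; lra.
Qed.

Lemma upnorm_sum_ext (F : nat -> set X) m : (forall k, dset (F k)) ->
  dintegrable (fun x => \sum_(k < m) \1_(F k) x : R) /\
  ext (fun x => \sum_(k < m) \1_(F k) x) = \sum_(k < m) rmeas (F k).
Proof.
move=> dF; elim: m => [|m [IH1 IH2]].
  rewrite big_ord0 (_ : (fun x => _) = fun=> 0); last first.
    by apply/funext => x; rewrite big_ord0.
  rewrite ext_c0 ?psi0; last exact: c0_0.
  by split => //; apply: dintegrable_c0; exact: c0_0.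
have := dintegrable_lin 1 IH1 (dF m).
rewrite big_ord_recr /= -IH2 mul1r.
rewrite (_ : (fun x => _) = (fun x => \sum_(k < m.+1) \1_(F k) x))//.
by apply/funext => x; rewrite big_ord_recr mul1r.
Qed.

Lemma dset_bigcup_triv (F : nat -> set X) : (forall k, dset (F k)) -> trivIset setT F ->
  dset (\bigcup_k F k).
Proof.
move=> dF tF; split; first exact: bounded_fct_ind.
move=> e e0; have e4 : 0 < e / 4 by rewrite divr_gt0.
have [M /(_ M (leqnn _)) HM] := dset_tail dF tF e4.
have [[bS /(_ _ e4)[g cg gS]] _] := upnorm_sum_ext M dF.
exists g => //.
apply: (@le_lt_trans _ _ (e / 4 + e / 4)); last by lra.
apply: le_trans (lerD HM (ltW gS)).
apply: upnorm_triangle; [by auto..|move=> x].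
apply: le_trans (ler_normD _ _).
by rewrite le_eqVlt; apply/orP; left; apply/eqP; congr `| _ |; ring.
Qed.

Lemma dset_borel E : borel E -> dset E.
Proof.
apply: smallest_sub; last exact: dset_open.
split; first exact: dset0.
  by move=> A dA; rewrite setTD; exact: dsetC.
move=> F dF; rewrite seqDU_bigcup_eq; apply: dset_bigcup_triv; last exact: trivIset_seqDU.
move=> k; rewrite /seqDU; rewrite setDE; apply: dsetI => //; apply: dsetC.
exact: dset_bigsetU.
Qed.

Lemma rmeas_sigma_additive (F : nat -> set X) : (forall k, borel (F k)) -> trivIset setT F ->
  (fun N => \sum_(k < N) rmeas (F k)) @ \oo --> rmeas (\bigcup_k F k).
Proof.
move=> bF tF; have dF k : dset (F k) by exact: dset_borel.
apply/cvgrPdist_le => e e0.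
have [M HM] := dset_tail dF tF e0.
exists M => // m /= /HM; apply: le_trans.
have [dS eS] := upnorm_sum_ext m dF.
have [dD eD] := dintegrable_lin (- 1) (dset_bigcup_triv dF tF) dS.
have := ext_bound dD; rewrite eD -eS mulN1r; congr (_ <= _).
by congr upnorm; apply/funext => x; rewrite mulN1r.
Qed.

Lemma ext_sum k (c : 'I_k -> R) (E : 'I_k -> set X) : (forall i, borel (E i)) ->
  dintegrable (fun x => \sum_(i < k) c i * \1_(E i) x) /\
  ext (fun x => \sum_(i < k) c i * \1_(E i) x) = \sum_(i < k) c i * rmeas (E i).
Proof.
move=> bE; have dE i : dset (E i) by exact: dset_borel.
elim: (index_enum _) => [|i s [IH1 IH2]].
  rewrite big_nil (_ : (fun x => _) = fun=> 0); last first.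
    by apply/funext => x; rewrite big_nil.
  rewrite ext_c0 ?psi0; last exact: c0_0.
  by split => //; apply: dintegrable_c0; exact: c0_0.
have := dintegrable_lin (c i) IH1 (dE i).
rewrite big_cons -IH2 [ext _ + _]addrC.
rewrite (_ : (fun x => _) = (fun x => \sum_(i <- i :: s) c i * \1_(E i) x))//.
by apply/funext => x; rewrite big_cons addrC.
Qed.

Lemma upint_le_cst (s : R) h : 0 <= s -> (forall x, h x <= s) -> upint h <= B * s.
Proof.
move=> s0 hs; apply: (@le_trans _ _ (Lam (fun=> s))).
  by apply: upint_le_Lam => //; exact: la_cst.
by apply: Lam_le => // g [cg gs]; exact: psiB.
Qed.

(** The sum of absolute values is the extended functional at the step function with value the sign
    of [rmeas (P i)] on [P i], whose modulus is at most [\1_W]. *)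
Lemma rmeas_var k (P : 'I_k -> set X) (W : set X) : (forall i, borel (P i)) ->
  (forall i j, i != j -> P i `&` P j = set0) -> (forall i, P i `<=` W) ->
  \sum_(i < k) `|rmeas (P i)| <= upint \1_W.
Proof.
move=> bP tP PW.
pose c i := Num.sg (rmeas (P i)).
have [dS eS] := ext_sum c bP.
have -> : \sum_(i < k) `|rmeas (P i)| = \sum_(i < k) c i * rmeas (P i).
  by apply: eq_bigr => i _; rewrite normrEsg.
rewrite -eS; apply: le_trans (ler_norm _) (le_trans (ext_bound dS) _).
apply: upint_mono; first by exists 1 => x; rewrite indicE; case: (_ \in _).
move=> x; have [[i Px]|nP] := pselect (exists i, P i x).
  rewrite (bigD1 i)//= big1 ?addr0; last first.
    move=> j ji; rewrite indicE memNset ?mulr0// => Pj.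
    by have := tP _ _ ji; rewrite -subset0 => /(_ x); apply.
  rewrite !indicE !mem_set//; last exact: PW Px.
  by rewrite mulr1 /c normr_sg; case: (_ != _).
rewrite big1 ?normr0 ?indicE// => i _; rewrite indicE memNset ?mulr0// => Pi.
by apply: nP; exists i.
Qed.

(** The integral formula for [psi f] in quantitative form, an error linear in the uniform distance
    to a simple function. [cintegral_eq] later recognizes complex integrals by such a rate. *)
Lemma rmeas_simple f k (c : 'I_k -> R) (E : 'I_k -> set X) (d : R) : c0 f ->
  (forall i, borel (E i)) -> 0 <= d ->
  (forall x, `|f x - \sum_(i < k) c i * \1_(E i) x| <= d) ->
  `|psi f - \sum_(i < k) c i * rmeas (E i)| <= B * d.
Proof.
move=> cf bE d0 fd; have [dS eS] := ext_sum c bE.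
have [dD eD] := dintegrable_lin (- 1) (dintegrable_c0 cf) dS.
rewrite -eS -ext_c0//; move: eD; rewrite mulN1r => <-.
apply: (le_trans (ext_bound dD)); apply: upint_le_cst => // x.
by rewrite mulN1r.
Qed.

Theorem real_riesz : exists nu : set X -> R, [/\
  forall F : nat -> set X, (forall k, borel (F k)) -> trivIset setT F ->
    (fun N => \sum_(k < N) nu (F k)) @ \oo --> nu (\bigcup_k F k),
  forall E (e : R), borel E -> 0 < e -> exists K V,
    [/\ compact K, open V, K `<=` E, E `<=` V &
     forall k (P : 'I_k -> set X), (forall i, borel (P i)) ->
       (forall i j, i != j -> P i `&` P j = set0) -> (forall i, P i `<=` V `\` K) ->
       \sum_(i < k) `|nu (P i)| <= e],
  forall k (P : 'I_k -> set X), (forall i, borel (P i)) ->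
    (forall i j, i != j -> P i `&` P j = set0) -> \sum_(i < k) `|nu (P i)| <= B &
  forall f k (c : 'I_k -> R) (E : 'I_k -> set X) (d : R), c0 f ->
    (forall i, borel (E i)) -> 0 <= d ->
    (forall x, `|f x - \sum_(i < k) c i * \1_(E i) x| <= d) ->
    `|psi f - \sum_(i < k) c i * nu (E i)| <= B * d].
Proof.
exists rmeas; split.
- exact: rmeas_sigma_additive.
- move=> E e bE e0; have [K [V [? ? ? ? VK]]] := dset_regular (dset_borel bE) e0.
  exists K, V; split => // k P bP tP PW; apply: le_trans VK; exact: rmeas_var.
- move=> k P bP tP; apply: le_trans (rmeas_var (W := setT) bP tP _) _ => //.
  rewrite -[leRHS]mulr1; apply: upint_le_cst => //.
- exact: rmeas_simple.
Qed.

End Daniell.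

(** * Complex numbers over a real field *)

Section ComplexNorm.
Variable R : realType.
Implicit Types z w : R[i].
Local Notation Re := (@complex.Re R).
Local Notation Im := (@complex.Im R).
Local Open Scope complex_scope.

(** The norm [|z|] of [R[i]] is itself an element of [R[i]]; estimates are carried out with this
    modulus in [R]. *)
Definition cabs z : R := Normc.normc z.

Lemma cabsE z : `|z| = (cabs z)%:C. Proof. by []. Qed.

Lemma cabs_ge0 z : 0 <= cabs z.
Proof. by case: z => a b; exact: sqrtr_ge0. Qed.

Lemma cabs0 : cabs 0 = 0. Proof. exact: Normc.normc0. Qed.

Lemma cabs0_eq0 z : cabs z = 0 -> z = 0. Proof. exact: Normc.eq0_normc. Qed.

Lemma cabsM z w : cabs (z * w) = cabs z * cabs w.
Proof. exact: Normc.normcM. Qed.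

Lemma cabsN z : cabs (- z) = cabs z. Proof. exact: normcN. Qed.

Lemma ler_cabsD z w : cabs (z + w) <= cabs z + cabs w.
Proof. exact: le_normcD. Qed.

Lemma ler_cabsB z w : cabs (z - w) <= cabs z + cabs w.
Proof. by rewrite -[cabs w]cabsN; exact: ler_cabsD. Qed.

Lemma cabsC z w : cabs (z - w) = cabs (w - z).
Proof. by rewrite -cabsN opprB. Qed.

Lemma ler_cabs_sum (I : Type) (s : seq I) (P : pred I) (F : I -> R[i]) :
  cabs (\sum_(i <- s | P i) F i) <= \sum_(i <- s | P i) cabs (F i).
Proof.
elim/big_rec2 : _ => [|i x y _ H]; first by rewrite cabs0.
by apply: le_trans (ler_cabsD _ _) _; rewrite lerD2l.
Qed.

Lemma ler_Re_cabs z : `|Re z| <= cabs z.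
Proof.
case: z => a b; rewrite /cabs /= -sqrtr_sqr; apply: ler_wsqrtr.
by rewrite lerDl sqr_ge0.
Qed.

Lemma ler_Im_cabs z : `|Im z| <= cabs z.
Proof.
case: z => a b; rewrite /cabs /= -sqrtr_sqr; apply: ler_wsqrtr.
by rewrite lerDr sqr_ge0.
Qed.

Lemma cabs_le_ReIm z : cabs z <= `|Re z| + `|Im z|.
Proof.
case: z => a b; rewrite /cabs /= -[leRHS]ger0_norm ?addr_ge0// -sqrtr_sqr.
apply: ler_wsqrtr; rewrite sqrrD !real_normK ?num_real//.
by rewrite lerD2r lerDl mulrn_wge0// mulr_ge0.
Qed.

Lemma cReD z w : Re (z + w) = Re z + Re w. Proof. by case: z; case: w. Qed.
Lemma cImD z w : Im (z + w) = Im z + Im w. Proof. by case: z; case: w. Qed.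
Lemma cReN z : Re (- z) = - Re z. Proof. by case: z. Qed.
Lemma cImN z : Im (- z) = - Im z. Proof. by case: z. Qed.
Lemma cReB z w : Re (z - w) = Re z - Re w. Proof. by rewrite cReD cReN. Qed.
Lemma cImB z w : Im (z - w) = Im z - Im w. Proof. by rewrite cImD cImN. Qed.
Lemma cReM z w : Re (z * w) = Re z * Re w - Im z * Im w.
Proof. by case: z; case: w. Qed.
Lemma cImM z w : Im (z * w) = Re z * Im w + Im z * Re w.
Proof. by case: z; case: w => a b c d /=. Qed.

Lemma Re_sum (I : Type) (s : seq I) (P : pred I) (F : I -> R[i]) :
  Re (\sum_(i <- s | P i) F i) = \sum_(i <- s | P i) Re (F i).
Proof. by elim/big_rec2 : _ => // i x y _ <-; rewrite cReD. Qed.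

Lemma Im_sum (I : Type) (s : seq I) (P : pred I) (F : I -> R[i]) :
  Im (\sum_(i <- s | P i) F i) = \sum_(i <- s | P i) Im (F i).
Proof. by elim/big_rec2 : _ => // i x y _ <-; rewrite cImD. Qed.

Lemma complexP z w : Re z = Re w -> Im z = Im w -> z = w.
Proof. by case: z; case: w => a b c d /= -> ->. Qed.

(** The order of [R[i]] compares only numbers with equal imaginary parts. This converts the complex
    tolerances of the definitions into real ones. *)
Lemma gt0_complexE (e : R[i]) : 0 < e -> 0 < Re e /\ e = (Re e)%:C.
Proof. by case: e => a b; rewrite ltcE /= => /andP[/eqP -> ->]. Qed.

Lemma ltc_cabs z (e : R) : (`|z| < e%:C) = (cabs z < e).
Proof. by rewrite cabsE ltcR. Qed.

Lemma lec_cabs z (e : R) : (`|z| <= e%:C) = (cabs z <= e).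
Proof. by rewrite cabsE lecR. Qed.

Lemma nbhs_complexP (z : R[i]) (A : set R[i]) :
  nbhs z A <-> exists2 e : R, 0 < e & forall w, cabs (z - w) < e -> A w.
Proof.
split.
  move=> /nbhs_ballP[e /= /gt0_complexE[e0 ee] zA].
  exists (Re e) => // w zw; apply: zA; rewrite /ball /= ee.
  by rewrite ltc_cabs.
move=> [e e0 zA]; apply/nbhs_ballP; exists e%:C; first by rewrite /= ltcR.
by move=> w; rewrite /ball /= ltc_cabs => /zA.
Qed.

Lemma cvg_complexP (u : nat -> R[i]) (l : R[i]) :
  u @ \oo --> l <->
  forall e : R, 0 < e -> exists M, forall m, (M <= m)%N -> cabs (u m - l) <= e.
Proof.
split.
  move=> ul e e0.
  have /ul[M _ HM] : nbhs l [set w | cabs (l - w) < e] by apply/nbhs_complexP; exists e.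
  by exists M => m /HM /= /ltW; rewrite cabsC.
move=> H A /nbhs_complexP[e e0 lA].
have [|M HM] := H (e / 2); first by rewrite divr_gt0.
exists M => // m /= /HM; rewrite cabsC => ul; apply: lA.
by rewrite (le_lt_trans ul)//; lra.
Qed.

Lemma cvg_complex_uniq (u : nat -> R[i]) (l l' : R[i]) :
  u @ \oo --> l -> u @ \oo --> l' -> l = l'.
Proof.
move=> /cvg_complexP H /cvg_complexP H'; apply/eqP; rewrite -subr_eq0; apply/eqP/cabs0_eq0.
apply/le_anti; rewrite cabs_ge0 andbT; apply/ler_addgt0Pr => e e0; rewrite add0r.
have e2 : 0 < e / 2 by rewrite divr_gt0.
have [M HM] := H _ e2; have [M' HM'] := H' _ e2.
have := HM _ (leq_maxl M M'); have := HM' _ (leq_maxr M M').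
rewrite cabsC; set w := u _ => H1 H2.
have -> : l - l' = (l - w) + (w - l') by ring.
by rewrite (splitr e) (le_trans (ler_cabsD _ _))// lerD// cabsC// cabsC.
Qed.

End ComplexNorm.

(** * Borel sets and complex measures *)

Section Borel.
Variable X : topologicalType.
Implicit Types A B : set X.

Lemma borel_open A : open A -> borel A.
Proof. by move=> oA; exact: sub_sigma_algebra. Qed.

Lemma borelC A : borel A -> borel (~` A).
Proof.
have [_ H _] := @smallest_sigma_algebra _ [set: X] (@open X).
by move=> /H; rewrite setTD.
Qed.

Lemma borel_closed A : closed A -> borel A.
Proof. by move=> /closed_openC/borel_open/borelC; rewrite setCK. Qed.

Lemma borel0 : borel (@set0 X). Proof. by apply: borel_open; exact: open0. Qed.

Lemma borelT : borel [set: X]. Proof. by apply: borel_open; exact: openT. Qed.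

Lemma borel_bigcup (F : nat -> set X) : (forall k, borel (F k)) -> borel (\bigcup_k F k).
Proof.
have [_ _ H] := @smallest_sigma_algebra _ [set: X] (@open X).
exact: H.
Qed.

Lemma borelU A B : borel A -> borel B -> borel (A `|` B).
Proof.
move=> bA bB.
rewrite (_ : A `|` B = \bigcup_k (if k is 0%N then A else B)).
  by apply: borel_bigcup => -[|k] /=.
apply/seteqP; split=> [x [Ax|Bx]|x [[|k] _ ?]]; [by exists 0%N|by exists 1%N|by left|by right].
Qed.

Lemma borelI A B : borel A -> borel B -> borel (A `&` B).
Proof.
move=> bA bB; rewrite -[_ `&` _]setCK setCI.
by apply: borelC; apply: borelU; exact: borelC.
Qed.

Lemma borelD A B : borel A -> borel B -> borel (A `\` B).
Proof. by move=> bA bB; rewrite setDE; apply: borelI => //; exact: borelC. Qed.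

Lemma borel_bigsetU (I : Type) (s : seq I) (P : pred I) (F : I -> set X) :
  (forall i, borel (F i)) -> borel (\big[setU/set0]_(i <- s | P i) F i).
Proof. by move=> bF; apply: (@big_ind _ (@borel X)); [exact: borel0|exact: borelU|move=> i _]. Qed.

Lemma borel_bigsetI (I : Type) (s : seq I) (P : pred I) (F : I -> set X) :
  (forall i, borel (F i)) -> borel (\big[setI/setT]_(i <- s | P i) F i).
Proof. by move=> bF; apply: (@big_ind _ (@borel X)); [exact: borelT|exact: borelI|move=> i _]. Qed.

Lemma borel_preimage (h : X -> X) A : continuous h -> borel A -> borel (h @^-1` A).
Proof.
move=> ch; pose G := [set B | borel (h @^-1` B)].
have sG : sigma_algebra setT G.
  split; first by rewrite /G /= preimage_set0; exact: borel0.
    by move=> B GB; rewrite /G /= setTD preimage_setC; exact: borelC.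
  by move=> F GF; rewrite /G /= preimage_bigcup; exact: borel_bigcup.
have oG : @open X `<=` G.
  move=> B oB; apply: borel_open.
  by apply: open_comp => // x _; exact: ch.
exact: (smallest_sub sG oG).
Qed.

End Borel.

Section Measures.
Variables (R : realType) (X : topologicalType).
Local Notation C := R[i].
Implicit Types (nu : set X -> C) (A B E W : set X).

Definition disjoint_fam (I : eqType) (P : I -> set X) :=
  forall i j, i != j -> P i `&` P j = set0.

Lemma disjoint_famP (I : eqType) (P : I -> set X) i j x :
  disjoint_fam P -> P i x -> P j x -> i = j.
Proof.
move=> dP Pi Pj; apply/eqP; apply: contrapT => /negP ij.
by have := dP _ _ ij; rewrite -subset0 => /(_ x); apply.
Qed.

(** A real bound for the variation on [W]. The families need not cover [W], which makes the bound
    monotone in [W]. *)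
Definition var_le nu W (M : R) := forall k (P : 'I_k -> set X),
  (forall i, borel (P i)) -> disjoint_fam P -> (forall i, P i `<=` W) ->
  \sum_(i < k) cabs (nu (P i)) <= M.

Lemma var_le_fin nu W M (I : finType) (P : I -> set X) : var_le nu W M ->
  (forall i, borel (P i)) -> disjoint_fam P -> (forall i, P i `<=` W) ->
  \sum_i cabs (nu (P i)) <= M.
Proof.
move=> H bP dP PW; have := @H #|I| (fun j => P (enum_val j)).
rewrite (reindex _ (onW_bij _ (@enum_val_bij I)))/=; apply => // i j ij.
by apply: dP; apply: contra ij => /eqP/enum_val_inj ->.
Qed.

Lemma var_le_ge0 nu W M : var_le nu W M -> 0 <= M.
Proof.
move=> /(_ 0%N (fun _ => set0)); rewrite big_ord0; apply; [by case..].
Qed.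

Lemma var_le_sub nu W W' M M' : W `<=` W' -> M' <= M -> var_le nu W' M' -> var_le nu W M.
Proof.
move=> WW MM H k P bP dP PW; apply: le_trans MM; apply: H => // i x /PW; exact: WW.
Qed.

Section complex_measure_theory.
Variable nu : set X -> C.
Hypothesis cnu : complex_measure nu.

Lemma cmeas0 : nu set0 = 0.
Proof.
have tr : trivIset setT (fun _ : nat => set0 : set X).
  by apply/trivIsetP => *; rewrite set0I.
have := cnu (fun _ => @borel0 X) tr; rewrite bigcup_const//.
move=> /cvg_complexP H; apply: cabs0_eq0; apply/le_anti; rewrite cabs_ge0 andbT.
apply/ler_addgt0Pr => e e0; rewrite add0r.
have [M HM] := H (e / 2) ltac:(by rewrite divr_gt0).
have H1 := HM _ (leqnn M); have H2 := HM _ (leqnSn M).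
have -> : nu set0 = (\sum_(k < M.+1) nu set0 - nu set0) - (\sum_(k < M) nu set0 - nu set0).
  by rewrite big_ord_recr /=; ring.
by rewrite (splitr e) (le_trans (ler_cabsB _ _))// lerD.
Qed.

Lemma cmeasU A B : borel A -> borel B -> A `&` B = set0 -> nu (A `|` B) = nu A + nu B.
Proof.
move=> bA bB AB0.
pose F k : set X := if k is 0%N then A else if k is 1%N then B else set0.
have tF : trivIset setT F.
  apply/trivIsetP => -[|[|i]] [|[|j]] //= _ _ _; rewrite /F ?setI0 ?set0I//.
  by rewrite setIC.
have -> : A `|` B = \bigcup_k F k.
  apply/seteqP; split=> [x [Ax|Bx]|x [[|[|k]] _ //= ?]].
  - by exists 0%N. - by exists 1%N. - by left. - by right.
apply: (cvg_complex_uniq (cnu _ tF)); first by case=> [|[|k]] //=; exact: borel0.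
apply/cvg_complexP => e e0; exists 2%N => -[|[|m]] // _.
rewrite 2!big_ord_recl /= big1 ?addr0 ?subrr ?cabs0 ?ltW// => i _; exact: cmeas0.
Qed.

Lemma cmeasD A B : borel A -> borel B -> B `<=` A -> nu (A `\` B) = nu A - nu B.
Proof.
move=> bA bB BA; rewrite -{2}(setDUK BA) cmeasU//; [by ring|exact: borelD|].
exact: setDIK.
Qed.

Lemma cmeas_split A B : borel A -> borel B -> nu A = nu (A `&` B) + nu (A `\` B).
Proof.
move=> bA bB; rewrite -cmeasU; [by rewrite setUIDK|exact: borelI|exact: borelD|].
by rewrite setDE setIACA setICr setI0.
Qed.

Lemma cmeas_sum (I : choiceType) (s : seq I) (P : I -> set X) : uniq s ->
  (forall i, borel (P i)) -> disjoint_fam P ->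
  nu (\big[setU/set0]_(i <- s) P i) = \sum_(i <- s) nu (P i).
Proof.
move=> us bP dP; elim: s us => [|i s IH /=]; first by rewrite !big_nil cmeas0.
move=> /andP[si us]; rewrite !big_cons cmeasU ?IH//; first exact: borel_bigsetU.
rewrite -subset0 => x [Pi]; rewrite -bigcup_seq => -[j /= js Pj].
by move: si; rewrite (disjoint_famP dP Pi Pj) js.
Qed.

(* A set on which nu is unbounded splits into a set of the same kind and one of
   measure at least 1; iterating contradicts countable additivity. *)
Lemma cmeas_bounded : exists M, forall A, borel A -> cabs (nu A) <= M.
Proof.
apply: contrapT => nb.
pose unb A := borel A /\ forall M, exists B, [/\ borel B, B `<=` A & M < cabs (nu B)].
have unbT : unb setT.
  split; first exact: borelT.
  move=> M; apply: contrapT => H; apply: nb; exists M => A bA.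
  by rewrite leNgt; apply/negP => MA; apply: H; exists A.
have step A : unb A -> exists B, [/\ unb B, B `<=` A & 1 <= cabs (nu (A `\` B))].
  move=> [bA uA].
  have [B [bB BA HB]] := uA (cabs (nu A) + 1).
  have bAB := borelD bA bB.
  have HAB : 1 <= cabs (nu (A `\` B)).
    rewrite cmeasD// cabsC; have := ler_cabsD (nu B - nu A) (nu A).
    rewrite subrK; lra.
  have [uB|nuB] := pselect (unb B); first by exists B.
  exists (A `\` B); split; first 2 last.
  - rewrite setDD (setIidr BA); have := cabs_ge0 (nu A); lra.
  - split=> // M.
    have [M' HM'] : exists M', forall D, borel D -> D `<=` B -> cabs (nu D) <= M'.
      apply: contrapT => H; apply: nuB; split => // M'.
      apply: contrapT => H'; apply: H; exists M' => D bD DB.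
      by rewrite leNgt; apply/negP => MD; apply: H'; exists D.
    have [D [bD DA MD]] := uA (M + M').
    exists (D `\` B); split; [exact: borelD|by move=> x [/DA]|].
    have := ler_cabsD (nu (D `&` B)) (nu (D `\` B)); rewrite -cmeas_split//.
    have := HM' (D `&` B) (borelI bD bB) (@subIsetr _ _ _); lra.
  - by move=> x [].
have /choice[f Hf] A : exists B, unb A -> [/\ unb B, B `<=` A & 1 <= cabs (nu (A `\` B))].
  by have [/step[B HB]|nA] := pselect (unb A); [exists B|exists A].
pose A k := iter k f setT.
have uA k : unb (A k) by elim: k => //= k IH; case: (Hf _ IH).
have AS k : A k.+1 `<=` A k by case: (Hf _ (uA k)).
have Ale i j : (i <= j)%N -> A j `<=` A i.
  elim: j => [|j IH]; first by rewrite leqn0 => /eqP ->.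
  rewrite leq_eqVlt => /orP[/eqP->//|]; rewrite ltnS => /IH H x /AS; exact: H.
pose D k := A k `\` A k.+1.
have tD : trivIset setT D.
  have H i j : (i < j)%N -> D i `&` D j = set0.
    move=> ij; rewrite -subset0 => x [[_ nA] [Aj _]]; apply: nA; exact: Ale Aj.
  apply/trivIsetP => i j _ _ ij; have [/H//|/H|/eqP] := ltngtP i j; first by rewrite setIC.
  by rewrite (negbTE ij).
have bD k : borel (D k) by apply: borelD; [exact: (uA k).1|exact: (uA k.+1).1].
have /cvg_complexP/(_ (1 / 4) ltac:(by rewrite divr_gt0))[M HM] := cnu bD tD.
have H1 := HM _ (leqnn M); have H2 := HM _ (leqnSn M).
have : 1 <= cabs (nu (D M)) by case: (Hf _ (uA M)).
move: H1 H2; rewrite big_ord_recr /=; set u := \sum_(_ < _) _; set l := nu (\bigcup__ _) => H1 H2.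
have -> : nu (D M) = (u + nu (D M) - l) - (u - l) by ring.
have := ler_cabsB (u + nu (D M) - l) (u - l); lra.
Qed.

(** Real and imaginary parts are treated separately and each is split by sign. Over indices of one
    sign the sum of absolute values is, up to sign, the real or imaginary part of [nu] of a union,
    so it is at most [M]; there are four such sums. *)
Lemma finite_variation : exists M, var_le nu setT M.
Proof.
have [M HM] := cmeas_bounded; exists (4 * M) => k P bP dP _.
have half (g : C -> R) : (forall z w, g (z + w) = g z + g w) -> g 0 = 0 ->
    (forall z, `|g z| <= cabs z) -> \sum_(i < k) `|g (nu (P i))| <= 2 * M.
  move=> gD g0 gc.
  have gsum (s : seq 'I_k) : g (\sum_(i <- s) nu (P i)) = \sum_(i <- s) g (nu (P i)).
    by elim: s => [|i s IH]; rewrite ?big_nil ?big_cons ?gD ?IH.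
  have gs (Q : pred 'I_k) : `|\sum_(i < k | Q i) g (nu (P i))| <= M.
    have -> : \sum_(i < k | Q i) g (nu (P i)) =
        g (nu (\big[setU/set0]_(i <- [seq i <- index_enum 'I_k | Q i]) P i)).
      rewrite cmeas_sum//; last by rewrite filter_uniq// index_enum_uniq.
      by rewrite gsum big_filter.
    by apply: le_trans (gc _) (HM _ _); exact: borel_bigsetU.
  rewrite (bigID (fun i => 0 <= g (nu (P i))))/=.
  have H1 := gs (fun i => 0 <= g (nu (P i))); have H2 := gs (fun i => ~~ (0 <= g (nu (P i)))).
  rewrite (eq_bigr (fun i => g (nu (P i)))); last by move=> i /ger0_norm.
  rewrite [X in _ + X <= _](eq_bigr (fun i => - g (nu (P i)))); last first.
    by move=> i; rewrite -ltNge => /ltr0_norm.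
  rewrite sumrN; move: H1 H2; rewrite !ler_norml => /andP[_ +] /andP[+ _].
  by move: (\sum_(i | _) _) (\sum_(i | _) _) => a b; lra.
have HR := half (@complex.Re R) (@cReD R) erefl (@ler_Re_cabs R).
have HI := half (@complex.Im R) (@cImD R) erefl (@ler_Im_cabs R).
apply: le_trans (ler_sum _ (fun i _ => cabs_le_ReIm (nu (P i)))) _.
rewrite big_split/=; lra.
Qed.

End complex_measure_theory.

End Measures.

(** * Regular complex measures *)

Local Notation total_variation := Defs.total_variation.

Section Good.
Variables (R : realType) (X : topologicalType).
Local Notation C := R[i].
Implicit Types (nu : set X -> C) (A B E W : set X).
Hypothesis hX : hausdorff_space X.

(** Inner and outer regularity in one condition on the variation of the gap [V \ K]. For complex
    measures it is equivalent to [regular_cmeasure], by [regular_radon] and [radon_regular]. *)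
Definition tight nu := forall E (e : R), borel E -> 0 < e -> exists K V,
  [/\ compact K, open V, K `<=` E, E `<=` V & var_le nu (V `\` K) e].

Definition radon_cmeasure nu :=
  [/\ complex_measure nu, exists M, var_le nu setT M & tight nu].

Lemma borel_compact A : compact A -> borel A.
Proof. by move=> cA; apply: borel_closed; exact: compact_closed. Qed.

Definition fam_cat (I J : Type) (P : I -> set X) (Q : J -> set X) (s : I + J) : set X :=
  match s with inl i => P i | inr j => Q j end.

Lemma fam_cat_disjoint (I J : eqType) (P : I -> set X) (Q : J -> set X) A B :
  disjoint_fam P -> disjoint_fam Q -> (forall i, P i `<=` A) -> (forall j, Q j `<=` B) ->
  A `&` B = set0 -> disjoint_fam (fam_cat P Q).
Proof.
move=> dP dQ PA QB AB0 [i|i] [j|j] ij /=.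
- by apply: dP; apply: contra ij => /eqP ->.
- by rewrite -subset0 -AB0 => x [/PA ? /QB].
- by rewrite -subset0 -AB0 => x [/QB ? /PA].
- by apply: dQ; apply: contra ij => /eqP ->.
Qed.

Lemma total_variation_le nu E M : var_le nu E M -> (total_variation nu E <= M%:E)%E.
Proof.
move=> H; apply: ge_ereal_sup => _ [_ [k [P [bP dP PE ->]]] <-].
rewrite lee_fin; apply: H => // i; rewrite -PE; exact: bigcup_sup.
Qed.

(** [total_variation] ranges over partitions of [E]; a disjoint family inside [E] becomes a
    partition once the rest of [E] is added as one more piece. *)
Lemma total_variation_ge nu E M : complex_measure nu -> borel E ->
  (total_variation nu E <= M%:E)%E -> var_le nu E M.
Proof.
move=> cnu bE HM k P bP dP PE.
pose U := \big[setU/set0]_(i < k) P i.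
have bU : borel U by exact: borel_bigsetU.
pose Q := fam_cat P (fun _ : unit => E `\` U).
have UP i : P i `<=` U by move=> x Px; rewrite /U -bigcup_seq; exists i => //=; rewrite mem_index_enum.
have dQ : disjoint_fam Q.
  apply: (@fam_cat_disjoint _ _ _ _ U (E `\` U)) => //; last exact: setDIK.
  by move=> _ x.
pose S (i : 'I_#|{: 'I_k + unit}|) := Q (enum_val i).
have : (((\sum_i Normc.normc (nu (S i))) : R)%:E <= M%:E)%E.
  apply: le_trans HM; apply: ereal_sup_ubound.
  exists (\sum_i Normc.normc (nu (S i))) => //; exists _, S; split => //.
  - by move=> i; rewrite /S; case: (enum_val i) => //= _; exact: borelD.
  - by move=> i j ij; apply: dQ; apply: contra ij => /eqP/enum_val_inj ->.
  - apply/seteqP; split=> x.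
      by move=> [i _]; rewrite /S; case: (enum_val i) => [j /PE//|_ []].
    move=> Ex; have [Ux|Ux] := pselect (U x).
      move: Ux; rewrite /U -bigcup_seq => -[i _ Pi].
      by exists (enum_rank (inl i)) => //; rewrite /S enum_rankK.
    by exists (enum_rank (inr tt)) => //; rewrite /S enum_rankK.
have <- : \sum_(i : 'I_k + unit) Normc.normc (nu (Q i)) = \sum_i Normc.normc (nu (S i)).
  exact: (reindex _ (onW_bij _ (@enum_val_bij _))).
rewrite lee_fin big_sumType /= => H; apply: le_trans H.
by rewrite lerDl sumr_ge0// => i _; exact: cabs_ge0.
Qed.

Lemma total_variation_ge0 nu E : borel E -> (0 <= total_variation nu E)%E.
Proof.
move=> bE; apply: (@le_trans _ _ (\sum_(i < 1) Normc.normc (nu E))%:E).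
  by rewrite lee_fin sumr_ge0// => i _; exact: cabs_ge0.
apply: ereal_sup_ubound; exists (\sum_(i < 1) Normc.normc (nu E)) => //.
exists 1%N, (fun _ => E); split => //; first by move=> i j; rewrite !ord1.
by rewrite bigcup_const//; exists ord0.
Qed.

Lemma total_variation_fin nu E : complex_measure nu -> borel E ->
  exists2 t : R, total_variation nu E = t%:E & var_le nu E t.
Proof.
move=> cnu bE; have [M HM] := finite_variation cnu.
have HE : var_le nu E M by apply: var_le_sub HM.
have := total_variation_le HE; have := total_variation_ge0 nu bE.
case tE : (total_variation nu E) => [t| |] //= _ _.
by exists t => //; apply: total_variation_ge => //; rewrite tE.
Qed.

(** Let [V] and [K] have total variation within [e / 2] of that of [E], and let [Q] be a partition
    of [K] that witnesses this. A family inside [V \ K] together with [Q] is a disjoint family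
    inside [V], which leaves at most [e] for the former. *)
Lemma regular_radon nu : complex_measure nu -> regular_cmeasure nu -> radon_cmeasure nu.
Proof.
move=> cnu rnu; split=> //; first exact: finite_variation.
move=> E e bE e0; have e2 : 0 < e / 2 by rewrite divr_gt0.
have [outE innE] := rnu _ bE.
have [t tE varE] := total_variation_fin cnu bE.
have [_ [V [oV EV] <-] Vt] : exists2 x, [set total_variation nu V | V in
    [set V | open V /\ E `<=` V]] x & (x < (t + e / 2)%:E)%E.
  by apply: ereal_inf_lt; rewrite -outE tE lte_fin ltrDl.
have [_ [K [cK KE] <-] Kt] : exists2 x, [set total_variation nu K | K in
    [set K | compact K /\ K `<=` E]] x & ((t - e / 2)%:E < x)%E.
  by apply: ereal_sup_gt; rewrite -innE tE lte_fin ltrBlDr ltrDl.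
have [_ [_ [k [Q [bQ dQ QK ->]]] <-]] := ereal_sup_gt Kt.
rewrite lte_fin => HQ.
have HV : var_le nu V (t + e / 2).
  by apply: total_variation_ge => //; [exact: borel_open|exact: ltW].
have bK := borel_compact cK.
exists K, V; split => // m P bP dP PVK.
have QK' i : Q i `<=` K by rewrite -QK; exact: bigcup_sup.
have dPQ : disjoint_fam (fam_cat P Q).
  by apply: (@fam_cat_disjoint _ _ _ _ (V `\` K) K) => //; rewrite setIC setDIK.
have := var_le_fin HV _ dPQ; rewrite big_sumType/=.
move=> /(_ _ _)/le_trans H.
have : \sum_i cabs (nu (P i)) + \sum_i cabs (nu (Q i)) <= t + e / 2.
  apply: H => //; first by case.
  by case=> [i x /PVK[]|i x /QK' /KE /EV].
move: HQ; rewrite -/(cabs _); move: (\sum_i cabs (nu (P i))) (\sum_(i < k) _) => a b; lra.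
Qed.

Lemma total_variation_mono nu A B : complex_measure nu -> borel A -> borel B -> A `<=` B ->
  (total_variation nu A <= total_variation nu B)%E.
Proof.
move=> cnu bA bB AB; have [t -> HB] := total_variation_fin cnu bB.
by apply: total_variation_le; apply: var_le_sub HB.
Qed.

Lemma total_variation_add nu A B (e : R) : complex_measure nu -> borel A -> borel B -> A `<=` B ->
  var_le nu (B `\` A) e -> (total_variation nu B <= total_variation nu A + e%:E)%E.
Proof.
move=> cnu bA bB AB He; have [t -> HA] := total_variation_fin cnu bA.
rewrite -EFinD; apply: total_variation_le => k P bP dP PB.
apply: (@le_trans _ _ (\sum_(i < k) (cabs (nu (P i `&` A)) + cabs (nu (P i `\` A))))).
  by apply: ler_sum => i _; rewrite (cmeas_split cnu (bP i) bA); exact: ler_cabsD.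
rewrite big_split/=; apply: lerD.
  apply: HA => [i|i j ij|i x []//]; first exact: borelI.
  by rewrite setIACA dP// set0I.
apply: He => [i|i j ij|i x [/PB ? ?]//]; first exact: borelD.
by rewrite !setDE setIACA dP// set0I.
Qed.

Lemma radon_regular nu : radon_cmeasure nu -> regular_cmeasure nu.
Proof.
move=> [cnu _ tnu] E bE; split; apply/le_anti/andP; split.
- apply: le_ereal_inf_tmp => _ [V [oV EV] <-].
  by apply: total_variation_mono => //; exact: borel_open.
- apply/lee_addgt0Pr => e e0; have [K [V [cK oV KE EV He]]] := tnu _ _ bE e0.
  apply: (@le_trans _ _ (total_variation nu V)).
    by apply: ereal_inf_lbound; exists V.
  apply: total_variation_add => //; first exact: borel_open.
  by apply: var_le_sub He => // x [? nE]; split => // /KE.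
- apply/lee_addgt0Pr => e e0; have [K [V [cK oV KE EV He]]] := tnu _ _ bE e0.
  apply: (@le_trans _ _ (total_variation nu K + e%:E)); last first.
    by rewrite leeD2r//; apply: ereal_sup_ubound; exists K.
  apply: total_variation_add => //; first exact: borel_compact.
  by apply: var_le_sub He => // x [/EV].
- apply: ge_ereal_sup => _ [K [cK KE] <-].
  by apply: total_variation_mono => //; exact: borel_compact.
Qed.

Lemma var_le_lin nu nu' (c : C) W M M' : var_le nu W M -> var_le nu' W M' ->
  var_le (fun A => nu A + c * nu' A) W (M + cabs c * M').
Proof.
move=> H H' k P bP dP PW.
apply: (@le_trans _ _ (\sum_(i < k) (cabs (nu (P i)) + cabs c * cabs (nu' (P i))))).
  by apply: ler_sum => i _; rewrite -cabsM; exact: ler_cabsD.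
rewrite big_split/= -mulr_sumr lerD ?H//.
by rewrite ler_wpM2l ?cabs_ge0// H'.
Qed.

Lemma cmeasure_lin nu nu' (c : C) : complex_measure nu -> complex_measure nu' ->
  complex_measure (fun A => nu A + c * nu' A).
Proof.
move=> H H' F bF tF; apply/cvg_complexP => e e0.
pose d := cabs c + 1; have d0 : 0 < d by rewrite ltr_wpDl ?cabs_ge0.
have /cvg_complexP/(_ (e / 2) ltac:(by rewrite divr_gt0))[M HM] := H F bF tF.
have /cvg_complexP/(_ (e / 2 / d) ltac:(by rewrite !divr_gt0))[M' HM'] := H' F bF tF.
exists (maxn M M') => m; rewrite geq_max => /andP[/HM h /HM' h'].
rewrite big_split/= -mulr_sumr; move: h h'.
set u := \sum_(_ < _) _; set u' := \sum_(_ < _) _; set l := nu _; set l' := nu' _ => h h'.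
have -> : u + c * u' - (l + c * l') = (u - l) + c * (u' - l') by ring.
rewrite (splitr e) (le_trans (ler_cabsD _ _))// lerD// cabsM.
apply: (@le_trans _ _ (d * (e / 2 / d))); last by rewrite mulrCA divff ?mulr1// gt_eqF.
apply: ler_pM; rewrite ?cabs_ge0// /d; lra.
Qed.

Lemma radon_lin nu nu' (c : C) : radon_cmeasure nu -> radon_cmeasure nu' ->
  radon_cmeasure (fun A => nu A + c * nu' A).
Proof.
move=> [cnu [M HM] tnu] [cnu' [M' HM'] tnu']; split; first exact: cmeasure_lin.
  by exists (M + cabs c * M'); exact: var_le_lin.
move=> E e bE e0; pose d := cabs c + 1; have d0 : 0 < d by rewrite ltr_wpDl ?cabs_ge0.
have [K [V [cK oV KE EV He]]] := tnu E (e / 2) bE ltac:(by rewrite divr_gt0).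
have [K' [V' [cK' oV' KE' EV' He']]] := tnu' E (e / 2 / d) bE ltac:(by rewrite !divr_gt0).
exists (K `|` K'), (V `&` V'); split.
- exact: compactU.
- exact: openI.
- by move=> x [/KE|/KE'].
- by move=> x Ex; split; [exact: EV|exact: EV'].
pose W := (V `&` V') `\` (K `|` K').
have H : var_le nu W (e / 2).
  by apply: var_le_sub He => // x [[? ?] n]; split => // Kx; apply: n; left.
have H' : var_le nu' W (e / 2 / d).
  by apply: var_le_sub He' => // x [[? ?] n]; split => // Kx; apply: n; right.
apply: var_le_sub (var_le_lin c H H') => //.
rewrite [leRHS](splitr e) lerD//.
apply: (@le_trans _ _ (d * (e / 2 / d))); last by rewrite mulrCA divff ?mulr1// gt_eqF.
by rewrite ler_wpM2r ?divr_ge0 ?ltW// /d ltrDl.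
Qed.

Lemma radon0 : radon_cmeasure (fun _ : set X => 0 : C).
Proof.
have v0 W : var_le (fun _ : set X => 0 : C) W 0.
  by move=> k P _ _ _; rewrite big1// => i _; exact: cabs0.
split.
- move=> F _ _; apply/cvg_complexP => e e0; exists 0%N => m _.
  by rewrite big1// subrr cabs0 ltW.
- by exists 0.
- move=> E e bE e0; exists set0, setT; split => //; [exact: compact0|exact: openT|].
  by apply: var_le_sub (v0 (setT `\` set0)); [|exact: ltW].
Qed.

Lemma radon_sum (I : Type) (s : seq I) (nu : I -> set X -> C) (c : I -> C) :
  (forall i, radon_cmeasure (nu i)) -> radon_cmeasure (fun A => \sum_(i <- s) c i * nu i A).
Proof.
move=> rnu; elim: s => [|i s IH].
  by rewrite (_ : (fun A => _) = fun=> 0); [exact: radon0|apply/funext => A; rewrite big_nil].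
rewrite (_ : (fun A => _) = (fun A => \sum_(i <- s) c i * nu i A + c i * nu i A)).
  exact: radon_lin.
by apply/funext => A; rewrite big_cons addrC.
Qed.

Lemma radon_image nu (h h' : X -> X) : continuous h -> continuous h' ->
  cancel h h' -> cancel h' h -> radon_cmeasure nu -> radon_cmeasure (fun A => nu (h @` A)).
Proof.
move=> ch ch' hK h'K [cnu [M HM] tnu].
have imE A : h @` A = h' @^-1` A.
  apply/seteqP; split=> [_ [x Ax <-]|x Ax]; first by rewrite /= hK.
  by exists (h' x).
have im'E A : h' @` A = h @^-1` A.
  apply/seteqP; split=> [_ [x Ax <-]|x Ax]; first by rewrite /= h'K.
  by exists (h x).
have bh A : borel A -> borel (h @` A) by rewrite imE; exact: borel_preimage.
have bh' A : borel A -> borel (h' @` A) by rewrite im'E; exact: borel_preimage.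
have varh W W' N : h @` W `<=` W' -> var_le nu W' N -> var_le (fun A => nu (h @` A)) W N.
  move=> hW HN k P bP dP PW; apply: (HN _ (fun i => h @` P i)) => [i|i j ij|i].
  - exact: bh.
  - by rewrite !imE -preimage_setI dP// preimage_set0.
  - by move=> _ [x /PW Wx <-]; apply: hW; exists x.
split.
- move=> F bF tF; rewrite image_bigcup; apply: (cnu (fun k => h @` F k)) => [k|].
    exact: bh.
  apply/trivIsetP => i j _ _ ij; rewrite !imE -preimage_setI.
  by move/trivIsetP : tF => -> //; rewrite preimage_set0.
- by exists M; exact: varh HM.
- move=> E e bE e0; have [K [V [cK oV KE EV He]]] := tnu (h @` E) e (bh _ bE) e0.
  exists (h' @` K), (h @^-1` V); split.
  + by apply: continuous_compact => //; exact: continuous_subspaceT.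
  + by apply: open_comp => // x _; exact: ch.
  + by move=> _ [x /KE[y Ey <-] <-]; rewrite hK.
  + by move=> x Ex; apply: EV; exists x.
  + apply: varh He => _ [x [Vx nK] <-]; split => // Khx; apply: nK.
    by exists (h x) => //; rewrite hK.
Qed.

End Good.

(** * Integration against complex measures *)

Section Integral.
Variables (R : realType) (X : topologicalType).
Local Notation C := R[i].
Local Notation "x %:C" := (real_complex R x) : ring_scope.
Implicit Types (nu : set X -> C) (A B E W : set X) (f g : X -> C).

Lemma ler_addmul_eps (a b M : R) : 0 <= M ->
  (forall e, 0 < e -> a <= b + e * M) -> a <= b.
Proof.
move=> M0 H; apply/ler_addgt0Pr => e e0.
have M1 : 0 < M + 1 by rewrite ltr_wpDl.
apply: le_trans (H _ (divr_gt0 e0 M1)) _; rewrite lerD2l mulrAC ler_pdivrMr//.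
by rewrite ler_wpM2l ?lerDl// ltW.
Qed.

Lemma indC A x : \1_A x = (\1_A x : R)%:C :> C.
Proof. by rewrite !indicE; case: (_ \in _). Qed.

Lemma cabs_real (r : R) : cabs r%:C = `|r|.
Proof. by rewrite /cabs /= expr0n /= addr0 sqrtr_sqr. Qed.

Lemma realcB (r t : R) : (r - t)%:C = r%:C - t%:C :> C.
Proof. exact: rmorphB. Qed.

(** The sets [E i] may overlap. They are refined into the atoms [A S], the points of [W] lying in
    [E i] exactly for [i] in [S]; the simple function is constant on each atom, and the variation
    bound applies to the atoms. *)
Lemma simple_bound nu W (M s : R) (I : finType) (c : I -> C) (E : I -> set X) :
  complex_measure nu -> borel W -> var_le nu W M -> (forall i, borel (E i)) -> 0 <= s ->
  (forall x, W x -> cabs (\sum_i c i * \1_(E i) x) <= s) ->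
  cabs (\sum_i c i * nu (E i `&` W)) <= s * M.
Proof.
move=> cnu bW HM bE s0 Hs.
pose A (S : {set I}) := W `&` \big[setI/setT]_i (if i \in S then E i else ~` E i).
have bA S : borel (A S).
  apply: borelI => //; apply: borel_bigsetI => i.
  by case: ifP => // _; exact: borelC.
have AP S x : A S x <-> W x /\ S = [set i | x \in E i]%SET.
  rewrite /A -bigcap_seq; split=> [[Wx Hx]|[Wx ->]].
    split => //; apply/setP => i; rewrite inE.
    have := Hx i (mem_index_enum i); case: ifP => _ /= Ex; first by rewrite mem_set.
    by rewrite memNset.
  by split=> // i _; rewrite inE; case: ifP => [/set_mem//|/negP + Ex]; apply; exact: mem_set.
have dA : disjoint_fam A.
  move=> S T ST; rewrite -subset0 => x [/AP[_ HS] /AP[_ HT]].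
  by move: ST; rewrite HS HT eqxx.
have nuE i : nu (E i `&` W) = \sum_(S : {set I} | i \in S) nu (A S).
  have -> : E i `&` W = \big[setU/set0]_(S <- [seq S : {set I} <- index_enum _ | i \in S]) A S.
    rewrite -bigcup_seq; apply/seteqP; split=> x.
      move=> [Ex Wx]; exists [set i | x \in E i]%SET; last exact/AP.
      by rewrite /= mem_filter mem_index_enum andbT inE mem_set.
    move=> [S /=]; rewrite mem_filter => /andP[iS _] /AP[Wx HS]; split => //.
    by move: iS; rewrite HS inE => /set_mem.
  by rewrite cmeas_sum ?big_filter// filter_uniq// index_enum_uniq.
have -> : \sum_i c i * nu (E i `&` W) = \sum_(S : {set I}) (\sum_(i in S) c i) * nu (A S).
  under eq_bigr do rewrite nuE mulr_sumr big_mkcond /=.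
  rewrite exchange_big/=; apply: eq_bigr => S _.
  by rewrite mulr_suml [RHS]big_mkcond.
apply: (@le_trans _ _ (\sum_(S : {set I}) s * cabs (nu (A S)))); last first.
  rewrite -mulr_sumr ler_wpM2l//; apply: var_le_fin HM _ _ _ => // S x /AP[]//.
apply: (le_trans (ler_cabs_sum _ _ _)); apply: ler_sum => S _; rewrite cabsM.
have [[x ASx]|nA] := pselect (A S !=set0); last first.
  have -> : A S = set0 by apply/seteqP; split => // x Ax; apply: nA; exists x.
  by rewrite cmeas0// cabs0 !mulr0.
rewrite ler_wpM2r ?cabs_ge0//; have [Wx SE] := (AP S x).1 ASx.
apply: le_trans (Hs x Wx); rewrite le_eqVlt; apply/orP; left; apply/eqP; congr cabs.
rewrite big_mkcond/=; apply: eq_bigr => i _; rewrite SE inE indicE.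
by case: (x \in E i); rewrite ?mulr1 ?mulr0.
Qed.

Definition simple_approx f (d : R) (I : finType) (c : I -> C) (E : I -> set X) :=
  (forall i, borel (E i)) /\ forall x, cabs (f x - \sum_i c i * \1_(E i) x) <= d.

(** For any other function [is_cintegral] holds vacuously for every value, so [cintegral] is
    meaningful only here. *)
Definition approximable f := forall d : R, 0 < d ->
  exists (k : nat) (c : 'I_k -> C) (E : 'I_k -> set X), simple_approx f d c E.

Lemma simple_approx_ord f d (I : finType) (c : I -> C) (E : I -> set X) :
  simple_approx f d c E ->
  exists (k : nat) (c' : 'I_k -> C) (E' : 'I_k -> set X), simple_approx f d c' E' /\
    forall nu, \sum_i c i * nu (E i) = \sum_i c' i * nu (E' i).
Proof.
move=> [bE fE]; exists #|I|, (fun i => c (enum_val i)), (fun i => E (enum_val i)).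
have re (F : I -> C) : \sum_i F i = \sum_(j < #|I|) F (enum_val j).
  exact: (reindex _ (onW_bij _ (@enum_val_bij I))).
split; last by move=> nu; rewrite re.
by split=> // x; have := fE x; rewrite re.
Qed.

Lemma simple_approx_lin f g (a : C) d d' (I J : finType) (c : I -> C) (E : I -> set X)
    (c' : J -> C) (E' : J -> set X) :
  simple_approx f d c E -> simple_approx g d' c' E' ->
  simple_approx (fun x => f x + a * g x) (d + cabs a * d')
    (fun s : I + J => match s with inl i => c i | inr j => a * c' j end) (fam_cat E E').
Proof.
move=> [bE fE] [bE' gE']; split; first by case.
move=> x; rewrite big_sumType /=.
have -> : \sum_j a * c' j * \1_(E' j) x = a * \sum_j c' j * \1_(E' j) x.
  by rewrite mulr_sumr; apply: eq_bigr => j _; rewrite mulrA.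
set u := \sum_i _; set v := \sum_i _.
have -> : f x + a * g x - (u + a * v) = (f x - u) + a * (g x - v) by ring.
rewrite (le_trans (ler_cabsD _ _))// lerD//.
by rewrite cabsM ler_wpM2l ?cabs_ge0//; exact: gE'.
Qed.

Lemma approximable_lin f g (a : C) : approximable f -> approximable g ->
  approximable (fun x => f x + a * g x).
Proof.
move=> af ag d d0; pose b := cabs a + 1; have b0 : 0 < b by rewrite ltr_wpDl ?cabs_ge0.
have [k [c [E H]]] := af (d / 2) ltac:(by rewrite divr_gt0).
have [k' [c' [E' H']]] := ag (d / 2 / b) ltac:(by rewrite !divr_gt0).
have [m [c0 [E0 [[bE0 H0] _]]]] := simple_approx_ord (simple_approx_lin a H H').
exists m, c0, E0; split => // x; apply: le_trans (H0 x) _.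
rewrite [leRHS](splitr d) lerD2l; apply: (@le_trans _ _ (b * (d / 2 / b))).
  by rewrite ler_wpM2r ?divr_ge0 ?ltW// /b ltrDl.
by rewrite mulrCA divff ?mulr1// gt_eqF.
Qed.

Lemma approximable0 : approximable (fun=> 0).
Proof.
move=> d d0; exists 0%N, (fun _ => 0), (fun _ => set0); split; first by case.
by move=> x; rewrite big_ord0 subrr cabs0 ltW.
Qed.

(** A staircase of step [d]: the constant [- s], carried by the index [None], plus [d] for every
    level [(j + 1) * d - s] that [p] reaches. [N] is such that the levels exhaust the range from
    [- s] to [s]. *)
Lemma approximable_c0 (p : X -> R) : c0 p -> approximable (fun x => (p x)%:C).
Proof.
move=> cp d d0; have [s s0 ps] := c0_bounded cp.
pose N := (Num.truncn (2 * s / d)).+1.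
have Nd : 2 * s < N%:R * d by rewrite -ltr_pdivrMr// truncnS_gt.
pose E (o : option 'I_N) := if o is Some j then [set x | j.+1%:R * d - s <= p x] else setT.
pose c (o : option 'I_N) : C := if o is Some j then d%:C else (- s)%:C.
suff H : simple_approx (fun x => (p x)%:C) d c E.
  by have [m [c0 [E0 [? _]]]] := simple_approx_ord H; exists m, c0, E0.
split.
  case=> [j|]; last exact: borelT.
  by apply: borel_closed; apply: closed_ge_c0; exact: cp.1.
move=> x.
have -> : \sum_o c o * \1_(E o) x = (- s + \sum_(j < N) d * (j.+1%:R * d <= p x + s)%R%:R)%:C.
  rewrite (bigD1 None)//= indicE in_setT mulr1 rmorphD /=; congr (_ + _).
  rewrite (reindex_omap Some id)/=; last by case.
  rewrite rmorph_sum /=; under eq_bigl => j do rewrite eqxx.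
  apply: eq_bigr => j _; rewrite indC -rmorphM /= indicE; congr (real_complex R (d * _)).
  congr (nat_of_bool _)%:R; rewrite -lerBlDr; apply/idP/idP => [/set_mem//|H]; exact: mem_set.
rewrite -realcB cabs_real.
set t := p x + s.
have t0 : 0 <= t by have := ps x; rewrite ler_norml => /andP[]; rewrite /t; lra.
have tN : t < N%:R * d.
  by apply: le_lt_trans Nd; have := ps x; rewrite ler_norml => /andP[]; rewrite /t; lra.
(* By induction on the number of levels: either the staircase is within [d] of [t], or all levels so
   far have been reached. *)
have : let S := \sum_(j < N) d * (j.+1%:R * d <= t)%R%:R in
  [/\ S <= t, S <= N%:R * d & (t <= S + d) \/ S = N%:R * d].
  elim: (N) => [|m [IH1 IH2 IH3]]; first by rewrite big_ord0 mul0r; split => //; right.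
  rewrite big_ord_recr /=; set S := \sum_(_ < m) _ in IH1 IH2 IH3 *.
  rewrite -natr1 mulrDl mul1r in IH2 IH3 *.
  case: (leP (m%:R * d + d) t) => mt; rewrite ?mulr1 ?mulr0 ?addr0.
    have SE : S = m%:R * d.
      by case: IH3 => // IH3; apply/le_anti; rewrite IH2/= -(lerD2r d) (le_trans mt).
    by rewrite SE; split; [lra|lra|right].
  split; [lra|lra|left]; case: IH3 => // ->; exact: ltW.
set S := \sum_(j < N) _ => -[H1 H2 H3].
have -> : p x - (- s + S) = t - S by rewrite /t; ring.
rewrite ger0_norm ?subr_ge0// lerBlDl; case: H3 => // ->.
by rewrite (le_trans (ltW tN))// lerDl ltW.
Qed.

Definition c0C f := c0 (fun x => complex.Re (f x)) /\ c0 (fun x => complex.Im (f x)).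

Lemma approximable_c0C f : c0C f -> approximable f.
Proof.
move=> [/approximable_c0 cr /approximable_c0 ci].
have := approximable_lin 'i%C cr ci; congr approximable.
by apply/funext => x; rewrite -complexE.
Qed.

Section fixed_measure.
Variables (nu : set X -> C) (M : R).
Hypotheses (cnu : complex_measure nu) (HM : var_le nu setT M).

Let M0 : 0 <= M := var_le_ge0 HM.

Lemma simple_dist f (d d' : R) (I J : finType) (c : I -> C) (E : I -> set X)
    (c' : J -> C) (E' : J -> set X) : 0 <= d -> 0 <= d' ->
  simple_approx f d c E -> simple_approx f d' c' E' ->
  cabs (\sum_i c i * nu (E i) - \sum_i c' i * nu (E' i)) <= (d + d') * M.
Proof.
move=> d0 d'0 H H'; have [bE _] := H; have [bE' _] := H'.
have [bEE] := simple_approx_lin (- 1) H H'.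
rewrite cabsN [cabs 1]Normc.normc1 mul1r => HE.
have := simple_bound (c := fun s : I + J => match s with inl i => c i | inr j => -1 * c' j end)
  (E := fam_cat E E') (s := d + d') cnu (@borelT X) HM bEE (addr_ge0 d0 d'0).
rewrite big_sumType /=.
have -> : \sum_i c i * nu (E i `&` setT) = \sum_i c i * nu (E i).
  by apply: eq_bigr => i _; rewrite setIT.
have -> : \sum_j -1 * c' j * nu (E' j `&` setT) = - \sum_j c' j * nu (E' j).
  by rewrite -sumrN; apply: eq_bigr => j _; rewrite setIT mulN1r mulNr.
apply => x _; have := HE x; congr (_ <= _).
by rewrite mulN1r subrr add0r cabsN.
Qed.

(** By [simple_dist], the values on simple functions at distances [d] and [d'] from [f] differ by at
    most [(d + d') * M]. For real and imaginary parts separately, lower estimates with error [d * M]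
    thus stay below all upper ones, and their supremum is the integral. *)
Lemma cintegral_exists f : approximable f -> exists v, is_cintegral nu f v.
Proof.
move=> af.
have part (g : C -> R) : (forall z w, g (z - w) = g z - g w) -> (forall z, `|g z| <= cabs z) ->
    exists r, forall k (c : 'I_k -> C) (E : 'I_k -> set X) (d : R), 0 <= d -> simple_approx f d c E ->
    `|g (\sum_i c i * nu (E i)) - r| <= d * M.
  move=> gB gc.
  pose S := [set r | exists k (c : 'I_k -> C) (E : 'I_k -> set X) (d : R), [/\ 0 <= d, simple_approx f d c E &
     r = g (\sum_i c i * nu (E i)) - d * M]].
  have H k (c : 'I_k -> C) (E : 'I_k -> set X) (d : R) k' (c' : 'I_k' -> C) (E' : 'I_k' -> set X) (d' : R) : 0 <= d -> 0 <= d' ->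
      simple_approx f d c E -> simple_approx f d' c' E' ->
      g (\sum_i c i * nu (E i)) - d * M <= g (\sum_i c' i * nu (E' i)) + d' * M.
    move=> d0 d'0 h h'; have := simple_dist d0 d'0 h h'; rewrite mulrDl.
    have := gc (\sum_i c i * nu (E i) - \sum_i c' i * nu (E' i)); rewrite gB ler_norml => /andP[_].
    set u := g _; set u' := g _; move: (cabs _) => v; lra.
  have hS : has_sup S.
    have [k [c [E h]]] := af 1 ltr01.
    split; first by exists (g (\sum_i c i * nu (E i)) - 1 * M), k, c, E, 1.
    exists (g (\sum_i c i * nu (E i)) + 1 * M) => _ [k' [c' [E' [d' [d'0 h' ->]]]]].
    exact: H.
  exists (sup S) => k c E d d0 h; rewrite ler_distlC -lerBlDr; apply/andP; split.
    by apply: sup_ubound; [exact: hS.2|exists k, c, E, d].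
  rewrite lerBlDr; apply: ge_sup; first exact: hS.1.
  by move=> _ [k' [c' [E' [d' [d'0 h' ->]]]]]; exact: H.
have [a Ha] := part _ (@cReB R) (@ler_Re_cabs R).
have [b Hb] := part _ (@cImB R) (@ler_Im_cabs R).
exists (Complex a b) => e /gt0_complexE[e0 ->].
pose d := complex.Re e / (2 * M + 1) / 2.
have M1 : 0 < 2 * M + 1 by rewrite ltr_wpDl// mulr_ge0.
have d0 : 0 < d by rewrite !divr_gt0.
exists d%:C; first by rewrite ltcR.
move=> k c E bE fE; rewrite ltc_cabs.
have h : simple_approx f d c E by split => // x; rewrite -lec_cabs.
have := Ha _ _ _ _ (ltW d0) h; have := Hb _ _ _ _ (ltW d0) h.
have := cabs_le_ReIm (\sum_(i < k) c i * nu (E i) - Complex a b); rewrite cReB cImB /=.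
have : d * (2 * M + 1) < complex.Re e by rewrite /d mulrAC divfK ?gt_eqF//; lra.
move: (`|_ - a|) (`|_ - b|) (cabs _) => x y z; nra.
Qed.

(** Comparison with an arbitrarily fine second approximation turns the qualitative [is_cintegral]
    into an error bound linear in [d]. *)
Lemma cintegral_approx f (d : R) (I : finType) (c : I -> C) (E : I -> set X) :
  approximable f -> 0 <= d -> simple_approx f d c E ->
  cabs (\sum_i c i * nu (E i) - cintegral nu f) <= d * M.
Proof.
move=> af d0 h.
have Hv : is_cintegral nu f (cintegral nu f).
  by have [v Hv] := cintegral_exists af; apply: (xgetPex 0); exists v.
apply: (@ler_addmul_eps _ _ (M + 1)); first by rewrite addr_ge0.
move=> e e0; have [d' d'0 Hd'] := Hv e%:C ltac:(by rewrite ltcR).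
have [d'0' d'E] := gt0_complexE d'0.
pose m := Num.min e (complex.Re d').
have m0 : 0 < m by rewrite lt_min e0.
have me : m <= e by rewrite ge_min lexx.
have [k [c' [E' h']]] := af _ m0; have [bE' fE'] := h'.
have := Hd' k c' E' bE'; rewrite ltc_cabs => /(_ _)/ltW H.
have {}H : cabs (\sum_(i < k) c' i * nu (E' i) - cintegral nu f) <= e.
  apply: H => x; rewrite d'E lec_cabs; apply: le_trans (fE' x) _.
  by rewrite ge_min lexx orbT.
have := simple_dist d0 (ltW m0) h h'.
set u := \sum_i _; set u' := \sum_(i < k) _ in H *; set v := cintegral _ _ in H * => H1.
have -> : u - v = (u - u') + (u' - v) by ring.
apply: le_trans (ler_cabsD _ _) (le_trans (lerD H1 H) _).
have : m * M <= e * M by rewrite ler_wpM2r.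
rewrite mulrDl mulrDr mulr1; lra.
Qed.

(** Any linear rate [M'] identifies the integral. Integrals against sums and images of measures, and
    against the Riesz measure, are computed this way. *)
Lemma cintegral_eq f v (M' : R) : approximable f -> 0 <= M' ->
  (forall k (c : 'I_k -> C) (E : 'I_k -> set X) (d : R), 0 <= d -> simple_approx f d c E ->
    cabs (\sum_i c i * nu (E i) - v) <= d * M') ->
  cintegral nu f = v.
Proof.
move=> af M'0 H; apply/eqP; rewrite -subr_eq0; apply/eqP/cabs0_eq0/le_anti.
rewrite cabs_ge0 andbT; apply: (@ler_addmul_eps _ _ (M + M')); first by rewrite addr_ge0.
move=> e e0; have [k [c [E h]]] := af _ e0.
have := cintegral_approx af (ltW e0) h; have := H _ _ _ _ (ltW e0) h.
rewrite add0r [X in _ -> X <= _ -> _]cabsC; set u := \sum_i _ => H1 H2.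
have -> : cintegral nu f - v = (cintegral nu f - u) + (u - v) by ring.
by rewrite mulrDr (le_trans (ler_cabsD _ _))// lerD.
Qed.

Lemma cintegral_bound f (s : R) : approximable f -> 0 <= s -> (forall x, cabs (f x) <= s) ->
  cabs (cintegral nu f) <= s * M.
Proof.
move=> af s0 fs.
have := cintegral_approx (c := fun _ : 'I_0 => 0) (E := fun _ => set0) af s0.
rewrite big_ord0 sub0r cabsN; apply; split; first by case.
by move=> x; rewrite big_ord0 subr0.
Qed.

Lemma cintegral_lin f g (a : C) : approximable f -> approximable g ->
  cintegral nu (fun x => f x + a * g x) = cintegral nu f + a * cintegral nu g.
Proof.
move=> af ag; have afg := approximable_lin a af ag.
apply: (@cintegral_eq _ _ M) => // k c E d d0 h.
apply: (@ler_addmul_eps _ _ ((1 + cabs a) * (2 * M))).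
  by rewrite mulr_ge0 ?addr_ge0 ?cabs_ge0 ?mulr_ge0.
move=> e e0.
have [k1 [c1 [E1 h1]]] := af _ e0; have [k2 [c2 [E2 h2]]] := ag _ e0.
have H1 := cintegral_approx af (ltW e0) h1; have H2 := cintegral_approx ag (ltW e0) h2.
have e2 : 0 <= e + cabs a * e by rewrite addr_ge0 ?mulr_ge0 ?cabs_ge0 ?ltW.
have := simple_dist d0 e2 h (simple_approx_lin a h1 h2).
rewrite big_sumType /=.
have -> : \sum_j a * c2 j * nu (E2 j) = a * \sum_j c2 j * nu (E2 j).
  by rewrite mulr_sumr; apply: eq_bigr => j _; rewrite mulrA.
set u := \sum_i _; set u1 := \sum_i _ in H1 *; set u2 := \sum_i _ in H2 * => H3.
set v1 := cintegral _ _ in H1 *; set v2 := cintegral _ _ in H2 *.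
have -> : u - (v1 + a * v2) = (u - (u1 + a * u2)) + ((u1 - v1) + a * (u2 - v2)) by ring.
apply: (le_trans (ler_cabsD _ _)); apply: le_trans (lerD H3 (ler_cabsD _ _)) _.
rewrite cabsM; have := ler_wpM2l (cabs_ge0 a) H2; move: H1.
move: (cabs (u1 - v1)) (cabs a * cabs (u2 - v2)) (cabs a) => x y z; lra.
Qed.

End fixed_measure.

Lemma approximable_sum (I : Type) (s : seq I) (a : I -> C) (f : I -> X -> C) :
  (forall i, approximable (f i)) -> approximable (fun x => \sum_(i <- s) a i * f i x).
Proof.
move=> af; elim: s => [|i s IH].
  rewrite (_ : (fun x => _) = fun=> 0); first exact: approximable0.
  by apply/funext => x; rewrite big_nil.
rewrite (_ : (fun x => _) = (fun x => \sum_(i <- s) a i * f i x + a i * f i x)).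
  exact: approximable_lin.
by apply/funext => x; rewrite big_cons addrC.
Qed.

Lemma cintegral_sum nu (I : Type) (s : seq I) (a : I -> C) (f : I -> X -> C) :
  radon_cmeasure nu -> (forall i, approximable (f i)) ->
  cintegral nu (fun x => \sum_(i <- s) a i * f i x) = \sum_(i <- s) a i * cintegral nu (f i).
Proof.
move=> [cnu [M HM] _] af; elim: s => [|i s IH].
  rewrite big_nil (_ : (fun x => _) = fun=> 0); last by apply/funext => x; rewrite big_nil.
  apply: cabs0_eq0; apply/le_anti; rewrite cabs_ge0 andbT -(mul0r M).
  by apply: cintegral_bound => //; [exact: approximable0|move=> x; rewrite cabs0].
rewrite (_ : (fun x => _) = (fun x => \sum_(i <- s) a i * f i x + a i * f i x)).
  by rewrite (cintegral_lin cnu HM)//; [rewrite IH big_cons addrC|exact: approximable_sum].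
by apply/funext => x; rewrite big_cons addrC.
Qed.

Lemma cintegral_measure_sum (I : finType) (a : I -> C) (nu : I -> set X -> C) f :
  (forall i, radon_cmeasure (nu i)) -> approximable f ->
  cintegral (fun A => \sum_i a i * nu i A) f = \sum_i a i * cintegral (nu i) f.
Proof.
move=> rnu af.
have [cs [Ms HMs] _] := radon_sum (index_enum I) a rnu.
have /choice[M HM] i : exists M, var_le (nu i) setT M by case: (rnu i).
have M0 i : 0 <= M i := var_le_ge0 (HM i).
apply: (@cintegral_eq _ Ms cs HMs _ _ (\sum_i cabs (a i) * M i)) => //.
  by apply: sumr_ge0 => i _; rewrite mulr_ge0 ?cabs_ge0.
move=> k c E d d0 h.
have -> : \sum_(j < k) c j * (\sum_i a i * nu i (E j)) = \sum_i a i * \sum_(j < k) c j * nu i (E j).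
  under eq_bigr do rewrite mulr_sumr.
  rewrite exchange_big/=; apply: eq_bigr => i _; rewrite mulr_sumr.
  by apply: eq_bigr => j _; rewrite mulrCA.
rewrite -sumrB; apply: (le_trans (ler_cabs_sum _ _ _)); rewrite mulr_sumr.
apply: ler_sum => i _; rewrite -mulrBr cabsM mulrCA ler_wpM2l ?cabs_ge0//.
by have [ci _ _] := rnu i; exact: (cintegral_approx ci (HM i) af d0 h).
Qed.

Lemma cintegral_image nu (h h' : X -> X) f : continuous h -> continuous h' ->
  cancel h h' -> cancel h' h -> hausdorff_space X -> radon_cmeasure nu ->
  approximable f -> approximable (fun x => f (h' x)) ->
  cintegral (fun A => nu (h @` A)) f = cintegral nu (fun x => f (h' x)).
Proof.
move=> ch ch' hK h'K hX rnu af afh; have [cnu [M HM] _] := rnu.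
have [cim [M' HM'] _] := radon_image ch ch' hK h'K rnu.
apply: (@cintegral_eq _ M' cim HM' _ _ M) => //; first exact: var_le_ge0 HM.
move=> k c E d d0 [bE fE].
apply: (cintegral_approx cnu HM (E := fun i => h @` E i)) => //.
have imE A : h @` A = h' @^-1` A.
  apply/seteqP; split=> [_ [x Ax <-]|x Ax]; first by rewrite /= hK.
  by exists (h' x).
split => [i|x]; first by rewrite imE; exact: borel_preimage.
have := fE (h' x); congr (cabs (_ - _) <= _); apply: eq_bigr => i _.
by rewrite imE !indicE.
Qed.

(** With [K] and [V] from tightness and a Urysohn function [p] between them, [p - \1_A] vanishes
    outside [V \ K], where the variation is small; hence [nu A] is close to the integral of [p],
    which is 0. *)
Lemma radon_uniq nu : hausdorff_space X -> locally_compact [set: X] -> radon_cmeasure nu ->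
  (forall p : X -> R, c0 p -> cintegral nu (fun x => (p x)%:C) = 0) ->
  forall A, borel A -> nu A = 0.
Proof.
move=> hX lX [cnu [M HM] tnu] H A bA.
have M0 := var_le_ge0 HM.
apply/cabs0_eq0/le_anti; rewrite cabs_ge0 andbT.
apply: (@ler_addmul_eps _ _ (1 + 1 + M + M)); first by rewrite !addr_ge0.
move=> e1 e10; rewrite add0r.
(* The bound [e <= 1] turns the error [(1 + e) * e] on [V \ K] into at most [2 * e]. *)
pose e := Num.min e1 1; have e0 : 0 < e by rewrite lt_min e10 ltr01.
have ee1 : e <= e1 by rewrite ge_min lexx.
have e_le1 : e <= 1 by rewrite ge_min lexx orbT.
have [K [V [cK oV KA AV He]]] := tnu _ _ bA e0.
have [p cp [p0 pV pK]] := c0_urysohn R hX lX cK oV (subset_trans KA AV).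
have ap := approximable_c0 cp.
have [k [c [E h]]] := ap _ e0; have [bE fE] := h.
have := cintegral_approx cnu HM ap (ltW e0) h; rewrite H// subr0 => Hs.
pose W := V `\` K; have bW : borel W.
  by apply: borelD; [exact: borel_open|exact: borel_compact].
(* The simple approximation of [p] minus the indicator of [A], as a single family: [None] carries
   [- \1_A]. *)
pose c' (o : option 'I_k) : C := if o is Some i then c i else -1.
pose E' (o : option 'I_k) := if o is Some i then E i else A.
have bE' o : borel (E' o) by case: o.
have sumo (F : set X -> C) : \sum_o c' o * F (E' o) = \sum_(i < k) c i * F (E i) - F A.
  rewrite (bigD1 None)//= mulN1r addrC; congr (_ - _).
  rewrite (reindex_omap Some id)/=; last by case.
  by under eq_bigl => j do rewrite eqxx.
have key x : \sum_o c' o * \1_(E' o) x =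
    ((p x) - \1_A x)%:C - ((p x)%:C - \sum_(i < k) c i * \1_(E i) x).
  by rewrite (sumo (fun B => \1_B x)) indC realcB; ring.
have bW' : cabs (\sum_o c' o * nu (E' o `&` W)) <= (1 + e) * e.
  apply: (simple_bound cnu bW He bE'); first by rewrite addr_ge0// ltW.
  move=> x _; rewrite key; apply: (le_trans (ler_cabsB _ _)); apply: lerD => //.
  rewrite cabs_real; have := p0 x; have := pV x; rewrite !indicE.
  by case: (x \in V); case: (x \in A) => /=; rewrite ler_norml => ? ?; apply/andP; split; lra.
have bWc : cabs (\sum_o c' o * nu (E' o `&` ~` W)) <= e * M.
  have HM' : var_le nu (~` W) M by apply: var_le_sub HM.
  apply: (simple_bound cnu (borelC bW) HM' bE'); first exact: ltW.
  move=> x Wx; rewrite key; suff -> : p x - \1_A x = 0 by rewrite sub0r cabsN.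
  rewrite indicE; have [Ax|Ax] := pselect (A x).
    rewrite mem_set//= pK ?subrr//; apply: contrapT => Kx; apply: Wx; split => //.
    exact: AV.
  rewrite memNset//= subr0; have := pV x; rewrite indicE memNset/=.
    by move=> ?; apply/le_anti; rewrite p0 andbT.
  by move=> Vx; apply: Wx; split => // /KA.
have split_nu : \sum_o c' o * nu (E' o) =
    \sum_o c' o * nu (E' o `&` W) + \sum_o c' o * nu (E' o `&` ~` W).
  rewrite -big_split/=; apply: eq_bigr => o _; rewrite -mulrDr; congr (_ * _).
  by rewrite (cmeas_split cnu (bE' o) bW) setDE.
have -> : nu A = \sum_(i < k) c i * nu (E i) - \sum_o c' o * nu (E' o).
  by rewrite sumo; ring.
apply: (le_trans (ler_cabsB _ _)); rewrite split_nu.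
apply: le_trans (lerD Hs (le_trans (ler_cabsD _ _) (lerD bW' bWc))) _.
nra.
Qed.

End Integral.

(** * The unitary group *)

Section Unitary.
Variables (R : realType) (n : nat).
Local Notation C := R[i].
Local Notation unitary := (@Defs.unitary R n).
Local Notation adjmx := (@Defs.adjmx R n).
Implicit Types A B U V : 'M[C]_n.

Lemma adjmxE A i j : adjmx A i j = ((A j i)^*)%C.
Proof. by rewrite /Defs.adjmx !mxE. Qed.

Lemma adjmxM A B : adjmx (A *m B) = adjmx B *m adjmx A.
Proof. by rewrite /Defs.adjmx map_mxM trmx_mul. Qed.

Lemma adjmxK A : adjmx (adjmx A) = A.
Proof. by apply/matrixP => i j; rewrite !adjmxE conjcK. Qed.

Lemma adjmx1 : adjmx 1%:M = 1%:M.
Proof. by rewrite /Defs.adjmx map_mx1 trmx1. Qed.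

Lemma adjmxB A B : adjmx (A - B) = adjmx A - adjmx B.
Proof. by apply/matrixP => i j; rewrite !mxE rmorphB. Qed.

Lemma unitary1 : unitary 1%:M.
Proof. by rewrite /Defs.unitary adjmx1 mulmx1. Qed.

Lemma unitaryP U : unitary U -> U *m adjmx U = 1%:M /\ adjmx U *m U = 1%:M.
Proof. by move=> uU; split => //; exact: mulmx1C. Qed.

Lemma unitaryM U V : unitary U -> unitary V -> unitary (U *m V).
Proof.
move=> uU uV; rewrite /Defs.unitary adjmxM mulmxA -(mulmxA U V).
by rewrite (unitaryP uV).1 mulmx1 (unitaryP uU).1.
Qed.

Lemma unitary_adj U : unitary U -> unitary (adjmx U).
Proof. by move=> /unitaryP[_ H]; rewrite /Defs.unitary adjmxK. Qed.

Lemma unitary_unitmx U : unitary U -> U \in unitmx.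
Proof. by move=> /unitaryP[H _]; case/mulmx1_unit : H. Qed.

Lemma unitary_invmx U : unitary U -> invmx U = adjmx U.
Proof.
move=> uU; rewrite -[LHS]mul1mx -(unitaryP uU).2 -mulmxA mulmxV ?mulmx1//.
exact: unitary_unitmx.
Qed.

(** The square of the Frobenius norm, which is what the trace formula [frobE] gives; bounds on
    [frob] are therefore bounds on squared distances. *)
Definition frob A : R := \sum_i \sum_j (cabs (A i j)) ^+ 2.

Lemma cabs_sqr (z : C) : ((cabs z) ^+ 2)%:C%C = z * z^*%C.
Proof. by rewrite rmorphXn /= -cabsE sqr_normc. Qed.

Lemma frobE A : (frob A)%:C%C = \tr (A *m adjmx A).
Proof.
rewrite /frob rmorph_sum /mxtrace /=; apply: eq_bigr => i _.
rewrite rmorph_sum mxE /=; apply: eq_bigr => j _.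
by rewrite adjmxE cabs_sqr.
Qed.

Lemma frob_adj A : frob (adjmx A) = frob A.
Proof.
rewrite /frob exchange_big/=; apply: eq_bigr => i _; apply: eq_bigr => j _.
by rewrite adjmxE; congr (_ ^+ 2); apply: (@complexI R); rewrite -!cabsE normcJ.
Qed.

Lemma frob_mulr A U : unitary U -> frob (A *m U) = frob A.
Proof.
move=> uU; apply: (@complexI R); rewrite !frobE adjmxM mulmxA -(mulmxA A).
by rewrite (unitaryP uU).1 mulmx1.
Qed.

Lemma frob_mull A U : unitary U -> frob (U *m A) = frob A.
Proof.
by move=> uU; rewrite -frob_adj adjmxM frob_mulr ?frob_adj//; exact: unitary_adj.
Qed.

Lemma frobC A B : frob (A - B) = frob (B - A).
Proof.
apply: eq_bigr => i _; apply: eq_bigr => j _.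
by rewrite !mxE cabsC.
Qed.

Lemma frob_entry A i j : cabs (A i j) ^+ 2 <= frob A.
Proof.
rewrite /frob (bigD1 i)//= (bigD1 j)//= -addrA lerDl addr_ge0//.
  by apply: sumr_ge0 => k _; rewrite sqr_ge0.
by apply: sumr_ge0 => k _; apply: sumr_ge0 => l _; rewrite sqr_ge0.
Qed.

Lemma frob_le A (d : R) : (forall i j, cabs (A i j) <= d) -> frob A <= n%:R ^+ 2 * d ^+ 2.
Proof.
move=> Ad; apply: (@le_trans _ _ (\sum_(i < n) \sum_(j < n) d ^+ 2)).
  apply: ler_sum => i _; apply: ler_sum => j _.
  by rewrite lerXn2r// ?nnegrE ?cabs_ge0// (le_trans (cabs_ge0 _) (Ad i j)).
by rewrite !sumr_const !card_ord -mulrnA -[leLHS]mulr_natr natrM mulrC -expr2.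
Qed.

Lemma unitary_entry U i j : unitary U -> cabs (U i j) <= 1.
Proof.
move=> uU; rewrite -(@ler_pXn2r _ 2)// ?nnegrE ?cabs_ge0// expr1n.
have : \sum_k cabs (U i k) ^+ 2 = 1.
  apply: (@complexI R); rewrite rmorph_sum rmorph1 /=.
  have := congr1 (fun M : 'M[C]_n => M i i) uU; rewrite !mxE eqxx /= => H.
  rewrite -[RHS]H; by apply: eq_bigr => k _; rewrite adjmxE cabs_sqr.
by rewrite (bigD1 j)//= => <-; rewrite lerDl sumr_ge0// => k _; rewrite sqr_ge0.
Qed.

(** Entries of a unitary matrix have real and imaginary parts in [-1, 1], cut into cells of length
    1/m. Two matrices with the same cells differ by at most 2/m in each entry, hence by at most 4
    n^2 / m^2 in [frob], and [m] is chosen accordingly. One unitary matrix per code is kept. *)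
Lemma unitary_net (d : R) : 0 < d -> exists s : seq 'M[C]_n,
  [/\ forall a, a \in s -> unitary a, (0 < size s)%N &
     forall u, unitary u -> exists2 a, a \in s & frob (u - a) <= d].
Proof.
move=> d0.
pose m := (Num.truncn (4 * n%:R ^+ 2 / d)).+1.
have m0 : 0 < m%:R :> R by rewrite ltr0n.
have md : 4 * n%:R ^+ 2 < m%:R * d by rewrite -ltr_pdivrMr// truncnS_gt.
(* The endpoint 1 falls into cell number [2 * m], whence [2 * m + 1] cells. *)
pose cell (r : R) : 'I_(2 * m).+1 := inord (Num.truncn ((r + 1) * m%:R)).
have cellP r t : `|r| <= 1 -> `|t| <= 1 -> cell r = cell t -> `|r - t| <= m%:R^-1.
  rewrite !ler_norml => /andP[r1 r2] /andP[t1 t2] /(congr1 (@nat_of_ord _)).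
  have pos (x : R) : -1 <= x -> 0 <= (x + 1) * m%:R.
    by move=> x1; rewrite mulr_ge0 ?ler0n//; lra.
  have small (x : R) : -1 <= x -> x <= 1 -> (Num.truncn ((x + 1) * m%:R) < (2 * m).+1)%N.
    move=> x1 x2; rewrite ltnS truncn_le_nat -natr1 natrM.
    by have : (x + 1) * m%:R <= 2 * m%:R; [rewrite ler_pM2r//; lra|lra].
  rewrite !inordK ?small// => E.
  have /andP[A1 A2] := truncn_itv (pos _ r1); have /andP[B1 B2] := truncn_itv (pos _ t1).
  rewrite E in A1 A2; rewrite -natr1 in A2 B2.
  rewrite -(div1r m%:R) -mulNr ler_pdivrMr// ler_pdivlMr// mulrBl.
  by apply/andP; split; lra.
pose code (u : 'M[C]_n) : {ffun 'I_n * 'I_n -> 'I_(2 * m).+1 * 'I_(2 * m).+1} :=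
  [ffun p => (cell (complex.Re (u p.1 p.2)), cell (complex.Im (u p.1 p.2)))].
(* A code that no unitary matrix has is represented by the identity, so that every element of the
   net is unitary. *)
have /choice[rep Hrep] c : exists a, unitary a /\ ((exists2 u, unitary u & code u = c) -> code a = c).
  have [[u uu uc]|nc] := pselect (exists2 u, unitary u & code u = c).
    by exists u.
  by exists 1%:M; split => //; exact: unitary1.
exists [seq rep c | c <- enum {: {ffun 'I_n * 'I_n -> 'I_(2 * m).+1 * 'I_(2 * m).+1}}]; split.
- by move=> a /mapP[c _ ->]; case: (Hrep c).
- by rewrite size_map -cardE; apply/card_gt0P; exists (code 1%:M).
- move=> u uu; exists (rep (code u)); first by apply: map_f; rewrite mem_enum.
  have [ua /(_ (ex_intro2 _ _ u uu erefl)) ca] := Hrep (code u).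
  apply: (@le_trans _ _ (n%:R ^+ 2 * (2 * m%:R^-1) ^+ 2)); last first.
    have m1 : m%:R^-1 <= 1 :> R by rewrite invf_le1// ler1n.
    have H1 : 4 * n%:R ^+ 2 * m%:R^-1 <= d by rewrite ler_pdivrMr// [leRHS]mulrC ltW.
    have -> : n%:R ^+ 2 * (2 * m%:R^-1) ^+ 2 = 4 * n%:R ^+ 2 * m%:R^-1 * m%:R^-1 :> R by ring.
    by apply: le_trans H1; exact: ler_piMr.
  apply: frob_le => i j; rewrite !mxE.
  have := congr1 (fun f : {ffun _ -> _} => f (i, j)) ca; rewrite !ffunE /= => -[cr ci].
  apply: (le_trans (cabs_le_ReIm _)); rewrite cReB cImB mulr2n mulrDl mul1r.
  apply: lerD; apply: cellP => //.
  + by apply: le_trans (ler_Re_cabs _) _; exact: unitary_entry.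
  + by apply: le_trans (ler_Re_cabs _) _; exact: unitary_entry.
  + by apply: le_trans (ler_Im_cabs _) _; exact: unitary_entry.
  + by apply: le_trans (ler_Im_cabs _) _; exact: unitary_entry.
Qed.

End Unitary.

(** * The Haar mean *)

Section Haar.
Variables (R : realType) (n : nat).
Local Notation C := R[i].
Local Notation unitary := (@Defs.unitary R n).
Local Notation adjmx := (@Defs.adjmx R n).
Implicit Types (u v x y a : 'M[C]_n) (h : 'M[C]_n -> R) (s : seq 'M[C]_n).

Definition ravg s h x : R := (size s)%:R^-1 * \sum_(a <- s) h (x *m a).

Definition unitary_seq s := (forall a, a \in s -> unitary a) /\ (0 < size s)%N.

Definition osc_le h (o : R) := forall x y, unitary x -> unitary y -> h x - h y <= o.

Definition modulus h (d e : R) := forall x y, unitary x -> unitary y ->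
  frob (x - y) <= d -> `|h x - h y| <= e.

Definition unif_cont h := forall e : R, 0 < e -> exists2 d, 0 < d & modulus h d e.

Lemma size_gt0R s : unitary_seq s -> 0 < (size s)%:R :> R.
Proof. by move=> [_ s0]; rewrite ltr0n. Qed.

Lemma ravg_lin s h h' (c : R) x :
  ravg s (fun u => h u + c * h' u) x = ravg s h x + c * ravg s h' x.
Proof. by rewrite /ravg big_split/= -mulr_sumr mulrDr mulrCA. Qed.

Lemma ravg_sub s h h' x : ravg s (fun u => h u - h' u) x = ravg s h x - ravg s h' x.
Proof. by rewrite /ravg sumrB mulrBr. Qed.

Lemma ravg_cst s (c : R) x : unitary_seq s -> ravg s (fun=> c) x = c.
Proof.
move=> us; rewrite /ravg big_const_seq count_predT iter_addr_0 -[c *+ _]mulr_natl mulrA.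
by rewrite mulVf ?mul1r// gt_eqF// size_gt0R.
Qed.

Lemma ravg_le s h h' x : unitary_seq s -> (forall a, a \in s -> h (x *m a) <= h' (x *m a)) ->
  ravg s h x <= ravg s h' x.
Proof.
move=> us hh'; rewrite /ravg ler_wpM2l ?invr_ge0 ?ler0n//.
by rewrite big_seq [leRHS]big_seq ler_sum.
Qed.

Lemma ravg_dist s h (c e : R) x : unitary_seq s -> unitary x ->
  (forall y, unitary y -> `|h y - c| <= e) -> `|ravg s h x - c| <= e.
Proof.
move=> us ux H; rewrite -(ravg_cst c x us) -ravg_sub ler_norml.
rewrite -[- e](ravg_cst _ x us) -[X in _ && (_ <= X)](ravg_cst e x us).
apply/andP; split; apply: ravg_le => // a /us.1 ua;
  by have := H _ (unitaryM ux ua); rewrite ler_norml => /andP[].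
Qed.

Lemma modulus_ravg s h d e : unitary_seq s -> modulus h d e -> modulus (ravg s h) d e.
Proof.
move=> us H x y ux uy xy.
have -> : ravg s h x - ravg s h y = ravg s (fun a => h (x *m a) - h (y *m a)) 1%:M.
  by rewrite /ravg -mulrBr -sumrB; congr (_ * _); apply: eq_bigr => a _; rewrite mul1mx.
rewrite -[X in `|X|]subr0; apply: ravg_dist => //; first exact: unitary1.
move=> a ua; rewrite subr0; apply: H; [exact: unitaryM..|].
by rewrite -mulmxBl frob_mulr.
Qed.

(* One term of the average at x is close to the smallest term of the average at y. *)
Lemma osc_contract s h d e o : unitary_seq s ->
  (forall u, unitary u -> exists2 a, a \in s & frob (u - a) <= d) ->
  modulus h d e -> osc_le h o ->
  osc_le (ravg s h) ((1 - (size s)%:R^-1) * o + (size s)%:R^-1 * e).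
Proof.
move=> us net mh oh x y ux uy; have m0 := size_gt0R us.
pose m := size s; pose F (i : 'I_m) := h (x *m nth 0 s i); pose G (i : 'I_m) := h (y *m nth 0 s i).
have uF (i : 'I_m) : unitary (nth 0 s i) by apply: us.1; exact: mem_nth.
have sum_ord z : \sum_(a <- s) h (z *m a) = \sum_(i < m) h (z *m nth 0 s i).
  by rewrite (big_nth 0) big_mkord.
have i0 : 'I_m by exact: (Ordinal us.2).
pose j := [arg min_(j < i0) G j]%O.
have jmin k : G j <= G k by rewrite /j; case: arg_minP => // ? _; apply.
have [a as_ ha] := net (adjmx x *m (y *m nth 0 s j))
  (unitaryM (unitary_adj ux) (unitaryM uy (uF j))).
have im : (index a s < m)%N by rewrite index_mem.
pose i := Ordinal im.
have Fi : F i <= G j + e.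
  have := mh (x *m nth 0 s i) (y *m nth 0 s j) (unitaryM ux (uF i)) (unitaryM uy (uF j)).
  rewrite ler_norml /F /G /= nth_index// => /(_ _)/andP[|_]; last by rewrite lerBlDl.
  rewrite -(frob_mull _ (unitary_adj ux)) mulmxBr mulmxA (unitaryP ux).2 mul1mx.
  by rewrite frobC.
have HF k : F k <= G j + o by rewrite -lerBlDl; apply: oh; apply: unitaryM.
rewrite /ravg !sum_ord -mulrBr -/m.
have -> : (1 - m%:R^-1) * o + m%:R^-1 * e = m%:R^-1 * ((m%:R - 1) * o + e).
  by rewrite mulrDr mulrA mulrBr mulVf ?gt_eqF// mulr1.
rewrite ler_wpM2l ?invr_ge0 ?(ltW m0)//.
have H1 : \sum_(k < m) F k <= G j + e + \sum_(k < m | k != i) (G j + o).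
  by rewrite (bigD1 i)//= lerD// ler_sum.
have H2 : \sum_(k < m) G j <= \sum_(k < m) G k by rewrite ler_sum.
have cardi : \sum_(k < m | k != i) (G j + o) = (m%:R - 1) * (G j + o).
  have : \sum_(k < m) (G j + o) = m%:R * (G j + o) by rewrite sumr_const card_ord mulr_natl.
  by rewrite (bigD1 i)//= => H; rewrite mulrBl mul1r -H; ring.
rewrite cardi in H1; rewrite sumr_const card_ord -[_ *+ m]mulr_natl in H2.
rewrite lerBlDr; apply: (le_trans H1); apply: le_trans (lerD (lexx _) H2).
by rewrite le_eqVlt; apply/orP; left; apply/eqP; ring.
Qed.

(** Products are listed with multiplicity, so an iterated average is again a single average. *)
Definition words s s' := [seq a *m b | a <- s, b <- s'].

Lemma words_unitary s s' : unitary_seq s -> unitary_seq s' -> unitary_seq (words s s').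
Proof.
move=> [us s0] [us' s'0]; split.
  by move=> _ /allpairsP[[a b] /= [/us ua /us' ub ->]]; exact: unitaryM.
by rewrite size_allpairs muln_gt0 s0.
Qed.

Lemma ravg_words s s' h x : ravg (words s s') h x = ravg s (ravg s' h) x.
Proof.
rewrite /ravg /words big_allpairs_dep size_allpairs natrM invfM -mulrA -mulr_sumr; congr (_ * (_ * _)).
by apply: eq_bigr => a _; apply: eq_bigr => b _; rewrite mulmxA.
Qed.

(** One average over a net of [m] points replaces the oscillation [o] by [q * o + (1 - q) * e] with
    [q = 1 - 1/m]. After [r] averages it is at most [q ^+ r * o + e], and [r] depends only on [k],
    so one sequence serves all [h]. *)
Lemma averaging_seq k : exists s, unitary_seq s /\
  forall h o e, 0 <= o -> 0 <= e -> osc_le h o -> modulus h k.+1%:R^-1 e ->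
    osc_le (ravg s h) (o / k.+1%:R + e).
Proof.
have k0 : 0 < k.+1%:R^-1 :> R by rewrite invr_gt0 ltr0n.
have [s [us s0 net]] := @unitary_net R n _ k0; have uss : unitary_seq s by [].
pose q : R := 1 - (size s)%:R^-1.
have m0 := size_gt0R uss.
have q0 : 0 <= q by rewrite subr_ge0 invf_le1// ler1n.
have q1 : q < 1 by rewrite gtrBl invr_gt0.
have [r qr] : exists r, q ^+ r <= k.+1%:R^-1.
  have qn : `|q| < 1 by rewrite ger0_norm.
  have /cvgrPdist_le/(_ _ k0)[r _ Hr] := cvg_expr qn.
  exists r; have := Hr r (leqnn r); rewrite /= sub0r normrN => H.
  by apply: le_trans (ler_norm _) H.
have [W [uW HW]] : exists W, unitary_seq W /\ forall h o e, 0 <= e ->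
    osc_le h o -> modulus h k.+1%:R^-1 e -> osc_le (ravg W h) (q ^+ r * o + e).
  elim: r {qr} => [|r [W [uW HW]]].
    exists [:: 1%:M]; split.
      by split=> // a; rewrite inE => /eqP ->; exact: unitary1.
    move=> h o e e0 oh mh x y ux uy; rewrite expr0 mul1r.
    rewrite /ravg /= !big_seq1 invr1 !mul1r !mulmx1.
    by rewrite (le_trans (oh _ _ ux uy))// lerDl.
  exists (words s W); split; first exact: words_unitary.
  move=> h o e e0 oh mh x y ux uy; rewrite !ravg_words.
  have := osc_contract uss net (modulus_ravg uW mh) (HW _ _ _ e0 oh mh) ux uy.
  move=> /le_trans; apply; rewrite -/q mulrDr mulrA -exprS -addrA lerD2l -mulrDl.
  by rewrite /q subrK mul1r.
exists W; split => // h o e o0 e0 oh mh x y ux uy.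
apply: le_trans (HW _ _ _ e0 oh mh x y ux uy) _.
by rewrite lerD2r mulrC ler_wpM2l.
Qed.

(** * The mean as common limit of right and left averages *)

Definition avg_seq k : seq 'M[C]_n := projT1 (cid (averaging_seq k)).

Lemma avg_seq_unitary k : unitary_seq (avg_seq k).
Proof. by rewrite /avg_seq; case: cid => s []. Qed.

Lemma avg_seq_osc k h o e : 0 <= o -> 0 <= e -> osc_le h o -> modulus h k.+1%:R^-1 e ->
  osc_le (ravg (avg_seq k) h) (o / k.+1%:R + e).
Proof. by have [_ H] := projT2 (cid (averaging_seq k)); exact: H. Qed.

(** Inversion on unitary matrices. Right averages of [inv_fct h] are left averages of [h], so the
    same lemmas serve both sides. *)
Definition inv_fct h u := h (adjmx u).

Lemma osc_inv h o : osc_le h o -> osc_le (inv_fct h) o.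
Proof. by move=> H x y ux uy; apply: H; exact: unitary_adj. Qed.

Lemma modulus_inv h d e : modulus h d e -> modulus (inv_fct h) d e.
Proof.
move=> H x y ux uy xy; apply: H; [exact: unitary_adj..|].
by rewrite -adjmxB frob_adj.
Qed.

(* Right and left averages commute; this forces all of them to be close to one constant. *)
Lemma ravg_inv_dist s s' h e e' x y : unitary_seq s -> unitary_seq s' ->
  osc_le (ravg s h) e -> osc_le (ravg s' (inv_fct h)) e' -> unitary x -> unitary y ->
  `|ravg s h x - ravg s' (inv_fct h) y| <= e + e'.
Proof.
move=> us us' H H' ux uy.
pose D := (size s)%:R^-1 * (size s')%:R^-1 * \sum_(a <- s) \sum_(b <- s') h (adjmx b *m a).
have D1 : D = ravg s' (fun b => ravg s h (adjmx b)) 1%:M.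
  rewrite /D /ravg exchange_big/= -mulr_sumr mulrA [_^-1 * _^-1]mulrC; congr (_ * _).
  by apply: eq_bigr => b _; rewrite mul1mx.
have D2 : D = ravg s (fun a => ravg s' (inv_fct h) (adjmx a)) 1%:M.
  rewrite /D /ravg -mulr_sumr mulrA; congr (_ * _).
  apply: eq_bigr => a _; apply: eq_bigr => b _.
  by rewrite /inv_fct mul1mx adjmxM adjmxK.
have h1 : `|D - ravg s h x| <= e.
  rewrite D1; apply: ravg_dist => //; first exact: unitary1.
  move=> b ub; have ub' := unitary_adj ub.
  by rewrite ler_norml lerNl opprB !H.
have h2 : `|D - ravg s' (inv_fct h) y| <= e'.
  rewrite D2; apply: ravg_dist => //; first exact: unitary1.
  move=> b ub; have ub' := unitary_adj ub.
  by rewrite ler_norml lerNl opprB !H'.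
rewrite distrC in h1.
have -> : ravg s h x - ravg s' (inv_fct h) y = (ravg s h x - D) + (D - ravg s' (inv_fct h) y) by ring.
by rewrite (le_trans (ler_normD _ _))// lerD.
Qed.

Definition hmean_spec h (c : R) := forall k e, osc_le (ravg (avg_seq k) h) e ->
  osc_le (ravg (avg_seq k) (inv_fct h)) e -> forall x, unitary x ->
  `|ravg (avg_seq k) h x - c| <= 3 * e /\ `|ravg (avg_seq k) (inv_fct h) x - c| <= 3 * e.

(* the mean of h against the Haar probability of the unitary group, when h is a
   haar_fct as defined below *)
Definition hmean h : R := xget 0 (hmean_spec h).

(** By [ravg_inv_dist] a right average minus its oscillation never exceeds a left average plus its
    own, and the supremum of the former lies in between. The factor 3 is [2 * e] for passing from
    one side to the other plus [e] for the distance to the supremum. *)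
Lemma hmeanP h : hmean_spec h (hmean h).
Proof.
(* Without such [k] and [e] the specification is vacuous; with them the supremum below is finite. *)
have [[k0 [e0 [osck osck']]]|none] := pselect (exists k e,
    osc_le (ravg (avg_seq k) h) e /\ osc_le (ravg (avg_seq k) (inv_fct h)) e); last first.
  by move=> k e o1 o2; exfalso; apply: none; exists k, e.
pose S := [set r | exists k e, osc_le (ravg (avg_seq k) h) e /\ r = ravg (avg_seq k) h 1%:M - e].
have u1 := @unitary1 R n.
have key k l e e' x y : osc_le (ravg (avg_seq k) h) e ->
    osc_le (ravg (avg_seq l) (inv_fct h)) e' -> unitary x -> unitary y ->
    `|ravg (avg_seq k) h x - ravg (avg_seq l) (inv_fct h) y| <= e + e'.
  by move=> H H' ux uy; apply: ravg_inv_dist => //; exact: avg_seq_unitary.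
have hS : has_sup S.
  split; first by exists (ravg (avg_seq k0) h 1%:M - e0), k0, e0.
  exists (ravg (avg_seq k0) (inv_fct h) 1%:M + e0) => _ [k [e [ok ->]]].
  have := key k k0 e e0 1%:M 1%:M ok osck' u1 u1; rewrite ler_norml => /andP[_]; lra.
apply: (xgetPex 0); exists (sup S) => k e ok ok' x ux.
have L : ravg (avg_seq k) h 1%:M - e <= sup S.
  by apply: sup_ubound; [exact: hS.2|exists k, e].
have U : sup S <= ravg (avg_seq k) (inv_fct h) 1%:M + e.
  apply: ge_sup; first exact: hS.1.
  move=> _ [l [e' [ol ->]]].
  have := key l k e' e 1%:M 1%:M ol ok' u1 u1; rewrite ler_norml => /andP[_]; lra.
have := key k k e e 1%:M x ok ok' u1 ux; rewrite ler_norml => /andP[a1 a2].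
have := key k k e e x 1%:M ok ok' ux u1; rewrite ler_norml => /andP[b1 b2].
have := ok x 1%:M ux u1; have := ok 1%:M x u1 ux.
have := ok' x 1%:M ux u1; have := ok' 1%:M x u1 ux.
by rewrite !ler_norml; split; apply/andP; split; lra.
Qed.

(** The rate involves [h] only through [o] and [e]; applied to a family indexed by the points of
    [X], it gives convergence uniform on [X]. *)
Lemma hmean_dist h o e k x : 0 <= o -> 0 <= e -> osc_le h o -> modulus h k.+1%:R^-1 e -> unitary x ->
  `|ravg (avg_seq k) h x - hmean h| <= 3 * (o / k.+1%:R + e) /\
  `|ravg (avg_seq k) (inv_fct h) x - hmean h| <= 3 * (o / k.+1%:R + e).
Proof.
move=> o0 e0 oh mh ux; apply: hmeanP => //; first exact: avg_seq_osc.
by apply: avg_seq_osc => //; [exact: osc_inv|exact: modulus_inv].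
Qed.

(** * Linearity and invariance of the mean *)

Definition haar_fct h := (exists o, osc_le h o) /\ unif_cont h.

Lemma modulus_le h d d' e : d' <= d -> modulus h d e -> modulus h d' e.
Proof. by move=> dd H x y ux uy /le_trans xy; apply: H => //; exact: xy. Qed.

Lemma avg_rate (o d e : R) : 0 < d -> 0 < e ->
  exists K, forall k, (K <= k)%N -> k.+1%:R^-1 <= d /\ o / k.+1%:R <= e.
Proof.
move=> d0 e0; pose M := Num.max d^-1 (`|o| / e).
exists (Num.truncn M).+1 => k Kk.
have kM : M <= k.+1%:R.
  by rewrite (le_trans (ltW (truncnS_gt M)))// ler_nat (leq_trans Kk).
have k0 : 0 < k.+1%:R :> R by rewrite ltr0n.
split.
  by rewrite -[d]invrK lef_pV2 ?posrE ?invr_gt0// (le_trans _ kM)// le_max lexx.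
rewrite ler_pdivrMr// (le_trans (ler_norm _))// mulrC -ler_pdivrMr//.
by rewrite (le_trans _ kM)// le_max lexx orbT.
Qed.

Lemma hmean_cvg h (e : R) : haar_fct h -> 0 < e -> exists K, forall k, (K <= k)%N ->
  forall x, unitary x -> `|ravg (avg_seq k) h x - hmean h| <= e /\
    `|ravg (avg_seq k) (inv_fct h) x - hmean h| <= e.
Proof.
move=> [] [w oh] uc e0; have e6 : 0 < e / 6 by rewrite divr_gt0.
have [d d0 md] := uc _ e6.
have o0 : 0 <= w.
  by rewrite -(subrr (h 1%:M)); apply: oh; exact: unitary1.
have [K HK] := avg_rate w d0 e6.
exists K => k /HK[kd ko] x ux.
have [H1 H2] := hmean_dist o0 (ltW e6) oh (modulus_le kd md) ux.
have b : 3 * (w / k.+1%:R + e / 6) <= e by move: (w / _) ko => t; lra.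
by split; [exact: le_trans H1 b|exact: le_trans H2 b].
Qed.

(** For each [k] the average on either side may be used. A left translate is handled by right
    averages, where it only moves the base point, and a right translate by left averages. *)
Lemma hmean_eq h (c : R) : haar_fct h ->
  (forall e : R, 0 < e -> exists K, forall k, (K <= k)%N ->
    `|ravg (avg_seq k) h 1%:M - c| <= e \/ `|ravg (avg_seq k) (inv_fct h) 1%:M - c| <= e) ->
  hmean h = c.
Proof.
move=> hh H; apply/eqP; rewrite -subr_eq0 -normr_le0; apply/ler_addgt0Pr => e e0.
have e2 : 0 < e / 2 by rewrite divr_gt0.
have [K HK] := H _ e2; have [K' HK'] := hmean_cvg hh e2.
have [H1 H2] := HK' _ (leq_maxr K K') _ (@unitary1 R n).
rewrite add0r (splitr e); case: (HK _ (leq_maxl K K')) => h1.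
  have -> : hmean h - c = (ravg (avg_seq (maxn K K')) h 1%:M - c) -
    (ravg (avg_seq (maxn K K')) h 1%:M - hmean h) by ring.
  by rewrite (le_trans (ler_normB _ _))// lerD.
have -> : hmean h - c = (ravg (avg_seq (maxn K K')) (inv_fct h) 1%:M - c) -
    (ravg (avg_seq (maxn K K')) (inv_fct h) 1%:M - hmean h) by ring.
by rewrite (le_trans (ler_normB _ _))// lerD.
Qed.

Lemma haar_fct_lin h h' (c : R) : haar_fct h -> haar_fct h' -> haar_fct (fun u => h u + c * h' u).
Proof.
move=> [] [w oh] uh [] [w' oh'] uh'; split.
  exists (w + `|c| * w') => x y ux uy.
  have -> : h x + c * h' x - (h y + c * h' y) = (h x - h y) + c * (h' x - h' y) by ring.
  apply: lerD; first exact: oh.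
  apply: (le_trans (ler_norm _)); rewrite normrM ler_wpM2l// ler_norml lerNl opprB.
  by rewrite !oh'.
move=> e e0; pose b := `|c| + 1; have b0 : 0 < b by rewrite ltr_wpDl.
have [d d0 md] := uh (e / 2) ltac:(by rewrite divr_gt0).
have [d' d'0 md'] := uh' (e / 2 / b) ltac:(by rewrite !divr_gt0).
exists (Num.min d d'); first by rewrite lt_min d0.
move=> x y ux uy; rewrite le_min => /andP[xy xy'].
have -> : h x + c * h' x - (h y + c * h' y) = (h x - h y) + c * (h' x - h' y) by ring.
rewrite (splitr e) (le_trans (ler_normD _ _))// lerD//; first exact: md.
rewrite normrM; apply: (@le_trans _ _ (b * (e / 2 / b))).
  by apply: ler_pM => //; [rewrite lerDl|exact: md'].
by rewrite mulrCA divff ?mulr1// gt_eqF.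
Qed.

Lemma hmean_lin h h' (c : R) : haar_fct h -> haar_fct h' ->
  hmean (fun u => h u + c * h' u) = hmean h + c * hmean h'.
Proof.
move=> hh hh'; apply: hmean_eq; first exact: haar_fct_lin.
move=> e e0; pose b := `|c| + 1; have b0 : 0 < b by rewrite ltr_wpDl.
have [K HK] := hmean_cvg hh (e := e / 2) ltac:(by rewrite divr_gt0).
have [K' HK'] := hmean_cvg hh' (e := e / 2 / b) ltac:(by rewrite !divr_gt0).
exists (maxn K K') => k; rewrite geq_max => /andP[/HK Hk /HK' Hk']; left.
have [H1 _] := Hk _ (@unitary1 R n); have [H2 _] := Hk' _ (@unitary1 R n).
rewrite ravg_lin; set u := ravg _ h _ in H1 *; set v := ravg _ h' _ in H2 *.
have -> : u + c * v - (hmean h + c * hmean h') = (u - hmean h) + c * (v - hmean h') by ring.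
rewrite (splitr e) (le_trans (ler_normD _ _))// lerD// normrM.
apply: (@le_trans _ _ (b * (e / 2 / b))); first by apply: ler_pM => //; rewrite lerDl.
by rewrite mulrCA divff ?mulr1// gt_eqF.
Qed.

Lemma haar_fct_left h v : unitary v -> haar_fct h -> haar_fct (fun u => h (v *m u)).
Proof.
move=> uv [] [w oh] uh; split.
  by exists w => x y ux uy; apply: oh; exact: unitaryM.
move=> e /uh[d d0 md]; exists d => // x y ux uy xy; apply: md; [exact: unitaryM..|].
by rewrite -mulmxBr frob_mull.
Qed.

Lemma haar_fct_right h v : unitary v -> haar_fct h -> haar_fct (fun u => h (u *m v)).
Proof.
move=> uv [] [w oh] uh; split.
  by exists w => x y ux uy; apply: oh; exact: unitaryM.
move=> e /uh[d d0 md]; exists d => // x y ux uy xy; apply: md; [exact: unitaryM..|].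
by rewrite -mulmxBl frob_mulr.
Qed.

Lemma hmean_left h v : unitary v -> haar_fct h -> hmean (fun u => h (v *m u)) = hmean h.
Proof.
move=> uv hh; apply: hmean_eq; first exact: haar_fct_left.
move=> e e0; have [K HK] := hmean_cvg hh e0; exists K => k /HK Hk; left.
have [H _] := Hk _ uv; congr (_ <= _) : H; congr `| _ - _ |.
by rewrite /ravg; congr (_ * _); apply: eq_bigr => a _; rewrite mul1mx.
Qed.

Lemma hmean_right h v : unitary v -> haar_fct h -> hmean (fun u => h (u *m v)) = hmean h.
Proof.
move=> uv hh; apply: hmean_eq; first exact: haar_fct_right.
move=> e e0; have [K HK] := hmean_cvg hh e0; exists K => k /HK Hk; right.
have [_ H] := Hk _ (unitary_adj uv); congr (_ <= _) : H; congr `| _ - _ |.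
rewrite /ravg; congr (_ * _); apply: eq_bigr => a _.
by rewrite /inv_fct mul1mx adjmxM adjmxK.
Qed.

Lemma haar_fct_cst (c : R) : haar_fct (fun=> c).
Proof.
split; first by exists 0 => x y _ _; rewrite subrr.
by move=> e e0; exists 1 => // x y _ _ _; rewrite subrr normr0 ltW.
Qed.

Lemma hmean_cst h (c : R) : (forall u, unitary u -> h u = c) -> hmean h = c.
Proof.
move=> hc.
have hh : haar_fct h.
  split; first by exists 0 => x y ux uy; rewrite !hc// subrr.
  by move=> e e0; exists 1 => // x y ux uy _; rewrite !hc// subrr normr0 ltW.
apply: hmean_eq => // e e0; exists 0%N => k _; left.
have us := avg_seq_unitary k.
apply: ravg_dist => //; first exact: unitary1.
by move=> y uy; rewrite hc// subrr normr0 ltW.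
Qed.

End Haar.

(** * Matrix-valued functions *)

Section MatrixTopology.
Variables (R : realType) (n : nat) (X : topologicalType).
Local Notation C := R[i].
Local Notation "x %:C" := (real_complex R x) : ring_scope.
Local Notation unitary := (@Defs.unitary R n).
Local Notation adjmx := (@Defs.adjmx R n).

(** The norm of a matrix over [R[i]] lies in [R[i]]. Its balls are the entrywise balls of the
    product topology, from which the strict bound is read off. *)
Lemma mxnorm_ltP (A : 'M[C]_n) (e : R) : 0 < e ->
  (`|A| < e%:C) <-> forall i j, cabs (A i j) < e.
Proof.
move=> e0.
have E : (@ball _ 'M[C]_n) 0 e%:C (- A) = ball_ (fun x : 'M[C]_n => `|x|) 0 e%:C (- A).
  by rewrite mx_norm_ball.
rewrite /ball_ /= sub0r opprK in E; rewrite -E; split.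
  by move=> [_ H] i j; have := H i j; rewrite /ball /= !mxE sub0r opprK ltc_cabs.
move=> H; split; first by rewrite ltcR.
by move=> i j; rewrite /ball /= !mxE sub0r opprK ltc_cabs.
Qed.

Lemma mxnorm_leP (A : 'M[C]_n) (d : R) : 0 <= d ->
  (`|A| <= d%:C) <-> forall i j, cabs (A i j) <= d.
Proof.
move=> d0; split=> [H i j|H].
  apply/ler_addgt0Pr => e e0; apply/ltW.
  have de : 0 < d + e by rewrite ltr_wpDl.
  by apply: (mxnorm_ltP A de).1; apply: le_lt_trans H _; rewrite ltcR ltrDl.
have R0 : 0 <= `|A| by [].
have ImA : complex.Im `|A| = 0 by exact: ger0_Im.
rewrite lecE /= ImA eqxx /=; apply/ler_addgt0Pr => e e0; apply/ltW.
have de : 0 < d + e by rewrite ltr_wpDl.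
have : `|A| < (d + e)%:C.
  by apply/mxnorm_ltP => // i j; apply: le_lt_trans (H i j) _; rewrite ltrDl.
by rewrite ltcE => /andP[].
Qed.

Lemma nbhs_mxP (U : 'M[C]_n) (W : set 'M[C]_n) :
  nbhs U W <-> exists2 e : R, 0 < e & forall V : 'M[C]_n, (forall i j, cabs (U i j - V i j) < e) -> W V.
Proof.
split.
  move=> /nbhs_ballP[e /= /gt0_complexE[e0 ee] UW].
  exists (complex.Re e) => // V UV; apply: UW; split; first by rewrite ee ltcR.
  by move=> i j; rewrite /ball /= ee ltc_cabs.
move=> [e e0 H]; apply/nbhs_ballP; exists e%:C; first by rewrite /= ltcR.
move=> V [_ UV]; apply: H => i j; have := UV i j.
by rewrite /ball /= ltc_cabs.
Qed.

Definition c0m (f : X -> 'M[C]_n) := forall j k, c0C (fun x => f x j k).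

Lemma continuous_mxP (f : X -> 'M[C]_n) : continuous f <->
  forall j k, continuous (fun x => complex.Re (f x j k)) /\ continuous (fun x => complex.Im (f x j k)).
Proof.
split=> [cf j k|H x].
  have near_f x (e : R) : 0 < e -> \forall y \near x, cabs (f x j k - f y j k) < e.
    move=> e0; have : nbhs (f x) [set M | cabs (f x j k - M j k) < e].
      by apply/nbhs_mxP; exists e => // V HV; exact: HV.
    exact: cf.
  split=> x; apply/cvgrPdist_lt => e e0; apply: filterS (near_f x _ e0) => y.
    by apply: le_lt_trans; rewrite -cReB ler_Re_cabs.
  by apply: le_lt_trans; rewrite -cImB ler_Im_cabs.
move=> W /nbhs_mxP[e e0 HW]; rewrite /nbhs /=.
have e2 : 0 < e / 2 by rewrite divr_gt0.
have near_jk (p : 'I_n * 'I_n) : \forall y \near x, cabs (f x p.1 p.2 - f y p.1 p.2) < e.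
  have [cr ci] := H p.1 p.2.
  have /cvgrPdist_lt/(_ _ e2) nr := cr x; have /cvgrPdist_lt/(_ _ e2) ni := ci x.
  apply: filterS2 nr ni => y hr hi; apply: (le_lt_trans (cabs_le_ReIm _)).
  by rewrite (splitr e) cReB cImB ltrD.
apply: filterS (filter_forall _ near_jk) => y Hy; apply: HW => i j.
exact: (Hy (i, j)).
Qed.

Lemma vanishing_mxP (f : X -> 'M[C]_n) : Defs.vanishing_at_infinity f <->
  forall e : R, 0 < e -> exists2 K, compact K & forall x, ~ K x -> forall i j, cabs (f x i j) < e.
Proof.
split=> H e.
  move=> e0; have [|K [cK KH]] := H e%:C; first by rewrite ltcR.
  by exists K => // x /KH; move/mxnorm_ltP => /(_ e0).
move=> /gt0_complexE[e0 ee]; have [K cK KH] := H _ e0.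
exists K; split => // x /KH Hx; rewrite ee; exact/mxnorm_ltP.
Qed.

Lemma c0m_Cstar (act : 'M[C]_n -> X -> X) (f : X -> 'M[C]_n) : Defs.Cstar act f <->
  c0m f /\ forall U x, unitary U -> f (act U x) = Defs.mxconj U (f x).
Proof.
split.
  move=> [/continuous_mxP cf /vanishing_mxP vf ef]; split => // j k.
  have [cr ci] := cf j k; split; split => // e /vf[K cK KH]; exists K => // x /KH/(_ j k).
    exact: le_lt_trans (ler_Re_cabs _).
  exact: le_lt_trans (ler_Im_cabs _).
move=> [cf ef]; split => //.
  by apply/continuous_mxP => j k; have [[? _] [? _]] := cf j k.
apply/vanishing_mxP => e e0; have e2 : 0 < e / 2 by rewrite divr_gt0.
have /choice[K HK] (p : 'I_n * 'I_n) : exists K, compact K /\ forall x, ~ K x -> cabs (f x p.1 p.2) < e.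
  have [[_ vr] [_ vi]] := cf p.1 p.2; have [K cK KH] := vr _ e2; have [L cL LH] := vi _ e2.
  exists (K `|` L); split; first exact: compactU.
  move=> x KL; have /KH h1 : ~ K x by move=> ?; apply: KL; left.
  have /LH h2 : ~ L x by move=> ?; apply: KL; right.
  by apply: (le_lt_trans (cabs_le_ReIm _)); rewrite (splitr e) ltrD.
exists (\big[setU/set0]_p K p); first by apply: bigsetU_compact => p _; case: (HK p).
move=> x Kx i j; apply: (HK (i, j)).2 => Kij; apply: Kx.
by rewrite -bigcup_seq; exists (i, j) => //=; rewrite mem_index_enum.
Qed.

Lemma c0C_lin (f g : X -> C) (c : C) : c0C f -> c0C g -> c0C (fun x => f x + c * g x).
Proof.
move=> [fr fi] [gr gi]; split.
  rewrite (_ : (fun x => _) = fun x => complex.Re (f x) +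
    (complex.Re c * complex.Re (g x) - complex.Im c * complex.Im (g x))).
    by apply: c0_add => //; apply: c0_sub; exact: c0_scale.
  by apply/funext => x; rewrite cReD cReM.
rewrite (_ : (fun x => _) = fun x => complex.Im (f x) +
    (complex.Re c * complex.Im (g x) + complex.Im c * complex.Re (g x))).
  by apply: c0_add => //; apply: c0_add; exact: c0_scale.
by apply/funext => x; rewrite cImD cImM.
Qed.

Lemma c0C_0 : c0C (fun _ : X => 0 : C).
Proof. by split; exact: c0_0. Qed.

Lemma c0C_sum (I : Type) (s : seq I) (c : I -> C) (f : I -> X -> C) :
  (forall i, c0C (f i)) -> c0C (fun x => \sum_(i <- s) c i * f i x).
Proof.
move=> cf; elim: s => [|i s IH].
  rewrite (_ : (fun x => _) = fun=> 0); first exact: c0C_0.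
  by apply/funext => x; rewrite big_nil.
rewrite (_ : (fun x => _) = (fun x => \sum_(i <- s) c i * f i x + c i * f i x)).
  exact: c0C_lin.
by apply/funext => x; rewrite big_cons addrC.
Qed.

Lemma c0_unif_limit (f : X -> R) :
  (forall e : R, 0 < e -> exists2 g, c0 g & forall x, `|f x - g x| <= e) -> c0 f.
Proof.
move=> H; split.
  move=> x; apply/cvgrPdist_lt => e e0; have e4 : 0 < e / 4 by rewrite divr_gt0.
  have [g [cg _] fg] := H _ e4; have /cvgrPdist_lt/(_ _ e4) := cg x.
  apply: filterS => y gxy.
  have -> : f x - f y = (f x - g x) + (g x - g y) + (g y - f y) by ring.
  have h1 := fg x; have h2 := fg y; rewrite distrC in h2.
  apply: (le_lt_trans (ler_normD _ _)); have := ler_normD (f x - g x) (g x - g y).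
  lra.
move=> e e0; have e2 : 0 < e / 2 by rewrite divr_gt0.
have [g [_ vg] fg] := H _ e2; have [K cK KH] := vg _ e2.
exists K => // x /KH gx; have -> : f x = (f x - g x) + g x by ring.
by apply: (le_lt_trans (ler_normD _ _)); have := fg x; lra.
Qed.

Lemma c0C_unif_limit (f : X -> C) :
  (forall e : R, 0 < e -> exists2 g, c0C g & forall x, cabs (f x - g x) <= e) -> c0C f.
Proof.
move=> H; split; apply: c0_unif_limit => e /H[g [gr gi] fg].
  by exists (fun x => complex.Re (g x)) => // x; rewrite -cReB (le_trans (ler_Re_cabs _)).
by exists (fun x => complex.Im (g x)) => // x; rewrite -cImB (le_trans (ler_Im_cabs _)).
Qed.

Lemma c0C_bounded (f : X -> C) : c0C f -> exists2 s : R, 0 <= s & forall x, cabs (f x) <= s.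
Proof.
move=> [/c0_bounded[s s0 fs] /c0_bounded[t t0 ft]]; exists (s + t); first exact: addr_ge0.
by move=> x; rewrite (le_trans (cabs_le_ReIm _))// lerD.
Qed.

Lemma c0m_bounded (f : X -> 'M[C]_n) : c0m f ->
  exists2 s : R, 0 <= s & forall x j k, cabs (f x j k) <= s.
Proof.
move=> cf; have /choice[s Hs] (p : 'I_n * 'I_n) : exists s : R, 0 <= s /\ forall x, cabs (f x p.1 p.2) <= s.
  by have [s] := c0C_bounded (cf p.1 p.2); exists s.
exists (\sum_p s p); first by apply: sumr_ge0 => p _; case: (Hs p).
move=> x j k; rewrite (bigD1 (j, k))//= (le_trans ((Hs (j, k)).2 x))// lerDl sumr_ge0// => p _.
by case: (Hs p).
Qed.

Lemma mulmx3_entry (A M B : 'M[C]_n) j k :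
  (A *m M *m B) j k = \sum_a \sum_b A j a * B b k * M a b.
Proof.
rewrite mxE exchange_big/=; apply: eq_bigr => b _; rewrite mxE mulr_suml.
by apply: eq_bigr => a _; rewrite mulrAC.
Qed.

Lemma mulmx3_bound (A M B : 'M[C]_n) (a s b : R) : 0 <= a -> 0 <= s -> 0 <= b ->
  (forall j k, cabs (A j k) <= a) -> (forall j k, cabs (M j k) <= s) ->
  (forall j k, cabs (B j k) <= b) -> forall j k, cabs ((A *m M *m B) j k) <= n%:R ^+ 2 * (a * b * s).
Proof.
move=> a0 s0 b0 HA HM HB j k; rewrite mulmx3_entry.
apply: (@le_trans _ _ (\sum_(i < n) \sum_(l < n) (a * b * s))); last first.
  by rewrite !sumr_const !card_ord -mulrnA -[leLHS]mulr_natr natrM mulrC -expr2.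
apply: (le_trans (ler_cabs_sum _ _ _)); apply: ler_sum => i _.
apply: (le_trans (ler_cabs_sum _ _ _)); apply: ler_sum => l _.
by rewrite !cabsM !ler_pM ?mulr_ge0 ?cabs_ge0.
Qed.

Lemma unitary_sandwich (U V M : 'M[C]_n) (s : R) : unitary U -> unitary V -> 0 <= s ->
  (forall j k, cabs (M j k) <= s) -> forall j k, cabs ((U *m M *m V) j k) <= n%:R ^+ 2 * s.
Proof.
move=> uU uV s0 HM j k; rewrite -[X in _ * X]mul1r -[X in X * s](mulr1 1).
apply: mulmx3_bound => //; by move=> *; exact: unitary_entry.
Qed.

End MatrixTopology.

(** * Averaging over the action *)

Section ComplexMean.
Variables (R : realType) (n : nat).
Local Notation C := R[i].
Local Notation unitary := (@Defs.unitary R n).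
Local Notation adjmx := (@Defs.adjmx R n).
Local Notation Re := (@complex.Re R).
Local Notation Im := (@complex.Im R).
Implicit Types (u v : 'M[C]_n) (h : 'M[C]_n -> C).

Definition haarC h := haar_fct (fun u => Re (h u)) /\ haar_fct (fun u => Im (h u)).

Definition cmean h : C := Complex (hmean (fun u => Re (h u))) (hmean (fun u => Im (h u))).

Definition cavg k h : C := real_complex R (size (avg_seq R n k))%:R^-1 * \sum_(a <- avg_seq R n k) h a.

Lemma cavg_Re k h : Re (cavg k h) = ravg (avg_seq R n k) (fun u => Re (h u)) 1%:M.
Proof.
rewrite /cavg cReM /= mul0r subr0 Re_sum /ravg.
by congr (_ * _); apply: eq_bigr => a _; rewrite mul1mx.
Qed.

Lemma cavg_Im k h : Im (cavg k h) = ravg (avg_seq R n k) (fun u => Im (h u)) 1%:M.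
Proof.
rewrite /cavg cImM /= mul0r addr0 Im_sum /ravg.
by congr (_ * _); apply: eq_bigr => a _; rewrite mul1mx.
Qed.

Lemma osc_Re h (o : R) : (forall u v, unitary u -> unitary v -> cabs (h u - h v) <= o) ->
  osc_le (fun u => Re (h u)) o.
Proof.
move=> oh u v uu uv; rewrite -cReB; apply: le_trans (oh _ _ uu uv).
exact: le_trans (ler_norm _) (ler_Re_cabs _).
Qed.

Lemma osc_Im h (o : R) : (forall u v, unitary u -> unitary v -> cabs (h u - h v) <= o) ->
  osc_le (fun u => Im (h u)) o.
Proof.
move=> oh u v uu uv; rewrite -cImB; apply: le_trans (oh _ _ uu uv).
exact: le_trans (ler_norm _) (ler_Im_cabs _).
Qed.

Lemma modulus_Re h (d e : R) : (forall u v, unitary u -> unitary v ->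
    frob (u - v) <= d -> cabs (h u - h v) <= e) -> modulus (fun u => Re (h u)) d e.
Proof.
by move=> H u v uu uv uvd; rewrite -cReB; apply: le_trans (ler_Re_cabs _) (H _ _ uu uv uvd).
Qed.

Lemma modulus_Im h (d e : R) : (forall u v, unitary u -> unitary v ->
    frob (u - v) <= d -> cabs (h u - h v) <= e) -> modulus (fun u => Im (h u)) d e.
Proof.
by move=> H u v uu uv uvd; rewrite -cImB; apply: le_trans (ler_Im_cabs _) (H _ _ uu uv uvd).
Qed.

Lemma cmean_dist h (o e : R) k : 0 <= o -> 0 <= e ->
  (forall u v, unitary u -> unitary v -> cabs (h u - h v) <= o) ->
  (forall u v, unitary u -> unitary v -> frob (u - v) <= k.+1%:R^-1 -> cabs (h u - h v) <= e) ->
  cabs (cavg k h - cmean h) <= 6 * (o / k.+1%:R + e).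
Proof.
move=> o0 e0 oh mh; apply: (le_trans (cabs_le_ReIm _)).
rewrite cReB cImB cavg_Re cavg_Im /=.
have [H1 _] := hmean_dist o0 e0 (osc_Re oh) (modulus_Re mh) (@unitary1 R n).
have [H2 _] := hmean_dist o0 e0 (osc_Im oh) (modulus_Im mh) (@unitary1 R n).
by apply: (le_trans (lerD H1 H2)); move: (o / _) => t; lra.
Qed.

Lemma haarC_intro h (o : R) : (forall u v, unitary u -> unitary v -> cabs (h u - h v) <= o) ->
  (forall e : R, 0 < e -> exists2 d, 0 < d &
    forall u v, unitary u -> unitary v -> frob (u - v) <= d -> cabs (h u - h v) <= e) ->
  haarC h.
Proof.
move=> oh mh; split; split.
- by exists o; exact: osc_Re.
- by move=> e /mh[d d0 H]; exists d => //; exact: modulus_Re.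
- by exists o; exact: osc_Im.
- by move=> e /mh[d d0 H]; exists d => //; exact: modulus_Im.
Qed.

Lemma cmean_lin h h' (c : C) : haarC h -> haarC h' ->
  haarC (fun u => h u + c * h' u) /\ cmean (fun u => h u + c * h' u) = cmean h + c * cmean h'.
Proof.
move=> [hr hi] [h'r h'i].
have ReE : (fun u => Re (h u + c * h' u)) =
    (fun u => (Re (h u) + Re c * Re (h' u)) + (- Im c) * Im (h' u)).
  by apply/funext => u; rewrite cReD cReM mulNr addrA.
have ImE : (fun u => Im (h u + c * h' u)) =
    (fun u => (Im (h u) + Re c * Im (h' u)) + Im c * Re (h' u)).
  by apply/funext => u; rewrite cImD cImM addrA.
have H1 := haar_fct_lin (Re c) hr h'r; have H2 := haar_fct_lin (Re c) hi h'i.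
split; first by rewrite /haarC ReE ImE; split; exact: haar_fct_lin.
rewrite /cmean ReE ImE !hmean_lin//; apply: complexP => /=.
  by rewrite cReD cReM /= mulNr addrA.
by rewrite cImD cImM /= addrA.
Qed.

Lemma cmean_cst h (c : C) : (forall u, unitary u -> h u = c) -> cmean h = c.
Proof.
move=> hc; apply: complexP => /=; apply: hmean_cst => u uu; by rewrite hc.
Qed.

Lemma haarC_cst (c : C) : haarC (fun=> c).
Proof. by split; exact: haar_fct_cst. Qed.

Lemma cmean_sum (I : Type) (s : seq I) (c : I -> C) (h : I -> 'M[C]_n -> C) :
  (forall i, haarC (h i)) -> haarC (fun u => \sum_(i <- s) c i * h i u) /\
  cmean (fun u => \sum_(i <- s) c i * h i u) = \sum_(i <- s) c i * cmean (h i).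
Proof.
move=> hh; elim: s => [|i s [IH1 IH2]].
  rewrite (_ : (fun u => _) = fun=> 0); last by apply/funext => u; rewrite big_nil.
  by split; [exact: haarC_cst|rewrite big_nil (cmean_cst (c := 0))].
rewrite (_ : (fun u => _) = (fun u => \sum_(i <- s) c i * h i u + c i * h i u)); last first.
  by apply/funext => u; rewrite big_cons addrC.
have [H1 H2] := cmean_lin (c i) IH1 (hh i); split => //.
by rewrite H2 IH2 big_cons addrC.
Qed.

Lemma cmean_left h v : unitary v -> haarC h -> cmean (fun u => h (v *m u)) = cmean h.
Proof. by move=> uv [hr hi]; rewrite /cmean (hmean_left uv hr) (hmean_left uv hi). Qed.

Lemma cmean_right h v : unitary v -> haarC h -> cmean (fun u => h (u *m v)) = cmean h.
Proof. by move=> uv [hr hi]; rewrite /cmean (hmean_right uv hr) (hmean_right uv hi). Qed.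

Lemma haarC_right h v : unitary v -> haarC h -> haarC (fun u => h (u *m v)).
Proof.
by move=> uv [hr hi]; split; [exact: (haar_fct_right uv hr)|exact: (haar_fct_right uv hi)].
Qed.

End ComplexMean.

Section Averaging.
Variables (R : realType) (n : nat) (X : topologicalType).
Local Notation C := R[i].
Local Notation "x %:C" := (real_complex R x) : ring_scope.
Local Notation unitary := (@Defs.unitary R n).
Local Notation adjmx := (@Defs.adjmx R n).
Variable act : 'M[C]_n -> X -> X.
Hypothesis act1 : forall x, act 1%:M x = x.
Hypothesis actM : forall U V x, unitary U -> unitary V -> act (U *m V) x = act U (act V x).
Hypothesis act_within : {within [set p : 'M[C]_n * X | unitary p.1],
  continuous (fun p : 'M[C]_n * X => act p.1 p.2)}.
Implicit Types (u v w : 'M[C]_n) (f g : X -> 'M[C]_n).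

Lemma act_local u x (W : set X) : unitary u -> nbhs (act u x) W ->
  exists2 d : R, 0 < d & exists2 O, nbhs x O &
  forall v y, unitary v -> frob (v - u) <= d -> O y -> W (act v y).
Proof.
move=> uu nW.
have /subspace_continuousP/(_ (u, x) uu) := act_within.
move=> /(_ W nW); rewrite /within /= => -[[A O] /= [nA nO] AO].
have /nbhs_mxP[e e0 HA] := nA.
(* Entries are then within [e / 2], which is strictly less than [e]. *)
exists ((e / 2) ^+ 2); first by rewrite exprn_gt0// divr_gt0.
exists O => // v y uv vu Oy; apply: (AO (v, y)) => //; split => //=.
apply: HA => i j; have := frob_entry (v - u) i j.
rewrite !mxE cabsC => /le_trans/(_ vu).
have e2 : 0 < e / 2 by rewrite divr_gt0.
rewrite ler_pXn2r ?nnegrE ?cabs_ge0 ?(ltW e2)// => H.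
by apply: le_lt_trans H _; lra.
Qed.

Lemma act_continuous u : unitary u -> continuous (act u).
Proof.
move=> uu x W nW; have [d d0 [Y nY H]] := act_local uu nW.
apply: filterS nY => y Oy; apply: H => //; rewrite subrr.
by rewrite /frob big1 ?ltW// => i _; rewrite big1// => j _; rewrite mxE cabs0 expr0n.
Qed.

Lemma actK u : unitary u -> cancel (act u) (act (adjmx u)).
Proof.
move=> uu x; have ua := unitary_adj uu.
by rewrite -actM// (unitaryP uu).2 act1.
Qed.

Lemma actVK u : unitary u -> cancel (act (adjmx u)) (act u).
Proof.
move=> uu x; have ua := unitary_adj uu.
by rewrite -actM// (unitaryP uu).1 act1.
Qed.

Lemma c0_act (p : X -> R) u : unitary u -> c0 p -> c0 (fun x => p (act u x)).
Proof.
move=> uu [cp vp]; split.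
  by move=> x; apply: continuous_comp; [exact: act_continuous|exact: cp].
move=> e /vp[K cK KH]; exists (act (adjmx u) @` K).
  apply: continuous_compact => //; apply: continuous_subspaceT.
  by apply: act_continuous; exact: unitary_adj.
move=> x nK; apply: KH => Kx; apply: nK; exists (act u x) => //; exact: actK.
Qed.

(* If x is outside the compact set where |p| >= e/2 but w x is inside it, the
   estimate at w x for the inverse of w is used. *)
Lemma c0_act_unif (p : X -> R) (e : R) : c0 p -> 0 < e -> exists2 d : R, 0 < d &
  forall w x, unitary w -> frob (w - 1%:M) <= d -> `|p (act w x) - p x| <= e.
Proof.
move=> cp e0; have e2 : 0 < e / 2 by rewrite divr_gt0.
have cK := c0_compact cp e2.
pose G (d : R) := [set y | forall w, unitary w -> frob (w - 1%:M) <= d -> `|p (act w y) - p y| <= e].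
have u1 := @unitary1 R n.
have [||||_ [d /= d0 <-] KG] := @directed_compact _ _ [set (G d)^° | d in [set d : R | 0 < d]] cK.
- by exists (G 1)^°, 1 => //=.
- by move=> _ [d _ <-]; exact: open_interior.
- move=> _ _ [d /= d0 <-] [d' /= d'0 <-]; exists (G (Num.min d d'))^°.
    by exists (Num.min d d') => //=; rewrite lt_min d0.
  have sub a b : b <= a -> (G a)^° `<=` (G b)^°.
    by move=> ba y; apply: filterS => z Gz w uw wb; apply: Gz => //; exact: le_trans ba.
  by move=> y [] ; apply: sub; rewrite ge_min lexx ?orbT.
- move=> x _; have nW : nbhs (act 1%:M x) [set y | `|p x - p y| < e / 2].
    rewrite act1; have /cvgrPdist_lt := cp.1 x; exact.
  have [d d0 [Y nY H]] := act_local u1 nW.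
  exists (G d)^°; first by exists d.
  rewrite /interior; near=> y; move=> w uw wd.
  have Oy : Y y by near: y.
  have h1 := H w y uw wd Oy.
  have h2 := H 1%:M y u1 (_ : frob (1%:M - 1%:M) <= d) Oy.
  have {}h2 : `|p x - p y| < e / 2.
    rewrite -[y in X in X < _](act1 y); apply: h2.
    rewrite subrr /frob big1 ?ltW// => i _; rewrite big1// => j _.
    by rewrite mxE cabs0 expr0n.
  rewrite /= in h1; rewrite distrC in h1.
  have -> : p (act w y) - p y = (p (act w y) - p x) + (p x - p y) by ring.
  by apply: (le_trans (ler_normD _ _)); lra.
exists d => // w x uw wd.
have Gx y : e / 2 <= `|p y| -> G d y by move=> /KG/interior_subset.
have [px|px] := leP (e / 2) `|p x|; first exact: (Gx x).
have [py|py] := leP (e / 2) `|p (act w x)|; last first.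
  by apply: (le_trans (ler_normB _ _)); lra.
have ua := unitary_adj uw.
have := Gx _ py _ ua; rewrite actK// distrC; apply.
by rewrite -(@adjmx1 R n) -adjmxB frob_adj.
Unshelve. all: by end_near. Qed.

(** Translation by [u] on matrix-valued functions; the functions it fixes for every unitary [u] are
    the equivariant ones. *)
Definition twist f u x := adjmx u *m f (act u x) *m u.

Lemma twistE f u x j k : twist f u x j k = \sum_a \sum_b adjmx u j a * u b k * f (act u x) a b.
Proof. exact: mulmx3_entry. Qed.

Lemma twist_c0m f u : unitary u -> c0m f -> c0m (twist f u).
Proof.
move=> uu cf j k.
rewrite (_ : (fun x => _) = (fun x => \sum_a 1 * \sum_b adjmx u j a * u b k * f (act u x) a b)).
  apply: c0C_sum => a; apply: c0C_sum => b.
  by have [cr ci] := cf a b; split; [exact: (c0_act uu cr)|exact: (c0_act uu ci)].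
by apply/funext => x; rewrite twistE; apply: eq_bigr => a _; rewrite mul1r.
Qed.

Lemma twist_twist f u v x : unitary u -> unitary v -> twist (twist f v) u x = twist f (v *m u) x.
Proof. by move=> uu uv; rewrite /twist adjmxM actM// !mulmxA. Qed.

Lemma twist_act f u v x : unitary u -> unitary v ->
  twist f u (act v x) = v *m twist f (u *m v) x *m adjmx v.
Proof.
move=> uu uv; rewrite /twist adjmxM actM// !mulmxA (unitaryP uv).1 mul1mx.
by rewrite -!mulmxA (unitaryP uv).1 mulmx1.
Qed.

Lemma twist_bound f u x (s : R) : unitary u -> 0 <= s -> (forall x j k, cabs (f x j k) <= s) ->
  forall j k, cabs (twist f u x j k) <= n%:R ^+ 2 * s.
Proof. by move=> uu s0 fs; apply: unitary_sandwich => //; exact: unitary_adj. Qed.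

Lemma c0m_act_unif f (e : R) : c0m f -> 0 < e -> exists2 d : R, 0 < d &
  forall w x, unitary w -> frob (w - 1%:M) <= d -> forall j k, cabs (f (act w x) j k - f x j k) <= e.
Proof.
move=> cf e0; have e2 : 0 < e / 2 by rewrite divr_gt0.
have /choice[d Hd] (q : 'I_n * 'I_n) : exists d : R, 0 < d /\ forall w x, unitary w ->
    frob (w - 1%:M) <= d -> cabs (f (act w x) q.1 q.2 - f x q.1 q.2) <= e.
  have [cr ci] := cf q.1 q.2.
  have [d d0 H] := c0_act_unif cr e2; have [d' d'0 H'] := c0_act_unif ci e2.
  exists (Num.min d d'); split; first by rewrite lt_min d0.
  move=> w x uw; rewrite le_min => /andP[h h'].
  by rewrite (le_trans (cabs_le_ReIm _))// cReB cImB (splitr e) lerD// ?H ?H'.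
exists (\big[Num.min/1]_q d q).
  by elim/big_ind : _ => // [a b a0 b0|q _]; [rewrite lt_min a0|case: (Hd q)].
move=> w x uw wd j k; apply: (Hd (j, k)).2 => //.
by apply: le_trans wd _; exact: bigmin_le.
Qed.

(* twist f (w v) x - twist f v x is conjugate to twist f w y - f y with y = v x,
   so only w close to 1 matters. *)
Lemma twist_unif f (e : R) : c0m f -> 0 < e -> exists2 d : R, 0 < d &
  forall u v x, unitary u -> unitary v -> frob (u - v) <= d ->
  forall j k, cabs (twist f u x j k - twist f v x j k) <= e.
Proof.
move=> cf e0; have [s s0 fs] := c0m_bounded cf.
pose N : R := n%:R ^+ 2; have N0 : 0 <= N by rewrite sqr_ge0.
(* The entries of [twist f w y - f y] will be at most [N * (1 + 2 * s) * t], conjugation by [v]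
   costs another factor [N], and the summand 1 keeps [c] positive. *)
pose c := N * (N * (1 + 2 * s)) + 1.
have c0 : 0 < c by rewrite ltr_wpDl// !mulr_ge0// addr_ge0// mulr_ge0.
pose t := e / c; have t0 : 0 < t by rewrite divr_gt0.
have [d d0 Hd] := c0m_act_unif cf t0.
exists (Num.min d (t ^+ 2)); first by rewrite lt_min d0 exprn_gt0.
move=> u v x uu uv uv_d j k.
pose w := u *m adjmx v; have uv' := unitary_adj uv.
have uw : unitary w by exact: unitaryM.
have uwv : u = w *m v by rewrite /w -mulmxA (unitaryP uv).2 mulmx1.
have frw : frob (w - 1%:M) = frob (u - v).
  by rewrite -(frob_mulr (u - v) uv') mulmxBl (unitaryP uv).1.
pose y := act v x.
have ew i l : cabs ((w - 1%:M) i l) <= t.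
  rewrite -(@ler_pXn2r _ 2)// ?nnegrE ?cabs_ge0 ?(ltW t0)//.
  apply: le_trans (frob_entry _ _ _) _; rewrite frw.
  by apply: le_trans uv_d _; rewrite ge_min lexx orbT.
have ew' i l : cabs ((adjmx w - 1%:M) i l) <= t.
  rewrite -(@ler_pXn2r _ 2)// ?nnegrE ?cabs_ge0 ?(ltW t0)//.
  apply: le_trans (frob_entry _ _ _) _.
  rewrite -(@adjmx1 R n) -adjmxB frob_adj frw.
  by apply: le_trans uv_d _; rewrite ge_min lexx orbT.
have fw i l : cabs ((f (act w y) - f y) i l) <= t.
  rewrite !mxE; apply: Hd => //; rewrite frw.
  by apply: le_trans uv_d _; rewrite ge_min lexx.
have diff i l : cabs ((twist f w y - f y) i l) <= N * (1 + 2 * s) * t.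
  have -> : twist f w y - f y = (adjmx w - 1%:M) *m f (act w y) *m w +
      (1%:M *m (f (act w y) - f y) *m w + 1%:M *m f y *m (w - 1%:M)).
    rewrite /twist mul1mx !mulmxBl mulmxBr !mul1mx mulmx1.
    by rewrite !addrA !subrK.
  rewrite mxE [X in cabs (_ + X)]mxE; apply: (le_trans (ler_cabsD _ _)).
  have h1 := @mulmx3_bound R n (adjmx w - 1%:M) (f (act w y)) w t s 1 (ltW t0) s0 ler01
    ew' (fs _) (fun i j => unitary_entry i j uw) i l.
  have h2 := @mulmx3_bound R n 1%:M (f (act w y) - f y) w 1 t 1 ler01 (ltW t0) ler01
    (fun i j => unitary_entry i j (@unitary1 R n)) fw (fun i j => unitary_entry i j uw) i l.
  have h3 := @mulmx3_bound R n 1%:M (f y) (w - 1%:M) 1 s t ler01 s0 (ltW t0)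
    (fun i j => unitary_entry i j (@unitary1 R n)) (fs _) ew i l.
  apply: le_trans (lerD h1 (le_trans (ler_cabsD _ _) (lerD h2 h3))) _.
  by rewrite le_eqVlt; apply/orP; left; apply/eqP; rewrite -/N; ring.
have -> : twist f u x j k - twist f v x j k = (adjmx v *m (twist f w y - f y) *m v) j k.
  rewrite mulmxBr mulmxBl [RHS]mxE [X in _ = _ + X]mxE; congr (_ - _).
  by rewrite uwv -twist_twist.
have b0 : 0 <= N * (1 + 2 * s) * t.
  apply: mulr_ge0; last exact: ltW.
  by apply: mulr_ge0 => //; apply: addr_ge0 => //; exact: mulr_ge0.
apply: le_trans (unitary_sandwich uv' uv b0 diff j k) _.
have -> : e = c * t by rewrite /t mulrC divfK// gt_eqF.
have -> : n%:R ^+ 2 * (N * (1 + 2 * s) * t) = N * (N * (1 + 2 * s)) * t by rewrite -/N; ring.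
by apply: ler_wpM2r; [exact: ltW|rewrite lerDl].
Qed.

Lemma mx_lin_entry (A M : 'M[C]_n) (c : C) j k : (A + c *: M) j k = A j k + c * M j k.
Proof. by rewrite !mxE. Qed.

Definition Eavg f x : 'M[C]_n := \matrix_(j, k) cmean (fun u => twist f u x j k).

Lemma EavgE f x j k : Eavg f x j k = cmean (fun u => twist f u x j k).
Proof. exact: mxE. Qed.

Lemma twist_haarC f x j k : c0m f -> haarC (fun u => twist f u x j k).
Proof.
move=> cf; have [s s0 fs] := c0m_bounded cf.
apply: (@haarC_intro _ _ _ (2 * (n%:R ^+ 2 * s))).
  move=> u v uu uv; apply: (le_trans (ler_cabsB _ _)).
  have := twist_bound x uu s0 fs j k; have := twist_bound x uv s0 fs j k; lra.
move=> e e0; have [d d0 H] := twist_unif cf e0; exists d => // u v uu uv uvd.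
exact: H.
Qed.

(** One [k] serves all [x], because the bound and the modulus of [u |-> twist f u x] do not depend
    on [x]. *)
Lemma Eavg_approx f (e : R) : c0m f -> 0 < e -> exists k, forall x j l,
  cabs (cavg k (fun u => twist f u x j l) - Eavg f x j l) <= e.
Proof.
(* The bound of [cmean_dist] has a factor 6 and two error terms. *)
move=> cf e0; have e12 : 0 < e / 12 by rewrite divr_gt0.
have [s s0 fs] := c0m_bounded cf.
have [d d0 H] := twist_unif cf e12.
pose o := 2 * (n%:R ^+ 2 * s).
have o0 : 0 <= o by rewrite !mulr_ge0// sqr_ge0.
have [K /(_ K (leqnn _))[Kd Ko]] := avg_rate o d0 e12.
exists K => x j l; rewrite EavgE.
apply: le_trans (cmean_dist o0 (ltW e12) _ _) _.
- move=> u v uu uv; apply: (le_trans (ler_cabsB _ _)).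
  have := twist_bound x uu s0 fs j l; have := twist_bound x uv s0 fs j l; rewrite /o; lra.
- by move=> u v uu uv uvd; apply: H => //; exact: le_trans Kd.
- move: (o / _) Ko => t; lra.
Qed.

Lemma cavg_c0C k (h : 'M[C]_n -> X -> C) : (forall u, unitary u -> c0C (h u)) ->
  c0C (fun x => cavg k (fun u => h u x)).
Proof.
move=> ch; have [us _] := avg_seq_unitary R n k.
(* [c0C_sum] has a hypothesis for every index, so matrices outside the sequence are replaced by the
   identity. *)
rewrite (_ : (fun x => _) = (fun x => 0 + real_complex R (size (avg_seq R n k))%:R^-1 *
    \sum_(a <- avg_seq R n k) 1 * h (if a \in avg_seq R n k then a else 1%:M) x)); last first.
  apply/funext => x; rewrite /cavg add0r; congr (_ * _).
  by rewrite big_seq [RHS]big_seq; apply: eq_bigr => a ->; rewrite mul1r.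
apply: c0C_lin; first exact: c0C_0.
apply: c0C_sum => a; apply: ch; case: ifP => [/us//|_]; exact: unitary1.
Qed.

Lemma Eavg_c0m f : c0m f -> c0m (Eavg f).
Proof.
move=> cf j l; apply: c0C_unif_limit => e e0; have [k Hk] := Eavg_approx cf e0.
exists (fun x => cavg k (fun u => twist f u x j l)).
  by apply: (@cavg_c0C k (fun u x => twist f u x j l)) => u uu; exact: twist_c0m.
by move=> x; rewrite cabsC.
Qed.

(** By [twist_act], moving [x] to [v x] conjugates by [v] and replaces [u] by [u v]; right
    invariance of the mean removes the latter. *)
Lemma Eavg_act f v x : c0m f -> unitary v -> Eavg f (act v x) = Defs.mxconj v (Eavg f x).
Proof.
move=> cf uv; rewrite /Defs.mxconj unitary_invmx//; apply/matrixP => j k.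
rewrite [RHS]mulmx3_entry [LHS]EavgE.
have hR a b : haarC (fun u => twist f (u *m v) x a b).
  exact: (haarC_right uv (twist_haarC x a b cf)).
pose F a u := \sum_b v j a * adjmx v b k * twist f (u *m v) x a b.
have HF a : haarC (F a) /\ cmean (F a) = \sum_b v j a * adjmx v b k * Eavg f x a b.
  have [H1 H2] := cmean_sum (index_enum 'I_n) (fun b => v j a * adjmx v b k) (hR a).
  split => //; rewrite H2; apply: eq_bigr => b _; rewrite [Eavg _ _ _ _]EavgE.
  by rewrite (cmean_right uv (twist_haarC x a b cf)).
have [_ H] := cmean_sum (index_enum 'I_n) (fun=> 1) (fun a => (HF a).1).
transitivity (cmean (fun u => \sum_a 1 * F a u)); last first.
  by rewrite H; apply: eq_bigr => a _; rewrite mul1r (HF a).2.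
apply/eqP; rewrite -subr_eq0.
have hl := twist_haarC (act v x) j k cf.
have hr : haarC (fun u => \sum_a 1 * F a u).
  by have [] := cmean_sum (index_enum 'I_n) (fun=> 1) (fun a => (HF a).1).
have [_] := cmean_lin (- 1) hl hr; rewrite mulN1r => <-.
rewrite (cmean_cst (c := 0))// => u uu; rewrite twist_act// mulmx3_entry.
by under [X in -1 * X]eq_bigr do rewrite mul1r; rewrite mulN1r subrr.
Qed.

(** Here [u] becomes [v u] by [twist_twist], so left invariance of the mean applies. *)
Lemma Eavg_twist f v x : c0m f -> unitary v -> Eavg (twist f v) x = Eavg f x.
Proof.
move=> cf uv; apply/matrixP => j k; rewrite [LHS]EavgE [RHS]EavgE.
rewrite -(cmean_left uv (twist_haarC x j k cf)).
have hl := twist_haarC x j k (twist_c0m uv cf).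
have hr : haarC (fun u => twist f (v *m u) x j k).
  have [Hr Hi] := twist_haarC x j k cf.
  by split; [exact: (haar_fct_left uv Hr)|exact: (haar_fct_left uv Hi)].
apply/eqP; rewrite -subr_eq0; have [_] := cmean_lin (- 1) hl hr; rewrite mulN1r => <-.
by rewrite (cmean_cst (c := 0))// => u uu; rewrite twist_twist// mulN1r subrr.
Qed.

Lemma Eavg_lin f g (c : C) x : c0m f -> c0m g ->
  Eavg (fun x => f x + c *: g x) x = Eavg f x + c *: Eavg g x.
Proof.
move=> cf cg; apply/matrixP => j k; rewrite [RHS]mx_lin_entry; apply: (etrans (EavgE _ _ _ _)).
transitivity (cmean (fun u => twist f u x j k) + c * cmean (fun u => twist g u x j k));
  last by congr (_ + _ * _); rewrite EavgE.
have [_ <-] := cmean_lin c (twist_haarC x j k cf) (twist_haarC x j k cg).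
congr cmean; apply/funext => u.
by rewrite /twist mulmxDr mulmxDl -scalemxAr -scalemxAl mx_lin_entry.
Qed.

Lemma Eavg_id f x : (forall U x, unitary U -> f (act U x) = Defs.mxconj U (f x)) -> Eavg f x = f x.
Proof.
move=> ef; apply/matrixP => j k; rewrite EavgE; apply: cmean_cst => u uu.
rewrite /twist ef// /Defs.mxconj unitary_invmx// !mulmxA (unitaryP uu).2 mul1mx.
by rewrite -mulmxA (unitaryP uu).2 mulmx1.
Qed.

Lemma cavg_bound k (h : 'M[C]_n -> C) (s : R) : (forall u, unitary u -> cabs (h u) <= s) ->
  cabs (cavg k h) <= s.
Proof.
move=> hs; have us := avg_seq_unitary R n k; have m0 := size_gt0R us.
rewrite /cavg cabsM cabs_real ger0_norm ?invr_ge0 ?(ltW m0)// ler_pdivrMl//.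
apply: (le_trans (ler_cabs_sum _ _ _)).
apply: (@le_trans _ _ (\sum_(a <- avg_seq R n k) s)).
  by rewrite big_seq [leRHS]big_seq; apply: ler_sum => a /us.1/hs.
by rewrite big_const_seq count_predT iter_addr_0 mulr_natl.
Qed.

Lemma Eavg_bound f (s : R) x j k : c0m f -> 0 <= s -> (forall x j k, cabs (f x j k) <= s) ->
  cabs (Eavg f x j k) <= n%:R ^+ 2 * s.
Proof.
move=> cf s0 fs; apply/ler_addgt0Pr => e e0; have [m Hm] := Eavg_approx cf e0.
have H := Hm x j k; rewrite cabsC in H.
have -> : Eavg f x j k = cavg m (fun u => twist f u x j k) + (Eavg f x j k - cavg m (fun u => twist f u x j k)).
  by ring.
apply: (le_trans (ler_cabsD _ _)); apply: lerD => //.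
by apply: cavg_bound => u uu; exact: twist_bound.
Qed.

End Averaging.

(** * Complex Riesz theorem and matrix-valued measures *)

Section ComplexRiesz.
Variables (R : realType) (X : topologicalType).
Local Notation C := R[i].
Local Notation "x %:C" := (real_complex R x) : ring_scope.
Local Notation Re := (@complex.Re R).
Local Notation Im := (@complex.Im R).
Hypotheses (hX : hausdorff_space X) (lX : locally_compact [set: X]).

Lemma sum_realc (I : Type) (s : seq I) (F : I -> R) :
  \sum_(i <- s) (F i)%:C = (\sum_(i <- s) F i)%:C :> C.
Proof. by rewrite (rmorph_sum (real_complex R)). Qed.

Lemma Re_realM (c : R) (z : C) : Re (c%:C * z) = c * Re z.
Proof. by rewrite cReM /= mul0r subr0. Qed.

Lemma Im_realM (c : R) (z : C) : Im (c%:C * z) = c * Im z.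
Proof. by rewrite cImM /= mul0r addr0. Qed.

Lemma real_riesz_complex (psi : (X -> R) -> R) (B : R) : 0 <= B ->
  (forall f g, c0 f -> c0 g -> psi (fun x => f x + g x) = psi f + psi g) ->
  (forall (c : R) f, c0 f -> psi (fun x => c * f x) = c * psi f) ->
  (forall f (s : R), c0 f -> 0 <= s -> (forall x, `|f x| <= s) -> psi f <= B * s) ->
  exists nu : set X -> C, radon_cmeasure nu /\
    forall p, c0 p -> cintegral nu (fun x => (p x)%:C) = (psi p)%:C.
Proof.
move=> B0 psiD psiZ psiB.
have [nu [sadd treg vle simp]] := real_riesz B0 psiD psiZ psiB hX lX.
have cabs_sum k (P : 'I_k -> set X) : \sum_(i < k) cabs (nu (P i))%:C = \sum_(i < k) `|nu (P i)|.
  by apply: eq_bigr => i _; rewrite cabs_real.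
have rnu : radon_cmeasure (fun A => (nu A)%:C).
  split.
  - move=> F bF tF; apply/cvg_complexP => e e0.
    have /cvgrPdist_le/(_ _ e0)[M _ HM] := sadd F bF tF.
    exists M => m Mm; rewrite sum_realc -realcB cabs_real distrC; exact: HM.
  - by exists B => k P bP dP _; rewrite cabs_sum; exact: vle.
  - move=> E e bE e0; have [K [V [cK oV KE EV H]]] := treg E e bE e0.
    by exists K, V; split => // k P bP dP PW; rewrite cabs_sum; exact: H.
exists (fun A => (nu A)%:C); split => // p cp.
have [cnu [M HM] _] := rnu.
(* The coefficients are complex: their real parts approximate [p] and their imaginary parts
   approximate 0, each at the cost [B * d]. *)
apply: (cintegral_eq cnu HM (M' := B + B)); [exact: approximable_c0|exact: addr_ge0|].
move=> k c E d d0 [bE pE].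
have hr := simp p k (fun i => Re (c i)) E d cp bE d0.
have hi := simp (fun=> 0) k (fun i => Im (c i)) E d (@c0_0 R X) bE d0.
have psi0' : psi (fun=> 0) = 0.
  by have := psiZ 0 _ (@c0_0 R X); rewrite !mul0r.
have ReS (a : 'I_k -> R) : Re (\sum_(i < k) c i * (a i)%:C) = \sum_(i < k) Re (c i) * a i.
  by rewrite Re_sum; apply: eq_bigr => i _; rewrite cReM /= mulr0 subr0.
have ImS (a : 'I_k -> R) : Im (\sum_(i < k) c i * (a i)%:C) = \sum_(i < k) Im (c i) * a i.
  by rewrite Im_sum; apply: eq_bigr => i _; rewrite cImM /= mulr0 add0r.
have pE' x : cabs ((p x)%:C - \sum_(i < k) c i * (\1_(E i) x : R)%:C) <= d.
  by apply: le_trans (pE x); under eq_bigr do rewrite -indC.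
apply: (le_trans (cabs_le_ReIm _)); rewrite cReB cImB ReS ImS /= subr0 mulrDr.
apply: lerD.
  rewrite distrC mulrC; apply: hr => x; rewrite -ReS.
  by have := ler_Re_cabs ((p x)%:C - \sum_(i < k) c i * (\1_(E i) x : R)%:C);
     rewrite cReB /= => /le_trans; apply.
have : `|psi (fun=> 0) - \sum_(i < k) Im (c i) * nu (E i)| <= B * d.
  apply: hi => x; rewrite -ImS.
  by have := ler_Im_cabs ((p x)%:C - \sum_(i < k) c i * (\1_(E i) x : R)%:C);
     rewrite cImB /= => /le_trans; apply.
by rewrite psi0' sub0r normrN [B * d]mulrC.
Qed.

(** A complex linear functional is determined by its restriction to real functions. The real and
    imaginary parts of that restriction are bounded and real linear; if [nu1] and [nu2] represent
    them, [nu1 + i nu2] represents [Phi]. *)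
Theorem complex_riesz (Phi : (X -> C) -> C) (B : R) : 0 <= B ->
  (forall f g (c : C), c0C f -> c0C g -> Phi (fun x => f x + c * g x) = Phi f + c * Phi g) ->
  (forall f (s : R), c0C f -> 0 <= s -> (forall x, cabs (f x) <= s) -> cabs (Phi f) <= B * s) ->
  exists nu : set X -> C, radon_cmeasure nu /\ forall f, c0C f -> cintegral nu f = Phi f.
Proof.
move=> B0 Phi_lin PhiB.
have cR (p : X -> R) : c0 p -> c0C (fun x => (p x)%:C) by move=> cp; split => //; exact: c0_0.
have Phi0 : Phi (fun=> 0) = 0.
  apply: cabs0_eq0; apply/le_anti; rewrite cabs_ge0 andbT -(mulr0 B).
  by apply: PhiB => //; [exact: c0C_0|move=> x; rewrite cabs0].
have D (f g : X -> R) : c0 f -> c0 g ->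
    Phi (fun x => (f x + g x)%:C) = Phi (fun x => (f x)%:C) + Phi (fun x => (g x)%:C).
  move=> /cR cf /cR cg; rewrite -[X in _ = _ + X]mul1r -Phi_lin//; congr Phi.
  by apply/funext => x; rewrite mul1r rmorphD.
have Z (c : R) (f : X -> R) : c0 f -> Phi (fun x => (c * f x)%:C) = c%:C * Phi (fun x => (f x)%:C).
  move=> /cR cf; rewrite -[RHS]add0r -Phi0 -Phi_lin//; last exact: c0C_0.
  by congr Phi; apply/funext => x; rewrite add0r rmorphM.
have Bd (g : C -> R) (f : X -> R) (s : R) : (forall z, `|g z| <= cabs z) -> c0 f -> 0 <= s ->
    (forall x, `|f x| <= s) -> g (Phi (fun x => (f x)%:C)) <= B * s.
  move=> gc cf s0 fs; apply: (le_trans (ler_norm _)); apply: (le_trans (gc _)).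
  by apply: PhiB => //; [exact: cR|move=> x; rewrite cabs_real].
have [nu1 [r1 h1]] := @real_riesz_complex (fun p => Re (Phi (fun x => (p x)%:C))) B B0
  (fun f g cf cg => etrans (congr1 Re (D f g cf cg)) (cReD _ _))
  (fun c f cf => etrans (congr1 Re (Z c f cf)) (Re_realM _ _))
  (fun f s cf s0 fs => Bd _ f s (@ler_Re_cabs R) cf s0 fs).
have [nu2 [r2 h2]] := @real_riesz_complex (fun p => Im (Phi (fun x => (p x)%:C))) B B0
  (fun f g cf cg => etrans (congr1 Im (D f g cf cg)) (cImD _ _))
  (fun c f cf => etrans (congr1 Im (Z c f cf)) (Im_realM _ _))
  (fun f s cf s0 fs => Bd _ f s (@ler_Im_cabs R) cf s0 fs).
pose a (b : bool) : C := if b then 1 else 'i%C.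
pose nus (b : bool) := if b then nu1 else nu2.
have rs b : radon_cmeasure (nus b) by case: b.
pose nu A := \sum_b a b * nus b A.
have rnu : radon_cmeasure nu := radon_sum (index_enum bool) a rs.
exists nu; split => //.
have real_case (p : X -> R) : c0 p -> cintegral nu (fun x => (p x)%:C) = Phi (fun x => (p x)%:C).
  move=> cp; rewrite cintegral_measure_sum//; last exact: approximable_c0.
  by rewrite big_bool /= mul1r h1// h2// -complexE.
move=> f cf; have [cfr cfi] := cf.
have fE : f = fun x => (Re (f x))%:C + 'i%C * (Im (f x))%:C.
  by apply/funext => x; rewrite -complexE.
have [cnu [M HM] _] := rnu.
rewrite fE (cintegral_lin cnu HM)//; [|exact: approximable_c0|exact: approximable_c0].
by rewrite !real_case// Phi_lin//; exact: cR.
Qed.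

Lemma cintegral_ext (nu nu' : set X -> C) f : (forall A, borel A -> nu A = nu' A) ->
  cintegral nu f = cintegral nu' f.
Proof.
move=> H; rewrite /cintegral; congr (xget _ _); apply/seteqP; split=> v Hv e e0;
  have [d d0 Hd] := Hv e e0; exists d => // k c E bE fE; have := Hd k c E bE fE;
  congr (`|_ - _| < _); apply: eq_bigr => i _; by rewrite H.
Qed.

End ComplexRiesz.

(** * Integrals against matrices of measures *)

Section MatrixIntegral.
Variables (R : realType) (n : nat) (X : topologicalType).
Local Notation C := R[i].
Local Notation unitary := (@Defs.unitary R n).
Local Notation adjmx := (@Defs.adjmx R n).
Variable nu : 'I_n -> 'I_n -> set X -> C.
Hypothesis rnu : forall j k, radon_cmeasure (nu j k).
Implicit Types f g : X -> 'M[C]_n.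

Lemma nintegral_lin f g (c : C) : c0m f -> c0m g ->
  nintegral nu (fun x => f x + c *: g x) = nintegral nu f + c * nintegral nu g.
Proof.
move=> cf cg; rewrite /nintegral mulr_sumr -big_split/=; apply: eq_bigr => j _.
rewrite mulr_sumr -big_split/=; apply: eq_bigr => k _.
have [cnu [M HM] _] := rnu k j.
rewrite -(cintegral_lin cnu HM); [|exact: approximable_c0C..].
by congr cintegral; apply/funext => x; rewrite mx_lin_entry.
Qed.

Lemma c0m_lin f g (c : C) : c0m f -> c0m g -> c0m (fun x => f x + c *: g x).
Proof.
move=> cf cg j k; rewrite (_ : (fun x => _) = fun x => f x j k + c * g x j k).
  exact: c0C_lin.
by apply/funext => x; rewrite mx_lin_entry.
Qed.

Lemma c0m_0 : c0m (fun _ : X => 0 : 'M[C]_n).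
Proof.
move=> j k; rewrite (_ : (fun x => _) = fun=> 0); first exact: c0C_0.
by apply/funext => x; rewrite mxE.
Qed.

Lemma nintegral_bound : exists2 M : R, 0 <= M & forall f (s : R), c0m f -> 0 <= s ->
  (forall x j k, cabs (f x j k) <= s) -> cabs (nintegral nu f) <= s * M.
Proof.
have /choice[M HM] (p : 'I_n * 'I_n) : exists M, var_le (nu p.1 p.2) setT M.
  by case: (rnu p.1 p.2).
exists (\sum_j \sum_k M (k, j)).
  by apply: sumr_ge0 => j _; apply: sumr_ge0 => k _; exact: var_le_ge0 (HM (k, j)).
move=> f s cf s0 fs; rewrite mulr_sumr.
apply: (le_trans (ler_cabs_sum _ _ _)); apply: ler_sum => j _; rewrite mulr_sumr.
apply: (le_trans (ler_cabs_sum _ _ _)); apply: ler_sum => k _.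
have [cnu _ _] := rnu k j.
by apply: (cintegral_bound cnu (HM (k, j))) => //; exact: approximable_c0C.
Qed.

Lemma nintegral0 : nintegral nu (fun=> 0) = 0.
Proof.
have := nintegral_lin (- 1) c0m_0 c0m_0; rewrite mulN1r subrr => <-.
by congr nintegral; apply/funext => x; rewrite scaler0 addr0.
Qed.

Lemma c0m_sum (I : Type) (s : seq I) (c : I -> C) (f : I -> X -> 'M[C]_n) :
  (forall i, c0m (f i)) -> c0m (fun x => \sum_(i <- s) c i *: f i x).
Proof.
move=> cf; elim: s => [|i s IH].
  rewrite (_ : (fun x => _) = fun=> 0); first exact: c0m_0.
  by apply/funext => x; rewrite big_nil.
rewrite (_ : (fun x => _) = (fun x => \sum_(i <- s) c i *: f i x + c i *: f i x)).
  exact: c0m_lin.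
by apply/funext => x; rewrite big_cons addrC.
Qed.

Lemma nintegral_sum (I : Type) (s : seq I) (c : I -> C) (f : I -> X -> 'M[C]_n) :
  (forall i, c0m (f i)) ->
  nintegral nu (fun x => \sum_(i <- s) c i *: f i x) = \sum_(i <- s) c i * nintegral nu (f i).
Proof.
move=> cf; elim: s => [|i s IH].
  rewrite big_nil (_ : (fun x => _) = fun=> 0); first exact: nintegral0.
  by apply/funext => x; rewrite big_nil.
rewrite (_ : (fun x => _) = (fun x => \sum_(i <- s) c i *: f i x + c i *: f i x)).
  by rewrite nintegral_lin// ?IH ?big_cons 1?addrC//; exact: c0m_sum.
by apply/funext => x; rewrite big_cons addrC.
Qed.

Definition single (j k : 'I_n) (p : X -> C) x : 'M[C]_n := p x *: delta_mx j k.

Lemma singleE j k p x a b : single j k p x a b = p x * ((a == j) && (b == k))%:R.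
Proof. by rewrite /single !mxE. Qed.

Lemma single_c0m j k p : c0C p -> c0m (single j k p).
Proof.
move=> cp a b; rewrite (_ : (fun x => _) = fun x => 0 + ((a == j) && (b == k))%:R * p x).
  by apply: c0C_lin => //; exact: c0C_0.
by apply/funext => x; rewrite singleE add0r mulrC.
Qed.

Lemma single_lin j k p q (c : C) :
  single j k (fun x => p x + c * q x) = fun x => single j k p x + c *: single j k q x.
Proof. by apply/funext => x; rewrite /single scalerDl scalerA. Qed.

Lemma nintegral_single j k p : c0C p -> nintegral nu (single j k p) = cintegral (nu k j) p.
Proof.
move=> cp; rewrite /nintegral.
have E a b : cintegral (nu b a) (fun x => single j k p x a b) =
    ((a == j) && (b == k))%:R * cintegral (nu k j) p.
  have [cnu [M HM] _] := rnu b a; have ap := approximable_c0C cp.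
  have [/andP[/eqP -> /eqP ->]|ab] := boolP ((a == j) && (b == k)).
    by rewrite mul1r; congr cintegral; apply/funext => x; rewrite singleE !eqxx mulr1.
  rewrite mulr0n mul0r.
  apply: cabs0_eq0; apply/le_anti; rewrite cabs_ge0 andbT -(mul0r M).
  apply: (cintegral_bound cnu HM) => //; first by apply: approximable_c0C; exact: single_c0m.
  by move=> x; rewrite singleE (negbTE ab) mulr0n mulr0 cabs0.
rewrite (bigD1 j)//= (bigD1 k)//= E !eqxx mul1r big1 ?addr0 => [|b bk]; last first.
  by rewrite E (negbTE bk) andbF mul0r.
rewrite big1 ?addr0// => a aj; rewrite big1// => b _.
by rewrite E (negbTE aj) mul0r.
Qed.

Lemma single_sum f :
  f = fun x => \sum_(p : 'I_n * 'I_n) 1 *: single p.1 p.2 (fun x => f x p.1 p.2) x.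
Proof.
apply/funext => x; rewrite {1}(matrix_sum_delta (f x)) pair_big/=.
by apply: eq_bigr => p _; rewrite scale1r.
Qed.

Variable act : 'M[C]_n -> X -> X.
Hypothesis hX : hausdorff_space X.
Hypothesis act1 : forall x, act 1%:M x = x.
Hypothesis actM : forall U V x, unitary U -> unitary V -> act (U *m V) x = act U (act V x).
Hypothesis act_within : {within [set p : 'M[C]_n * X | unitary p.1],
  continuous (fun p : 'M[C]_n * X => act p.1 p.2)}.
Hypothesis nu_act : forall U A, unitary U -> borel A ->
  \matrix_(j, k) nu j k (act U @` A) = mxconj U (\matrix_(j, k) nu j k A).

(** A change of variables moves the translation by [u] onto the measures, giving [nu']. Equivariance
    says that [nu] is [nu'] conjugated by [u], and the coefficients of this conjugation are exactly
    those produced by the conjugation of the values of [f]. *)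
Lemma nintegral_twist f u : c0m f -> unitary u -> nintegral nu (twist act f u) = nintegral nu f.
Proof.
move=> cf uu; have ua := unitary_adj uu.
pose nu' j k A := nu j k (act (adjmx u) @` A).
have rnu' j k : radon_cmeasure (nu' j k).
  apply: (radon_image (h' := act u)) => //.
  - exact: act_continuous.
  - exact: act_continuous.
  - exact: actVK.
  - exact: actK.
have cfu a b : c0C (fun x => f (act u x) a b).
  by have [cr ci] := cf a b; split; [exact: (c0_act act1 actM act_within uu cr)|
    exact: (c0_act act1 actM act_within uu ci)].
have step1 j k : cintegral (nu k j) (fun x => twist act f u x j k) =
    \sum_a \sum_b adjmx u j a * u b k * cintegral (nu' k j) (fun x => f x a b).
  transitivity (cintegral (nu k j) (fun x => \sum_(p : 'I_n * 'I_n)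
     (adjmx u j p.1 * u p.2 k) * f (act u x) p.1 p.2)).
    by congr cintegral; apply/funext => x; rewrite twistE pair_big.
  rewrite cintegral_sum//; last by move=> p; exact: approximable_c0C.
  rewrite pair_big/=; apply: eq_bigr => -[a b] _ /=; congr (_ * _).
  rewrite (@cintegral_image _ _ (nu k j) (act (adjmx u)) (act u) (fun x => f x a b))//.
  - exact: act_continuous.
  - exact: act_continuous.
  - exact: actVK.
  - exact: actK.
  - exact: approximable_c0C.
  - exact: approximable_c0C (cfu a b).
have step2 a b : cintegral (nu b a) (fun x => f x a b) =
    \sum_j \sum_k adjmx u j a * u b k * cintegral (nu' k j) (fun x => f x a b).
  rewrite pair_big/= -(@cintegral_measure_sum _ _ _
    (fun p : 'I_n * 'I_n => adjmx u p.1 a * u b p.2) (fun p => nu' p.2 p.1))//; last exact: approximable_c0C.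
  apply: cintegral_ext => A bA.
  have := nu_act ua bA; rewrite /mxconj unitary_invmx// adjmxK => H.
  have : \matrix_(j, k) nu j k A = u *m (\matrix_(j, k) nu' j k A) *m adjmx u.
    by rewrite /nu' H !mulmxA (unitaryP uu).1 mul1mx -mulmxA (unitaryP uu).1 mulmx1.
  move=> /(congr1 (fun M : 'M[C]_n => M b a)); rewrite mulmx3_entry mxE => ->.
  rewrite exchange_big pair_big /=; apply: eq_bigr => -[j k] _ /=.
  by rewrite mxE [u b k * _]mulrC.
rewrite /nintegral.
pose F j k a b := adjmx u j a * u b k * cintegral (nu' k j) (fun x => f x a b).
transitivity (\sum_j \sum_k \sum_a \sum_b F j k a b).
  by apply: eq_bigr => j _; apply: eq_bigr => k _; exact: step1.
transitivity (\sum_a \sum_b \sum_j \sum_k F j k a b); last first.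
  by apply: eq_bigr => a _; apply: eq_bigr => b _; rewrite step2.
transitivity (\sum_(p : 'I_n * 'I_n) \sum_(q : 'I_n * 'I_n) F p.1 p.2 q.1 q.2).
  by rewrite pair_big; apply: eq_bigr => p _; rewrite pair_big.
rewrite exchange_big [RHS]pair_big; apply: eq_bigr => q _ /=.
by rewrite [RHS]pair_big.
Qed.

(** Equality holds for every finite average [S] of twists by [nintegral_twist]. [Eavg_approx] brings
    [S] uniformly close to [Eavg act f], and the integral is bounded for the uniform norm. *)
Lemma nintegral_Eavg f : c0m f -> nintegral nu (Eavg act f) = nintegral nu f.
Proof.
move=> cf; have [M M0 HM] := nintegral_bound.
have cE := Eavg_c0m act1 actM act_within cf.
apply/eqP; rewrite -subr_eq0; apply/eqP/cabs0_eq0/le_anti; rewrite cabs_ge0 andbT.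
apply: (ler_addmul_eps M0) => e e0; rewrite add0r.
have [k Hk] := Eavg_approx act1 actM act_within cf e0.
have us := avg_seq_unitary R n k; have m0 := size_gt0R us.
pose W := avg_seq R n k.
pose c : C := real_complex R (size W)%:R^-1.
pose T a := twist act f (if a \in W then a else 1%:M).
have uif a : unitary (if a \in W then a else 1%:M).
  by case: ifP => [/us.1//|_]; exact: unitary1.
have cT a : c0m (T a) by exact: (twist_c0m act1 actM act_within (uif a) cf).
have cS := c0m_sum W (fun=> c) cT; have IS := nintegral_sum W (fun=> c) cT.
set S := (fun x => _) in cS IS.
have cW : c * (size W)%:R = 1.
  have -> : (size W)%:R = real_complex R (size W)%:R :> C by rewrite rmorph_nat.
  by rewrite /c -rmorphM mulVf ?rmorph1// gt_eqF.
have IS' : nintegral nu S = nintegral nu f.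
  rewrite IS (eq_bigr (fun=> c * nintegral nu f)); last first.
    by move=> a _; rewrite nintegral_twist.
  rewrite -mulr_sumr big_const_seq count_predT iter_addr_0 -[_ *+ size W]mulr_natl mulrA.
  by rewrite cW mul1r.
have SE x j l : S x j l = cavg k (fun u => twist act f u x j l).
  rewrite /S summxE /cavg mulr_sumr big_seq [RHS]big_seq; apply: eq_bigr => a aW.
  by rewrite mxE /T aW.
have := HM (fun x => S x + (- 1) *: Eavg act f x) e (c0m_lin (- 1) cS cE) (ltW e0).
rewrite nintegral_lin// IS' mulN1r cabsC; apply => x j l.
by rewrite mx_lin_entry mulN1r SE.
Qed.

End MatrixIntegral.

(** * Extension of the functional *)

Section Extension.
Variables (R : realType) (n : nat) (X : topologicalType).
Local Notation C := R[i].
Local Notation unitary := (@Defs.unitary R n).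
Local Notation adjmx := (@Defs.adjmx R n).
Variables (act : 'M[C]_n -> X -> X) (phi : (X -> 'M[C]_n) -> C).
Hypothesis hX : hausdorff_space X.
Hypothesis lX : locally_compact [set: X].
Hypothesis act1 : forall x, act 1%:M x = x.
Hypothesis actM : forall U V x, unitary U -> unitary V -> act (U *m V) x = act U (act V x).
Hypothesis act_within : {within [set p : 'M[C]_n * X | unitary p.1],
  continuous (fun p : 'M[C]_n * X => act p.1 p.2)}.
Hypothesis phi_lin : cont_lin_functional act phi.
Implicit Types f g : X -> 'M[C]_n.

Lemma Cstar0 : Cstar act (fun _ : X => 0 : 'M[C]_n).
Proof.
apply/c0m_Cstar; split; first exact: c0m_0.
by move=> U x uU; rewrite /mxconj mulmx0 mul0mx.
Qed.

Lemma functional0 : phi (fun=> 0) = 0.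
Proof.
have [_ Z _] := phi_lin; have := Z 0 _ Cstar0; rewrite mul0r => <-.
by congr phi; apply/funext => x; rewrite scale0r.
Qed.

Lemma CstarZ f (c : C) : Cstar act f -> Cstar act (fun x => c *: f x).
Proof.
move=> /c0m_Cstar[cf ef]; apply/c0m_Cstar; split.
  have := c0m_lin c (@c0m_0 R n X) cf; congr c0m.
  by apply/funext => x; rewrite add0r.
by move=> U x uU; rewrite ef// /mxconj -scalemxAr -scalemxAl.
Qed.

(** Continuity at 0 with tolerance 1 gives a radius [d]; rescaling [f] into this ball gives the
    bound with constant 1/d. *)
Lemma functional_bounded : exists2 B : R, 0 <= B & forall f (s : R), Cstar act f -> 0 <= s ->
  (forall x j k, cabs (f x j k) <= s) -> cabs (phi f) <= B * s.
Proof.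
have [_ Z cont] := phi_lin.
have [d /gt0_complexE[d0 dE] Hd] := cont _ Cstar0 1 ltr01.
exists (complex.Re d)^-1; first by rewrite invr_ge0 ltW.
move=> f s Cf s0 fs; apply/ler_addgt0Pr => e e0.
(* The term [e * D] keeps [t] positive when [s = 0] and contributes only [e] to [t / D]. *)
pose D := complex.Re d; pose t := s + e * D.
have t0 : 0 < t by rewrite ltr_wpDl// mulr_gt0.
have Dt0 : 0 < D / t by rewrite divr_gt0.
have := Hd _ (CstarZ (real_complex R (D / t)) Cf).
rewrite functional0 subr0 Z// -[1]/(real_complex R 1) ltc_cabs cabsM cabs_real.
rewrite ger0_norm ?(ltW Dt0)// => /(_ _)/ltW H.
have {}H : D / t * cabs (phi f) <= 1.
  apply: H => x; rewrite subr0 dE; apply/mxnorm_leP; first exact: ltW.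
  move=> i j; rewrite mxE cabsM cabs_real ger0_norm ?(ltW Dt0)//.
  rewrite -/D mulrAC ler_pdivrMr// ler_wpM2l ?(ltW d0)//.
  by rewrite (le_trans (fs x i j))// /t lerDl mulr_ge0 ?(ltW e0) ?(ltW d0).
have : cabs (phi f) <= t / D.
  by rewrite ler_pdivlMr// mulrC -(ler_pM2r (_ : 0 < t^-1)) ?invr_gt0// mulrAC divff ?gt_eqF.
move=> /le_trans; apply; rewrite /t mulrDl mulfK ?gt_eqF// mulrC lexx.
by [].
Qed.

Definition ext_functional f := phi (Eavg act f).

Lemma Eavg_Cstar f : c0m f -> Cstar act (Eavg act f).
Proof.
move=> cf; apply/c0m_Cstar; split; first exact: Eavg_c0m.
by move=> U x uU; exact: Eavg_act.
Qed.

Lemma ext_functional_lin f g (c : C) : c0m f -> c0m g ->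
  ext_functional (fun x => f x + c *: g x) = ext_functional f + c * ext_functional g.
Proof.
move=> cf cg; have [D Z _] := phi_lin; rewrite /ext_functional.
rewrite -Z; last exact: Eavg_Cstar.
rewrite -D; [|exact: Eavg_Cstar|by apply: CstarZ; exact: Eavg_Cstar].
by congr phi; apply/funext => x /=; apply: Eavg_lin.
Qed.

Lemma ext_functional0 : ext_functional (fun=> 0) = 0.
Proof.
have := ext_functional_lin (- 1) (@c0m_0 R n X) (@c0m_0 R n X); rewrite mulN1r subrr => <-.
by congr ext_functional; apply/funext => x; rewrite scaler0 addr0.
Qed.

Lemma ext_functional_sum (I : Type) (s : seq I) (c : I -> C) (f : I -> X -> 'M[C]_n) :
  (forall i, c0m (f i)) ->
  ext_functional (fun x => \sum_(i <- s) c i *: f i x) = \sum_(i <- s) c i * ext_functional (f i).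
Proof.
move=> cf; elim: s => [|i s IH].
  rewrite big_nil (_ : (fun x => _) = fun=> 0); first exact: ext_functional0.
  by apply/funext => x; rewrite big_nil.
rewrite (_ : (fun x => _) = (fun x => \sum_(i <- s) c i *: f i x + c i *: f i x)).
  by rewrite ext_functional_lin// ?IH ?big_cons 1?addrC//; exact: c0m_sum.
by apply/funext => x; rewrite big_cons addrC.
Qed.

Lemma single_functional j k : exists nu : set X -> C, radon_cmeasure nu /\
  forall p, c0C p -> cintegral nu p = ext_functional (single j k p).
Proof.
have [B B0 HB] := functional_bounded.
have N0 : 0 <= n%:R ^+ 2 :> R by rewrite sqr_ge0.
apply: (@complex_riesz R X hX lX (fun p => ext_functional (single j k p)) (B * n%:R ^+ 2)).
- exact: mulr_ge0.
- by move=> f g c cf cg; rewrite single_lin ext_functional_lin//; exact: single_c0m.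
- move=> p s cp s0 ps; rewrite -mulrA; have cs := single_c0m j k cp.
  apply: HB; [exact: Eavg_Cstar|exact: mulr_ge0|].
  move=> x a b; apply: Eavg_bound => // {}x {}a {}b; rewrite singleE cabsM.
  by case: (_ && _); rewrite ?mulr1n ?mulr0n ?cabs0 ?mulr0// [cabs 1]Normc.normc1 mulr1.
Qed.

(* The transposition of the indices matches int f dmu = sum f_jk dmu_kj. *)
Definition rep (j k : 'I_n) : set X -> C := projT1 (cid (single_functional k j)).

Lemma rep_radon j k : radon_cmeasure (rep j k).
Proof. by have [] := projT2 (cid (single_functional k j)). Qed.

Lemma rep_integral j k p : c0C p -> cintegral (rep j k) p = ext_functional (single k j p).
Proof. by have [_] := projT2 (cid (single_functional k j)); apply. Qed.

Lemma rep_nintegral f : c0m f -> nintegral rep f = ext_functional f.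
Proof.
move=> cf; rewrite [in RHS](single_sum f) ext_functional_sum; last first.
  by move=> p; apply: single_c0m; exact: cf.
rewrite /nintegral pair_big/=; apply: eq_bigr => -[j k] _ /=; rewrite mul1r.
by apply: rep_integral; exact: cf.
Qed.

Lemma ext_functional_twist f u : c0m f -> unitary u ->
  ext_functional (twist act f u) = ext_functional f.
Proof.
move=> cf uu; rewrite /ext_functional; have -> // : Eavg act (twist act f u) = Eavg act f.
  by apply/funext => x; exact: (Eavg_twist act1 actM act_within x cf uu).
Qed.

(** Both sides are combined into one measure, the index [None] carrying the image measure and
    [Some (b, c)] the entries on the right. Its integral of every [p] vanishes: with [V] the adjoint
    of [U], twisting [single k j (p o act V)] by [U] gives the sum of [U j b * V c k] times
    [single c b p], and [ext_functional] does not see the twist. Then [radon_uniq] applies. *)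
Lemma rep_act U A : unitary U -> borel A ->
  \matrix_(j, k) rep j k (act U @` A) = mxconj U (\matrix_(j, k) rep j k A).
Proof.
move=> uU bA; have uV := unitary_adj uU.
rewrite /mxconj unitary_invmx//; apply/matrixP => j k; rewrite [LHS]mxE [RHS]mulmx3_entry.
pose a (o : option ('I_n * 'I_n)) : C := if o is Some p then - (U j p.1 * adjmx U p.2 k) else 1.
pose nu (o : option ('I_n * 'I_n)) (B : set X) :=
  if o is Some p then rep p.1 p.2 B else rep j k (act U @` B).
have cU := act_continuous act_within uU; have cV := act_continuous act_within uV.
have KU := actK act1 actM uU; have VK := actVK act1 actM uU.
have rnu o : radon_cmeasure (nu o).
  case: o => [p|]; first exact: rep_radon.
  by apply: (radon_image (h' := act (adjmx U))) => //; exact: rep_radon.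
have sumo (F : option ('I_n * 'I_n) -> C) : \sum_o a o * F o =
    F None - \sum_b \sum_c U j b * adjmx U c k * F (Some (b, c)).
  rewrite (bigD1 None)//= mul1r; congr (_ + _).
  rewrite pair_big/= (reindex_omap Some id)/=; last by case.
  rewrite -sumrN; under eq_bigl => p do rewrite eqxx.
  by apply: eq_bigr => -[b c] _ /=; rewrite mulNr.
have rs := radon_sum (index_enum _) a rnu.
have H0 : \sum_o a o * nu o A = 0.
  apply: (radon_uniq hX lX rs _ bA) => p cp.
  have cpC : c0C (fun x => real_complex R (p x)) by split => //; exact: c0_0.
  have cpV : c0C (fun x => real_complex R (p (act (adjmx U) x))).
    by split; [exact: (c0_act act1 actM act_within uV cp)|exact: c0_0].
  rewrite cintegral_measure_sum//; last exact: approximable_c0.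
  pose P x := real_complex R (p x).
  pose G := single k j (fun x => P (act (adjmx U) x)).
  have cG : c0m G by exact: single_c0m.
  have e1 : cintegral (nu None) P = ext_functional G.
    apply: etrans (rep_integral _ _ cpV).
    apply: (cintegral_image cU cV KU VK hX (rep_radon j k)); first exact: approximable_c0.
    exact: approximable_c0C cpV.
  have e2 b c : cintegral (nu (Some (b, c))) P = ext_functional (single c b P).
    exact: (rep_integral _ _ cpC).
  rewrite (sumo (fun o => cintegral (nu o) P)) e1.
  have -> : \sum_b \sum_c U j b * adjmx U c k * cintegral (nu (Some (b, c))) P =
      \sum_b \sum_c U j b * adjmx U c k * ext_functional (single c b P).
    by apply: eq_bigr => b _; apply: eq_bigr => c _; rewrite e2.
  rewrite -(ext_functional_twist cG uU); apply/eqP; rewrite subr_eq0; apply/eqP.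
  have -> : twist act G U = fun x => \sum_(q : 'I_n * 'I_n)
      (U j q.1 * adjmx U q.2 k) *: single q.2 q.1 P x.
    apply/funext => x; apply/matrixP => r s.
    have sE (c : C) b d : (c *: single b d P x) r s = c * (P x * ((r == b) && (s == d))%:R).
      by rewrite mxE singleE.
    rewrite twistE summxE (bigD1 k)//= [X in _ + X]big1 ?addr0; last first.
      by move=> b bk; rewrite big1// => c _; rewrite singleE (negbTE bk) /= !mulr0.
    rewrite (bigD1 j)//= [X in _ + X]big1 ?addr0; last first.
      by move=> c cj; rewrite singleE (negbTE cj) andbF !mulr0.
    rewrite singleE !eqxx mulr1 KU.
    rewrite (bigD1 (s, r))//= [X in _ = _ + X]big1 ?addr0; last first.
      move=> [b c] bc; rewrite sE /=.
      have -> : (r == c) && (s == b) = false.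
        by apply: contraNF bc => /andP[/eqP -> /eqP ->].
      by rewrite !mulr0.
    by rewrite sE !eqxx mulr1 [adjmx U r k * _]mulrC.
  rewrite ext_functional_sum; last by move=> q; exact: single_c0m.
  by rewrite pair_big.
move: H0; rewrite (sumo (fun o => nu o A)) /nu => /eqP; rewrite subr_eq0 => /eqP ->.
by apply: eq_bigr => b _; apply: eq_bigr => c _; rewrite mxE.
Qed.

Lemma rep_nmeasure : nmeasure act rep.
Proof.
split; last exact: rep_act.
move=> j k; have r := rep_radon j k; split; first by case: r.
exact: radon_regular.
Qed.

(** [nu] represents [ext_functional] on all of C_0(X, M_n); testing on [single k j p] isolates the
    entry [nu j k], and [radon_uniq] is applied to its difference with [rep j k]. *)
Lemma nmeasure_uniq nu : nmeasure act nu ->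
  (forall f, Cstar act f -> phi f = nintegral nu f) ->
  forall j k A, borel A -> nu j k A = rep j k A.
Proof.
move=> [reg eqv] Hphi j k A bA.
have rnu a b : radon_cmeasure (nu a b) by have [? ?] := reg a b; exact: regular_radon.
have key f : c0m f -> nintegral nu f = ext_functional f.
  move=> cf; rewrite -(nintegral_Eavg rnu hX act1 actM act_within eqv cf) -Hphi//.
  exact: Eavg_Cstar.
have rd := radon_lin (- 1) (rnu j k) (rep_radon j k).
have := radon_uniq hX lX rd _ bA; rewrite mulN1r => H.
apply/eqP; rewrite -subr_eq0; apply/eqP; apply: H => p cp.
have cpC : c0C (fun x => real_complex R (p x)) by split => //; exact: c0_0.
pose a (b : bool) : C := if b then 1 else -1.
pose m (b : bool) := if b then nu j k else rep j k.
have -> : (fun B => nu j k B + -1 * rep j k B) = fun B => \sum_b a b * m b B.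
  by apply/funext => B; rewrite big_bool /= mul1r.
rewrite cintegral_measure_sum; [|by case; [exact: rnu|exact: rep_radon]|exact: approximable_c0].
rewrite big_bool /= mul1r mulN1r (rep_integral _ _ cpC) -key; last exact: single_c0m.
by rewrite nintegral_single// subrr.
Qed.

End Extension.

(** Measures are encoded as functions on all subsets of [X], of which [nmeasure] constrains only the
    values on Borel sets; uniqueness is accordingly equality on Borel sets. *)
Theorem theorem4p2 (R : realType) (n : nat) (X : topologicalType)
    (act : 'M[R[i]]_n -> X -> X) (phi : (X -> 'M[R[i]]_n) -> R[i]) :
  nspace act -> cont_lin_functional act phi ->
  exists mu : 'I_n -> 'I_n -> set X -> R[i],
    [/\ nmeasure act mu,
        (forall f, Cstar act f -> phi f = nintegral mu f) &
        (forall mu' : 'I_n -> 'I_n -> set X -> R[i],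
           nmeasure act mu' -> (forall f, Cstar act f -> phi f = nintegral mu' f) ->
           forall j k A, borel A -> mu' j k A = mu j k A)].
Proof.
move=> [[hX lX act1 actM _] [act_within _]] phi_lin.
exists (rep hX lX act1 actM act_within phi_lin); split.
- exact: rep_nmeasure.
- move=> f /c0m_Cstar[cf ef]; rewrite rep_nintegral// /ext_functional; congr phi.
  by apply/funext => x; rewrite Eavg_id.
- by move=> mu' nmu' Hmu' j k A; exact: nmeasure_uniq.
Qed.
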